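(* Let $w: [0,+\infty)\to(0,+\infty)$ be a weight function. Then the following properties are equivalent: (1) the radial weight $w$ on $\mathbb{C}$ is approximable by a holomorphic map, that is, there exist $n\in\mathbb{N}$ and a holomorphic map $f:\mathbb{C}\to\mathbb{C}^n$ such that $|f(z)|\asymp w(z)$, $z\in\mathbb{C}$; (2) $w$ is essential, that is, $\widetilde{w}(t)\asymp w(t)$, $0\le t<+\infty$; (3) $w$ is approximable by the maximum of a holomorphic function modulus, that is, there exists an entire function $f:\mathbb{C}\to\mathbb{C}$ such that $M_f(t)\asymp w(t)$, $0\le t<+\infty$, where $M_f(t)=\max\{|f(z)|:|z|=t\}$; (4) $w$ is approximable by power series with positive coefficients, that is, there exist $a_k\ge 0$, $k=0,1,\dots$, such that $\sum_{k=0}^\infty a_k t^k\asymp w(t)$, $0\le t<+\infty$; (5) $w$ is equivalent to a log-tropical weight function, that is, there exists a log-tropical weight function $v:[0,+\infty)\to(0,+\infty)$ with $v(t)\asymp w(t)$, $0\le t<+\infty$.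
   Context: A weight function $w:[0,+\infty)\to(0,+\infty)$ is a non-decreasing, continuous and unbounded function. It is extended to a radial weight on $\mathbb{C}$ by $w(z)=w(|z|)$. For functions $u,v:X\to(0,+\infty)$ on a set $X$, $u\asymp v$ (''$u$ and $v$ are equivalent'') means that there are constants $C_1,C_2>0$ with $C_1u(x)\le v(x)\le C_2u(x)$ for all $x\in X$. For a vector in $\mathbb{C}^n$, $|\cdot|$ is the Euclidean norm. The associated weight is $\widetilde{w}(z)=\sup\{|f(z)|: f \text{ entire on }\mathbb{C},\ |f|\le w\text{ on }\mathbb{C}\}$, $z\in\mathbb{C}$. It is radial, so it defines a function $\widetilde{w}(t)$, $t\ge 0$, with $\widetilde{w}(z)=\widetilde{w}(|z|)$. A tropical power series on $\mathbb{R}$ is a function of the form $\Psi(x)=\sup_{j\in E}(b_j+jx)$, $x\in\mathbb{R}$, where $E\subset\mathbb{Z}_+=\{0,1,2,\dots\}$ is an arbitrary subset, $b_j\in\mathbb{R}$ for $j\in E$, and the supremum is finite for all $x\in\mathbb{R}$. A weight function $v:[0,+\infty)\to(0,+\infty)$ is log-tropical if its logarithmic transform $\Phi_v(x)=\log v(e^x)$, $x\in\mathbb{R}$, is a tropical power series. *)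

(* Defs.v *)
From Stdlib Require Export Reals.
From Stdlib Require Import Lra.
From Coquelicot Require Export Coquelicot.

Open Scope R_scope.

(* Functions on [0, +oo) are represented by total functions R -> R; every
   notion below only looks at the values at arguments t >= 0. *)
Definition nonneg (t : R) : Prop := 0 <= t.

(* [continuous_on nonneg] restricts the limit to [0, +oo), so continuity at 0
   is one-sided. *)
Definition weight_function (w : R -> R) : Prop :=
  (forall t, 0 <= t -> 0 < w t) /\
  (forall s t, 0 <= s -> s <= t -> w s <= w t) /\
  continuous_on nonneg w /\
  (forall A : R, exists t, 0 <= t /\ A < w t).

Definition equivalent_on {X : Type} (D : X -> Prop) (u v : X -> R) : Prop :=
  exists C1 C2 : R, 0 < C1 /\ 0 < C2 /\
    forall x, D x -> C1 * u x <= v x /\ v x <= C2 * u x.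

Definition entire (f : C -> C) : Prop :=
  forall z : C, @ex_derive C_AbsRing C_NormedModule f z.

Fixpoint sum_sqr_Cmod {n : nat} : Tn n C -> R :=
  match n with
  | O => fun _ => 0
  | S _ => fun v => Cmod (fst v) ^ 2 + sum_sqr_Cmod (snd v)
  end.

Definition euclidean_norm {n : nat} (v : Tn n C) : R := sqrt (sum_sqr_Cmod v).

Definition holomorphic_map {n : nat} (f : C -> Tn n C) : Prop :=
  forall k : nat, (k < n)%nat -> entire (fun z => coeff_Tn (RtoC 0) (f z) k).

(* The set is nonempty (take f = 0) and bounded above by w |z|, so its
   supremum is a real number whenever w >= 0 on [0, +oo). *)
Definition associated_weight (w : R -> R) (z : C) : R :=
  real (Lub_Rbar (fun y => exists f : C -> C,
    entire f /\ (forall u : C, Cmod (f u) <= w (Cmod u)) /\ y = Cmod (f z))).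

(* For entire f and t >= 0 this supremum is a maximum: see [max_modulus_max]. *)
Definition max_modulus (f : C -> C) (t : R) : R :=
  real (Lub_Rbar (fun y => exists z : C, Cmod z = t /\ y = Cmod (f z))).

(* As [is_lub] asks for a real supremum, it also excludes an empty E. *)
Definition tropical_power_series (Psi : R -> R) : Prop :=
  exists (E : nat -> Prop) (b : nat -> R), forall x : R,
    is_lub (fun y => exists j : nat, E j /\ y = b j + INR j * x) (Psi x).

Definition log_tropical (v : R -> R) : Prop :=
  tropical_power_series (fun x => ln (v (exp x))).

Definition approximable_by_holomorphic_map (w : R -> R) : Prop :=
  exists (n : nat) (f : C -> Tn n C), (1 <= n)%nat /\ holomorphic_map f /\
    equivalent_on (fun _ : C => True)
      (fun z => euclidean_norm (f z)) (fun z => w (Cmod z)).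

Definition essential (w : R -> R) : Prop :=
  equivalent_on nonneg (fun t => associated_weight w (RtoC t)) w.

Definition approximable_by_max_modulus (w : R -> R) : Prop :=
  exists f : C -> C, entire f /\ equivalent_on nonneg (max_modulus f) w.

Definition approximable_by_power_series (w : R -> R) : Prop :=
  exists a : nat -> R, (forall k, 0 <= a k) /\
    (forall t, 0 <= t -> ex_pseries a t) /\
    equivalent_on nonneg (PSeries a) w.

Definition equivalent_to_log_tropical (w : R -> R) : Prop :=
  exists v : R -> R, weight_function v /\ log_tropical v /\
    equivalent_on nonneg v w.

Lemma entire_Cmod_continuous (f : C -> C) (z : C) (eps : R) :
  entire f -> 0 < eps ->
  exists d, 0 < d /\
    forall y, Cmod (y - z) < d -> Rabs (Cmod (f y) - Cmod (f z)) < eps.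
Proof.
intros Hf He.
pose proof (@ex_derive_continuous C_AbsRing C_NormedModule f z (Hf z)) as Hc.
pose proof (proj1 (filterlim_locally_ball_norm
  (K := C_AbsRing) (U := C_NormedModule) f (f z)) Hc (mkposreal eps He)) as [d Hd].
exists d; split; [apply cond_pos|].
intros y Hy.
specialize (Hd y Hy).
change (Cmod (f y - f z) < eps) in Hd.
apply Rle_lt_trans with (2 := Hd).
apply Rabs_le; split.
- pose proof (Cmod_triangle (f y) (f z - f y)) as H.
  replace (f y + (f z - f y))%C with (f z) in H by ring.
  replace (f z - f y)%C with (- (f y - f z))%C in H by ring.
  rewrite Cmod_opp in H; lra.
- pose proof (Cmod_triangle (f z) (f y - f z)) as H.
  replace (f z + (f y - f z))%C with (f y) in H by ring.
  lra.
Qed.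

Lemma circle_param (z : C) :
  exists x, - PI <= x <= PI /\ z = (Cmod z * cos x, Cmod z * sin x).
Proof.
destruct (Req_dec (Cmod z) 0) as [Hz|Hz].
  exists 0; split; [pose proof PI_RGT_0; lra|].
  rewrite Hz, (Cmod_eq_0 z Hz), !Rmult_0_l; reflexivity.
pose proof (Cmod_ge_0 z) as Hge.
assert (Hp : 0 < Cmod z) by lra.
destruct z as [a b].
set (r := Cmod (a, b)) in *.
assert (Hr : r * r = a * a + b * b).
{ unfold r, Cmod; simpl; rewrite sqrt_sqrt; [ring | nra]. }
assert (Hc : -1 <= a / r <= 1).
{ split; apply Rmult_le_reg_r with r; try exact Hp; unfold Rdiv;
    rewrite Rmult_assoc, Rinv_l, Rmult_1_r by lra; nra. }
pose proof (acos_bound (a / r)) as Ha.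
assert (Hs : (r * sin (acos (a / r))) * (r * sin (acos (a / r))) = b * b).
{ pose proof (sin2_cos2 (acos (a / r))) as H.
  rewrite cos_acos in H by exact Hc; unfold Rsqr in H.
  replace (r * sin (acos (a / r)) * (r * sin (acos (a / r))))
    with (r * r * (1 - a / r * (a / r))) by (rewrite <- H; ring).
  replace (r * r * (1 - a / r * (a / r))) with (r * r - a * a)
    by (field; lra).
  lra. }
pose proof (sin_ge_0 (acos (a / r)) (proj1 Ha) (proj2 Ha)) as Hsg.
assert (Hrs : 0 <= r * sin (acos (a / r))) by (apply Rmult_le_pos; lra).
destruct (Rle_dec 0 b) as [Hb|Hb].
- exists (acos (a / r)); split; [lra|].
  rewrite cos_acos by exact Hc.
  f_equal; [field; lra | nra].
- exists (- acos (a / r)); split; [lra|].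
  rewrite cos_neg, sin_neg, cos_acos by exact Hc.
  f_equal; [field; lra | nra].
Qed.

Lemma max_modulus_max (f : C -> C) (t : R) :
  entire f -> 0 <= t ->
  (exists z, Cmod z = t /\ Cmod (f z) = max_modulus f t) /\
  (forall z, Cmod z = t -> Cmod (f z) <= max_modulus f t).
Proof.
intros Hf Ht.
set (p := fun x => (t * cos x, t * sin x) : C).
assert (Hp : forall x, Cmod (p x) = t).
{ intros x; unfold p, Cmod; simpl.
  replace (t * cos x * (t * cos x * 1) + t * sin x * (t * sin x * 1))
    with (t * t * (Rsqr (sin x) + Rsqr (cos x))) by (unfold Rsqr; ring).
  rewrite sin2_cos2, Rmult_1_r; apply sqrt_square; exact Ht. }
assert (Hcont : forall x, - PI <= x <= PI ->
  continuity_pt (fun x => Cmod (f (p x))) x).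
{ intros x _.
  apply continuity_pt_locally; intros eps.
  destruct (entire_Cmod_continuous f (p x) eps Hf (cond_pos eps)) as [d [Hd H]].
  assert (H1 : continuity_pt (fun y => t * cos y) x).
  { apply continuity_pt_scal with (f := cos); apply continuity_cos. }
  assert (H2 : continuity_pt (fun y => t * sin y) x).
  { apply continuity_pt_scal with (f := sin); apply continuity_sin. }
  assert (Hd2 : 0 < d / 2) by lra.
  apply continuity_pt_locally with (eps := mkposreal _ Hd2) in H1.
  apply continuity_pt_locally with (eps := mkposreal _ Hd2) in H2.
  generalize (filter_and _ _ H1 H2); apply filter_imp; simpl.
  intros y [A B]; apply H.
  replace (p y - p x)%C with
    (t * cos y - t * cos x, t * sin y - t * sin x)%R by reflexivity.
  unfold Cmod; simpl.
  apply Rabs_lt_between in A; apply Rabs_lt_between in B.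
  rewrite <- (sqrt_square d) by lra.
  set (a := t * cos y - t * cos x) in *; set (b := t * sin y - t * sin x) in *.
  assert (0 < (d / 2 - a) * (d / 2 + a)) by (apply Rmult_lt_0_compat; lra).
  assert (0 < (d / 2 - b) * (d / 2 + b)) by (apply Rmult_lt_0_compat; lra).
  apply sqrt_lt_1_alt; split; nra. }
destruct (continuity_ab_maj _ (- PI) PI ltac:(pose proof PI_RGT_0; lra) Hcont)
  as [m [Hmax _]].
assert (Hub : forall z, Cmod z = t -> Cmod (f z) <= Cmod (f (p m))).
{ intros z Hz; destruct (circle_param z) as [x [Hx Ez]].
  rewrite Hz in Ez; rewrite Ez; exact (Hmax x Hx). }
assert (E : max_modulus f t = Cmod (f (p m))).
{ unfold max_modulus.
  rewrite (is_lub_Rbar_unique _ (Finite (Cmod (f (p m))))); [reflexivity|].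
  split.
  - intros y [z [Hz ->]]; exact (Hub z Hz).
  - intros M HM; apply HM; exists (p m); auto. }
rewrite E; split; [exists (p m); auto | exact Hub].
Qed.

(* Main.v *)
Require Import Defs.
From Stdlib Require Import Arith Lra Lia Psatz Classical ClassicalEpsilon.

Open Scope R_scope.

(** Every property of the theorem says that the weight [w] is governed by the
    monomials [c * t ^ k] lying below it. Let [envelope_coeff w k] be the
    largest [c >= 0] with [c * t ^ k <= w t] for all [t >= 0], and say that
    [w] is [enveloped_by_monomials] when, up to a constant, [w t] is at most
    one of these largest monomials at [t]. All the implications pass through
    this property.

    Equivalence to a log-tropical weight amounts to it: the supremum of the
    monomials below [w] is a log-tropical weight, and conversely each affine
    piece of a log-tropical weight equivalent to [w] is, up to a constant, a
    monomial below [w].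

    From the envelope to power series and holomorphic maps. The sum of all the
    monomials [envelope_coeff w k * t ^ k] may be much larger than [w],
    because many of them can be comparable at the same point (for [exp], about
    [sqrt t] of them). A greedy scan therefore keeps an exponent only if,
    without it, the intermediate monomials would exceed [100] times the larger
    of their two neighbours. The kept monomials still cover the envelope up to
    the factor [100] ([selected_cover]) and decay geometrically, in the number
    of kept exponents, on both sides of the exponent that is largest at the
    given point ([selected_decay]). Their sum is thus a power series
    equivalent to [w]. Distributing the kept exponents into [8] classes modulo
    [8] makes them so sparse that at each radius one of the [8] power series
    is dominated by a single term ([dominant_class]); the [8] series form a
    holomorphic map whose norm is equivalent to [w].

    A power series with nonnegative coefficients attains its maximum modulus
    on the positive axis, so it also approximates [w] in the sense of
    [approximable_by_max_modulus]. If [w] is approximable by a maximum modulus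
    or by a holomorphic map, it is essential, since multiples of the functions
    at hand compete in the definition of the associated weight.

    From essential weights to the envelope ([entire_bound_by_monomials]).
    Suppose that at a point [t] no monomial of size [S] lies below [w]: for
    each [j] there is a radius [r j] with [w (r j) < S * (r j / t) ^ j]. Every
    entire [f] with [|f| <= w] then satisfies [|f t| <= 4 * S]. Indeed, take
    the first [j] with [t <= r j]; the two circles of radii [r (j - 1) < t <=
    r j] carry bounds with consecutive exponents. If both are far from [t],
    Cauchy's formula in the annulus applied to [f u / u ^ j] gives the bound,
    because an integer power is available exactly between the two exponents
    ([two_circle_gap]); if one of them is within a factor [2] of [t], its
    bound can be rewritten with the exponent of the other and the maximum
    principle for [f u / u ^ k] applies ([two_circle_maximum]). Hence the
    associated weight is at most [4 * S] at [t].

    The complex analysis needed is the inequality [annulus_estimate]. It rests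
    on the constancy in [r] of the integral of a holomorphic function over the
    circle of radius [r], which is Goursat's theorem for a rectangle in the
    logarithmic coordinates [exp x * (cos y, sin y)], proved by bisection; one
    exceptional point where the function is merely continuous is allowed, so
    that difference quotients can be integrated. *)

(** * Thinning a family of monomials *)

Section Selection.
Variable A : nat -> R.
Hypothesis A_ge0 : forall k, 0 <= A k.
Notation term k t := (A k * t ^ k).

(** The monomials increase up to the exponent [m] and decrease after it, so [m]
    is where the Newton polygon of [A] is attained at [y]. *)
Definition is_peak (y : R) (m : nat) : Prop :=
  (forall i j, (i <= j <= m)%nat -> term i y <= term j y) /\
  (forall i j, (m <= i <= j)%nat -> term j y <= term i y).

Lemma term_ge0 k t : 0 <= t -> 0 <= term k t.
Proof. intros; apply Rmult_le_pos; [apply A_ge0 | apply pow_le; assumption]. Qed.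

Lemma term_ratio_mono i j s y : (i <= j)%nat -> 0 <= s -> s <= y ->
  term j s * term i y <= term j y * term i s.
Proof.
intros Hij Hs Hsy.
replace j with (i + (j - i))%nat by lia; set (d := (j - i)%nat).
rewrite !pow_add.
assert (Hp : s ^ d <= y ^ d) by (apply pow_incr; lra).
assert (0 <= A (i + d) * A i * s ^ i * y ^ i).
{ repeat apply Rmult_le_pos; try apply A_ge0; apply pow_le; lra. }
nra.
Qed.

(** The monomials [p] and [q] alone cover all those between them, up to the
    factor [100]; the set of exponents in between can be discarded. *)
Definition bridged (p q : nat) : Prop :=
  forall t m, 0 < t -> (p <= m <= q)%nat ->
    term m t <= 100 * Rmax (term p t) (term q t).

(** Greedy scan of the exponents: [k] is kept when discarding it would leave a
    gap, from the last kept exponent to [k + 1], that is not [bridged].  As the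
    test for [k] only looks at [k + 1], the scan needs no search for the next
    kept exponent, which may fail to exist. *)
Fixpoint last_selected (k : nat) : nat :=
  match k with
  | O => O
  | S k' => if excluded_middle_informative (bridged (last_selected k') (S k))
            then last_selected k' else k
  end.

Definition selected (k : nat) : Prop := last_selected k = k.

(** Number of kept positive exponents up to [k]. *)
Fixpoint selection_rank (k : nat) : nat :=
  match k with
  | O => O
  | S k' => if Nat.eq_dec (last_selected k) k
            then S (selection_rank k') else selection_rank k'
  end.

Lemma last_selected_le k : (last_selected k <= k)%nat.
Proof.
induction k as [|k IH]; simpl; [lia|].
destruct (excluded_middle_informative _); lia.
Qed.

Lemma last_selected_S k :
  (last_selected (S k) = last_selected k /\
   bridged (last_selected k) (S (S k)) /\ ~ selected (S k)) \/
  (selected (S k) /\ ~ bridged (last_selected k) (S (S k))).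
Proof.
unfold selected; simpl.
destruct (excluded_middle_informative _) as [H|H]; [left|right]; auto.
pose proof (last_selected_le k); repeat split; auto; lia.
Qed.

Lemma selection_rank_S k :
  (selected (S k) -> selection_rank (S k) = S (selection_rank k)) /\
  (~ selected (S k) -> selection_rank (S k) = selection_rank k).
Proof.
unfold selected; cbn [selection_rank].
destruct (Nat.eq_dec _ _); split; intros; tauto.
Qed.

Lemma last_selected_selected k :
  selected (last_selected k) /\
  selection_rank (last_selected k) = selection_rank k.
Proof.
induction k as [|k IH]; [split; reflexivity|].
destruct (last_selected_S k) as [[E [_ N]]|[H _]].
- rewrite E, (proj2 (selection_rank_S k) N); exact IH.
- unfold selected in H; rewrite H; split; [exact H|reflexivity].
Qed.

(** Invariant of the scan: consecutive exponents are always bridged, and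
    skipping an exponent is only allowed when the longer gap is bridged. *)
Lemma bridged_last_selected k : bridged (last_selected k) (S k).
Proof.
assert (Hadj : forall p, bridged p (S p)).
{ intros p t m Ht Hm.
  pose proof (term_ge0 p t ltac:(lra)); pose proof (term_ge0 (S p) t ltac:(lra)).
  pose proof (Rmax_l (term p t) (term (S p) t)).
  pose proof (Rmax_r (term p t) (term (S p) t)).
  assert (m = p \/ m = S p) as [->| ->] by lia; lra. }
destruct k as [|k]; [apply Hadj|].
destruct (last_selected_S k) as [[E [B _]]|[H _]].
- rewrite E; exact B.
- unfold selected in H; rewrite H; apply Hadj.
Qed.

Lemma selection_rank_mono j k : (j <= k)%nat ->
  (selection_rank j <= selection_rank k)%nat.
Proof.
induction 1 as [|k _ IH]; [lia|].
destruct (selection_rank_S k) as [H1 H2].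
destruct (classic (selected (S k))) as [H|H];
  [rewrite (H1 H)|rewrite (H2 H)]; lia.
Qed.

Lemma selection_rank_lt j k : selected k -> (j < k)%nat ->
  (selection_rank j < selection_rank k)%nat.
Proof.
intros Hk Hj; destruct k as [|k]; [lia|].
rewrite (proj1 (selection_rank_S k) Hk).
pose proof (selection_rank_mono j k ltac:(lia)); lia.
Qed.

Lemma selected_le_last j k : selected j -> (j <= k)%nat ->
  (j <= last_selected k)%nat.
Proof.
intros Hj Hjk.
destruct (le_lt_dec j (last_selected k)) as [H|H]; [exact H|exfalso].
pose proof (selection_rank_lt _ _ Hj H).
rewrite (proj2 (last_selected_selected k)) in H0.
pose proof (selection_rank_mono j k Hjk); lia.
Qed.

(** If [S q] is kept and [p] is the kept exponent before it, the gap from [p] to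
    [S (S q)] is not bridged: at some [tau] an intermediate monomial [mu] is
    more than [100] times larger than both [p] and [S (S q)].  Since quotients
    of monomials are monotone in the point, the advantage of [mu] over
    [S (S q)] persists to the left of [tau], and its advantage over [p] to the
    right.  The position of the peak tells on which side of [tau] the point [y]
    lies.  So passing two kept exponents away from the peak costs a factor
    [100]. *)
Lemma selection_decay q s y m : is_peak y m -> 0 < y ->
  selected (S q) -> (S q < s)%nat ->
  ((m <= last_selected q)%nat -> 100 * term s y <= term (last_selected q) y) /\
  ((s <= m)%nat -> 100 * term (last_selected q) y <= term s y).
Proof.
intros [Hup Hdown] Hy Hq Hs.
destruct (last_selected_S q) as [[_ [_ N]]|[_ N]]; [contradiction|].
pose proof (last_selected_le q) as Hpq.
set (p := last_selected q) in *.
apply not_all_ex_not in N as [tau N].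
apply not_all_ex_not in N as [mu N].
apply imply_to_and in N as [Htau N].
apply imply_to_and in N as [Hmu N].
apply Rnot_le_lt in N.
(* [tau] and [mu] witness that the gap from [p] to [S (S q)] is not bridged *)
pose proof (Rmax_l (term p tau) (term (S (S q)) tau)) as Hl.
pose proof (Rmax_r (term p tau) (term (S (S q)) tau)) as Hr.
pose proof (term_ge0 p tau ltac:(lra)) as Gp.
pose proof (term_ge0 (S (S q)) tau ltac:(lra)) as Gq.
set (M := Rmax _ _) in *.
assert (Hmuq : (mu <= S q)%nat).
{ destruct (Nat.eq_dec mu (S (S q))) as [->|]; [lra|lia]. }
split; intros Hm.
- pose proof (term_ge0 p y ltac:(lra)) as Gpy.
  assert (D1 := Hdown p mu ltac:(lia)).
  assert (D2 := Hdown (S (S q)) s ltac:(lia)).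
  pose proof (term_ge0 s y ltac:(lra)) as Gs.
  destruct (Req_dec (term p y) 0) as [Z|Z].
  { assert (D3 := Hdown p s ltac:(lia)); lra. }
  assert (Hlt : y < tau).
  { apply Rnot_le_lt; intros Hle.
    pose proof (term_ratio_mono p mu tau y ltac:(lia) ltac:(lra) Hle) as Hmono.
    nra. }
  pose proof (term_ratio_mono mu (S (S q)) y tau ltac:(lia) ltac:(lra) ltac:(lra)) as Hmono.
  pose proof (term_ge0 mu y ltac:(lra)) as Gm.
  assert (100 * term (S (S q)) y <= term mu y); [|lra].
  apply Rmult_le_reg_r with (term mu tau); [lra|].
  nra.
- assert (U1 := Hup mu (S (S q)) ltac:(lia)).
  assert (U2 := Hup mu s ltac:(lia)).
  pose proof (term_ge0 mu y ltac:(lra)) as Gm.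
  pose proof (term_ge0 p y ltac:(lra)) as Gpy.
  assert (H0 : 100 * term p y <= term mu y); [|lra].
  destruct (Rle_dec tau y) as [Hle|Hgt].
  + pose proof (term_ratio_mono p mu tau y ltac:(lia) ltac:(lra) Hle) as Hmono.
    apply Rmult_le_reg_r with (term mu tau); [lra|].
    nra.
  + pose proof (term_ratio_mono mu (S (S q)) y tau ltac:(lia) ltac:(lra) ltac:(lra)) as Hmono.
    pose proof (Hup p mu ltac:(lia)).
    assert (term mu y = 0) by nra.
    lra.
Qed.

(** The factor [100] per two steps is written as [1/10] per step; the leading
    [100] absorbs the parity and the first step. *)
Lemma selected_below_peak y m : is_peak y m -> 0 < y ->
  forall k, (k <= m)%nat -> forall j, selected j -> (j <= k)%nat ->
    term j y <= 100 * (1/10) ^ (selection_rank k - selection_rank j) *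
                term (last_selected k) y.
Proof.
intros Hpk Hy k.
induction k as [k IH] using (well_founded_induction lt_wf).
intros Hkm j Hj Hjk.
pose proof (selected_le_last j k Hj Hjk) as Hjl.
pose proof (last_selected_le k) as Hlk.
destruct (last_selected_selected k) as [Hsel Hrank].
pose proof (proj1 Hpk j (last_selected k) ltac:(lia)) as Hle.
pose proof (term_ge0 (last_selected k) y ltac:(lra)) as G.
pose proof (selection_rank_mono j k Hjk) as Hrk.
remember (selection_rank k - selection_rank j)%nat as d eqn:Ed.
(* ranks at distance 0 or 1 only need monotonicity below the peak *)
destruct d as [|[|d]]; [simpl; lra|simpl; lra|].
destruct (last_selected k) as [|q] eqn:El.
{ assert (j = O) by lia; subst j; lia. }
pose proof (proj1 (selection_rank_S q) Hsel) as HrS.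
destruct (last_selected_selected q) as [Hsel' Hrank'].
pose proof (last_selected_le q) as Hlq.
destruct (last_selected q) as [|q'] eqn:El'.
{ simpl in Hrank'; lia. }
pose proof (proj1 (selection_rank_S q') Hsel') as HrS'.
assert (Hjq : (j <= q')%nat).
{ destruct (le_lt_dec j q') as [|Hc]; [assumption|].
  pose proof (selection_rank_mono (S q') j Hc); lia. }
pose proof (IH q' ltac:(lia) ltac:(lia) j Hj Hjq) as H1.
replace (selection_rank q' - selection_rank j)%nat with d in H1 by lia.
pose proof (proj2 (selection_decay q' (S q) y m Hpk Hy Hsel' ltac:(lia)) ltac:(lia)) as H2.
assert (Hk0 : 0 < (1/10) ^ d) by (apply pow_lt; lra).
apply Rle_trans with (1 := H1).
replace ((1/10) ^ S (S d)) with ((1/10) ^ d / 100) by (simpl; field).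
nra.
Qed.

Lemma selected_above_peak y m : is_peak y m -> 0 < y ->
  forall s, selected s -> (m < s)%nat ->
    term s y <= 100 * (1/10) ^ (selection_rank s - selection_rank m) * term m y.
Proof.
intros Hpk Hy s.
induction s as [s IH] using (well_founded_induction lt_wf).
intros Hs Hms.
pose proof (proj2 Hpk m s ltac:(lia)) as Hle.
pose proof (term_ge0 m y ltac:(lra)) as G.
pose proof (selection_rank_lt m s Hs Hms) as Hrk.
remember (selection_rank s - selection_rank m)%nat as d eqn:Ed.
(* above the peak, distances up to 2 are absorbed by the leading constant: the
   decay must start from an exponent strictly above the peak *)
destruct d as [|[|[|d]]]; try (simpl; lra).
destruct s as [|q]; [lia|].
pose proof (proj1 (selection_rank_S q) Hs) as HrS.
destruct (last_selected_selected q) as [Hsel' Hrank'].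
pose proof (last_selected_le q) as Hlq.
destruct (last_selected q) as [|q'] eqn:El'.
{ simpl in Hrank'; lia. }
pose proof (proj1 (selection_rank_S q') Hsel') as HrS'.
destruct (last_selected_selected q') as [Hsel'' Hrank''].
pose proof (last_selected_le q') as Hlq'.
assert (Hmp : (m < last_selected q')%nat).
{ destruct (le_lt_dec (last_selected q') m) as [Hc|]; [|assumption].
  pose proof (selection_rank_mono _ _ Hc); lia. }
pose proof (IH (last_selected q') ltac:(lia) Hsel'' Hmp) as H1.
replace (selection_rank (last_selected q') - selection_rank m)%nat
  with (S d) in H1 by lia.
pose proof (proj1 (selection_decay q' (S q) y m Hpk Hy Hsel' ltac:(lia)) ltac:(lia)) as H2.
replace ((1/10) ^ S (S (S d))) with ((1/10) ^ (S d) / 100) by (simpl; field).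
nra.
Qed.

Definition rank_distance (i j : nat) : nat := ((i - j) + (j - i))%nat.

Lemma selected_decay y m j : is_peak y m -> 0 < y -> selected j ->
  term j y <= 100 * (1/10) ^ (rank_distance (selection_rank j) (selection_rank m)) *
              term m y.
Proof.
intros Hpk Hy Hj; unfold rank_distance.
destruct (le_lt_dec j m) as [H|H].
- pose proof (selection_rank_mono j m H).
  replace (selection_rank j - selection_rank m)%nat with O by lia.
  pose proof (selected_below_peak y m Hpk Hy m (le_n m) j Hj H) as H1.
  apply Rle_trans with (1 := H1), Rmult_le_compat_l.
  + apply Rmult_le_pos; [lra | apply pow_le; lra].
  + apply (proj1 Hpk); split; [apply last_selected_le | lia].
- pose proof (selection_rank_lt m j Hj H).
  replace (selection_rank m - selection_rank j)%nat with O by lia.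
  rewrite Nat.add_0_r; apply selected_above_peak; assumption.
Qed.

(** The peak exponent [m] lies in the gap between its neighbouring kept
    exponents, and that gap is bridged.  When there is no kept exponent after
    [m], the gaps from the last kept one to all later exponents are bridged, and
    the later monomials tend to [0]. *)
Lemma selected_cover y m : is_peak y m -> 0 < y ->
  (forall eps, 0 < eps -> exists N, forall n, (N <= n)%nat -> term n y < eps) ->
  exists j, selected j /\ term m y <= 100 * term j y /\
    (selection_rank m <= selection_rank j <= S (selection_rank m))%nat.
Proof.
intros Hpk Hy Hvan.
destruct (last_selected_selected m) as [Hsel Hrank].
pose proof (last_selected_le m) as Hlm.
destruct (classic (term m y <= 100 * term (last_selected m) y)) as [H|H].
{ exists (last_selected m); repeat split; [exact Hsel|exact H|lia|lia]. }
apply Rnot_le_lt in H.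
pose proof (term_ge0 (last_selected m) y ltac:(lra)) as G.
destruct (classic (exists d, selected (S (m + d)))) as [Hex|Hno].
- assert (Hleast : exists d, selected (S (m + d)) /\
            forall e, (e < d)%nat -> ~ selected (S (m + e))).
  { destruct Hex as [d Hd]; revert Hd.
    induction d as [d IH] using (well_founded_induction lt_wf); intros Hd.
    destruct (classic (exists e, (e < d)%nat /\ selected (S (m + e)))) as [[e [He1 He2]]|N].
    - exact (IH e He1 He2).
    - exists d; split; [exact Hd|intros e He1 He2; apply N; eauto]. }
  destruct Hleast as [d [Hd Hmin]].
  assert (Hconst : forall e, (e <= d)%nat ->
     last_selected (m + e) = last_selected m /\
     selection_rank (m + e) = selection_rank m).
  { induction e as [|e IH]; intros He; [rewrite Nat.add_0_r; auto|].
    destruct (IH ltac:(lia)) as [E1 E2]; rewrite Nat.add_succ_r.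
    pose proof (Hmin e ltac:(lia)) as N.
    destruct (last_selected_S (m + e)) as [[E [_ _]]|[S _]]; [|contradiction].
    rewrite E, (proj2 (selection_rank_S _) N); auto. }
  destruct (Hconst d (le_n d)) as [E1 E2].
  pose proof (bridged_last_selected (m + d) y m Hy) as B.
  rewrite E1 in B; specialize (B ltac:(lia)).
  exists (S (m + d)); split; [exact Hd|].
  rewrite (proj1 (selection_rank_S _) Hd), E2; split; [|lia].
  revert B; apply Rmax_case; lra.
- assert (Hconst : forall e, last_selected (m + e) = last_selected m).
  { induction e as [|e IH]; [rewrite Nat.add_0_r; auto|].
    rewrite Nat.add_succ_r.
    destruct (last_selected_S (m + e)) as [[E _]|[S _]].
    - congruence.
    - exfalso; eauto. }
  destruct (Hvan (term m y / 100) ltac:(lra)) as [N HN].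
  pose proof (bridged_last_selected (m + N) y m Hy) as B.
  rewrite Hconst in B; specialize (B ltac:(lia)).
  specialize (HN (S (m + N)) ltac:(lia)).
  revert B; apply Rmax_case; lra.
Qed.

End Selection.

(** * Sums over the selected exponents *)

Lemma two_sided_geometric_sum c N :
  sum_n (fun i => (1/2) ^ rank_distance i c) N <= 3.
Proof.
assert (H : ((N <= c)%nat ->
             sum_n (fun i => (1/2) ^ rank_distance i c) N <= 2 * (1/2) ^ (c - N)) /\
            ((c <= N)%nat ->
             sum_n (fun i => (1/2) ^ rank_distance i c) N <= 3 - (1/2) ^ (N - c))).
{ unfold rank_distance.
  induction N as [|N [IH1 IH2]].
  - rewrite sum_O; split; intros H.
    + replace (0 - c + (c - 0))%nat with c by lia; rewrite Nat.sub_0_r.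
      assert (0 < (1/2) ^ c) by (apply pow_lt; lra); lra.
    + assert (c = O) by lia; subst c; simpl; lra.
  - rewrite sum_Sn; split; intros H.
    + specialize (IH1 ltac:(lia)).
      replace (c - N)%nat with (S (c - S N)) in IH1 by lia.
      replace (S N - c + (c - S N))%nat with (c - S N)%nat by lia.
      change (sum_n (fun i => (1/2) ^ (i - c + (c - i))) N + (1/2) ^ (c - S N)
              <= 2 * (1/2) ^ (c - S N)).
      simpl pow in IH1; lra.
    + change (sum_n (fun i => (1/2) ^ (i - c + (c - i))) N +
              (1/2) ^ (S N - c + (c - S N)) <= 3 - (1/2) ^ (S N - c)).
      replace (S N - c + (c - S N))%nat with (S N - c)%nat by lia.
      destruct (Nat.eq_dec c (S N)) as [->|Hne].
      * specialize (IH1 ltac:(lia)); rewrite Nat.sub_diag.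
        replace (S N - N)%nat with 1%nat in IH1 by lia; simpl in *; lra.
      * specialize (IH2 ltac:(lia)).
        replace (S N - c)%nat with (S (N - c)) by lia.
        simpl pow; lra. }
destruct (le_lt_dec N c) as [Hc|Hc].
- apply Rle_trans with (1 := proj1 H Hc).
  assert ((1/2) ^ (c - N) <= 1 ^ (c - N)) by (apply pow_incr; lra).
  rewrite pow1 in *; lra.
- assert (H2 := proj2 H ltac:(lia)).
  assert (0 < (1/2) ^ (N - c)) by (apply pow_lt; lra); lra.
Qed.

Lemma sum_n_le_compat (u v : nat -> R) n :
  (forall k, (k <= n)%nat -> u k <= v k) -> sum_n u n <= sum_n v n.
Proof.
induction n as [|n IH]; intros H.
- rewrite !sum_O; apply H; lia.
- rewrite !sum_Sn; apply Rplus_le_compat; [apply IH; intros; apply H; lia|apply H; lia].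
Qed.

Section Selected_coefficients.
Variable A : nat -> R.
Hypothesis A_ge0 : forall k, 0 <= A k.
Notation term k t := (A k * t ^ k).
Notation rank := (selection_rank A).

Definition class_coeff (chi : nat -> Prop) (k : nat) : R :=
  if excluded_middle_informative (selected A k /\ chi (rank k)) then A k else 0.

Lemma class_coeff_ge0 chi k : 0 <= class_coeff chi k.
Proof. unfold class_coeff; destruct (excluded_middle_informative _); [apply A_ge0|lra]. Qed.

Lemma sum_over_ranks (g : nat -> R) n : (forall i, 0 <= g i) ->
  sum_n (fun k => if excluded_middle_informative (selected A k)
                  then g (rank k) else 0) n
  <= sum_n g (rank n).
Proof.
intros Hg; induction n as [|n IH].
- rewrite sum_O; simpl selection_rank; rewrite sum_O.
  destruct (excluded_middle_informative _) as [_|N]; [lra|].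
  exfalso; apply N; reflexivity.
- rewrite sum_Sn; destruct (selection_rank_S A n) as [H1 H2].
  destruct (excluded_middle_informative _) as [S|N].
  + rewrite (H1 S), sum_Sn; apply Rplus_le_compat; [exact IH|lra].
  + rewrite (H2 N).
    apply Rle_trans with (2 := IH); unfold plus; simpl; lra.
Qed.

(** Splitting [(1/10) ^ d] as [(1/5) ^ d * (1/2) ^ d] leaves a summable
    geometric factor and makes the sum over ranks at distance at least [a] of
    the peak as small as [(1/5) ^ a]. *)
Lemma far_ranks_sum y m a (chi : nat -> Prop) n : is_peak A y m -> 0 < y ->
  (forall i, chi i -> (a <= rank_distance i (rank m))%nat) ->
  sum_n (fun k => class_coeff chi k * y ^ k) n <= 300 * (1/5) ^ a * term m y.
Proof.
intros Hpk Hy Hchi.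
set (M := 100 * (1/5) ^ a * term m y).
assert (HM : 0 <= M).
{ unfold M; repeat apply Rmult_le_pos; try apply A_ge0; try lra; apply pow_le; lra. }
apply Rle_trans with
  (sum_n (fun k => if excluded_middle_informative (selected A k)
     then M * (1/2) ^ rank_distance (rank k) (rank m) else 0) n).
- apply sum_n_le_compat; intros k _; unfold class_coeff.
  destruct (excluded_middle_informative (selected A k /\ chi (rank k))) as [[S X]|N].
  + destruct (excluded_middle_informative _) as [_|N]; [|contradiction].
    specialize (Hchi _ X).
    apply Rle_trans with (1 := selected_decay A A_ge0 y m k Hpk Hy S).
    set (d := rank_distance (rank k) (rank m)) in *.
    replace ((1/10) ^ d) with ((1/5) ^ d * (1/2) ^ d)
      by (rewrite <- Rpow_mult_distr; f_equal; lra).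
    assert ((1/5) ^ d <= (1/5) ^ a).
    { replace d with (a + (d - a))%nat by lia; rewrite pow_add.
      assert ((1/5) ^ (d - a) <= 1 ^ (d - a)) by (apply pow_incr; lra).
      rewrite pow1 in *.
      assert (0 < (1/5) ^ a) by (apply pow_lt; lra); nra. }
    unfold M.
    assert (0 < (1/2) ^ d) by (apply pow_lt; lra).
    pose proof (term_ge0 A A_ge0 m y ltac:(lra)).
    assert (0 <= (1/2) ^ d * term m y) by (apply Rmult_le_pos; lra).
    nra.
  + rewrite Rmult_0_l.
    destruct (excluded_middle_informative _); [|lra].
    apply Rmult_le_pos; [exact HM|apply pow_le; lra].
- eapply Rle_trans; [apply (sum_over_ranks (fun i => M * (1/2) ^ rank_distance i (rank m)))|].
  + intros i; apply Rmult_le_pos; [exact HM|apply pow_le; lra].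
  + assert (E : sum_n (fun i => M * (1/2) ^ rank_distance i (rank m)) (rank n) =
               M * sum_n (fun i => (1/2) ^ rank_distance i (rank m)) (rank n))
      by exact (sum_n_mult_l (K := R_Ring) M _ _).
    rewrite E; clear E.
    pose proof (two_sided_geometric_sum (rank m) (rank n)) as H3.
    unfold M in *; set (T := 100 * (1/5) ^ a * term m y) in *.
    replace (300 * (1/5) ^ a * term m y) with (T * 3) by (unfold T; ring).
    apply Rmult_le_compat_l; [exact HM|exact H3].
Qed.

(** The kept exponent [j] covering the peak has the rank of the peak or the
    next one, so the other ranks of its class modulo [8] are at distance at
    least [7] from the rank of the peak; [300 / 5 ^ 7] is below [1 / 200]. *)
Lemma dominant_class y m : is_peak A y m -> 0 < y ->
  (forall eps, 0 < eps -> exists N, forall n, (N <= n)%nat -> term n y < eps) ->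
  exists r j, (r < 8)%nat /\
    let a := class_coeff (fun i => i mod 8 = r) in
    term m y <= 100 * (a j * y ^ j) /\
    forall n, sum_n (fun k => if Nat.eq_dec k j then 0 else a k * y ^ k) n
              <= a j * y ^ j / 2.
Proof.
intros Hpk Hy Hvan.
destruct (selected_cover A A_ge0 y m Hpk Hy Hvan) as [j [Hj [Hcov Hr]]].
exists (rank j mod 8), j; split; [apply Nat.mod_upper_bound; lia|].
set (r := rank j mod 8); intros a.
assert (Ea : a j = A j).
{ unfold a, class_coeff; destruct (excluded_middle_informative _) as [|N]; [reflexivity|].
  exfalso; apply N; split; [exact Hj|reflexivity]. }
rewrite Ea; split; [exact Hcov|intros n].
set (chi := fun i => i mod 8 = r /\ i <> rank j).
apply Rle_trans with (sum_n (fun k => class_coeff chi k * y ^ k) n).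
- apply sum_n_le_compat; intros k _.
  assert (0 < y ^ k) by (apply pow_lt; lra).
  destruct (Nat.eq_dec k j) as [->|Hkj].
  + apply Rmult_le_pos; [apply class_coeff_ge0|lra].
  + apply Rmult_le_compat_r; [lra|].
    unfold a, class_coeff.
    destruct (excluded_middle_informative (selected A k /\ rank k mod 8 = r)) as [[S X]|N].
    * destruct (excluded_middle_informative _) as [_|N]; [lra|].
      exfalso; apply N; split; [exact S|split; [exact X|]].
      intros E; destruct (Nat.lt_total k j) as [L|[L|L]]; [|contradiction|].
      -- pose proof (selection_rank_lt A k j Hj L); lia.
      -- pose proof (selection_rank_lt A j k S L); lia.
    * destruct (excluded_middle_informative _); [apply A_ge0|lra].
- eapply Rle_trans; [apply (far_ranks_sum y m 7 chi n Hpk Hy)|].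
  + intros i [Hi1 Hi2]; unfold rank_distance; unfold r in Hi1.
    pose proof (Nat.div_mod i 8 ltac:(lia)).
    pose proof (Nat.div_mod (rank j) 8 ltac:(lia)).
    assert (i / 8 <> rank j / 8)%nat by (intros E; apply Hi2; lia).
    lia.
  + replace ((1/5) ^ 7) with (1 / 78125) by (simpl; field).
    pose proof (term_ge0 A A_ge0 j y ltac:(lra)); lra.
Qed.

Lemma class_sum_bound y m chi n : is_peak A y m -> 0 < y ->
  sum_n (fun k => class_coeff chi k * y ^ k) n <= 300 * term m y.
Proof.
intros Hpk Hy.
eapply Rle_trans; [apply (far_ranks_sum y m 0 chi n Hpk Hy); intros; lia|].
simpl; lra.
Qed.

End Selected_coefficients.

(** * Monomials below a weight and log-tropical weights *)

Lemma continuous_on_nonneg (w : R -> R) :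
  continuous_on nonneg w <->
  forall x eps, 0 <= x -> 0 < eps -> exists d, 0 < d /\
    forall y, 0 <= y -> Rabs (y - x) < d -> Rabs (w y - w x) < eps.
Proof.
split.
- intros H x eps Hx He.
  pose proof (proj1 (filterlim_locally _ _) (H x Hx) (mkposreal eps He)) as [d Hd].
  exists d; split; [apply cond_pos|intros y Hy Hxy; exact (Hd y Hxy Hy)].
- intros H x Hx; apply filterlim_locally; intros eps.
  destruct (H x eps Hx (cond_pos eps)) as [d [Hd Hw]].
  exists (mkposreal d Hd); intros y Hxy Hy; exact (Hw y Hy Hxy).
Qed.

Section Envelope.
Variable w : R -> R.
Hypothesis w_weight : weight_function w.

Definition below (k : nat) (c : R) : Prop :=
  0 <= c /\ forall s, 0 <= s -> c * s ^ k <= w s.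

Definition envelope_coeff (k : nat) : R := real (Lub_Rbar (below k)).

Lemma envelope_coeff_lub k : is_lub_Rbar (below k) (envelope_coeff k).
Proof.
destruct w_weight as [Hpos _].
unfold envelope_coeff; pose proof (Lub_Rbar_correct (below k)) as [Hu Hl].
assert (H0 : below k 0).
{ split; [lra|intros s Hs; rewrite Rmult_0_l; apply Rlt_le, Hpos, Hs]. }
assert (H1 : Rbar_le (Lub_Rbar (below k)) (w 1)).
{ apply Hl; intros c [_ Hc]; specialize (Hc 1 ltac:(lra)); rewrite pow1 in Hc; simpl; lra. }
specialize (Hu 0 H0) as H2.
destruct (Lub_Rbar (below k)) as [r| |]; simpl in *; try contradiction.
split; [exact Hu|exact Hl].
Qed.

Lemma below_le_envelope k c : below k c -> c <= envelope_coeff k.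
Proof. exact (proj1 (envelope_coeff_lub k) c). Qed.

Lemma envelope_below k : below k (envelope_coeff k).
Proof.
pose proof w_weight as [Hpos _].
destruct (envelope_coeff_lub k) as [Hu Hl].
assert (H0 : below k 0).
{ split; [lra|intros s Hs; rewrite Rmult_0_l; apply Rlt_le, Hpos, Hs]. }
split; [exact (Hu 0 H0)|].
intros s Hs.
destruct (Req_dec (s ^ k) 0) as [Z|Z]; [rewrite Z, Rmult_0_r; apply Rlt_le, Hpos, Hs|].
assert (Hp : 0 < s ^ k) by (pose proof (pow_le s k Hs); lra).
apply Rmult_le_reg_r with (/ s ^ k); [apply Rinv_0_lt_compat, Hp|].
rewrite Rmult_assoc, Rinv_r, Rmult_1_r by exact Z.
apply (Hl (w s * / s ^ k)); intros c [_ Hc]; simpl.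
apply Rmult_le_reg_r with (s ^ k); [exact Hp|].
rewrite Rmult_assoc, Rinv_l, Rmult_1_r by exact Z; apply Hc, Hs.
Qed.

Lemma envelope_coeff_ge0 k : 0 <= envelope_coeff k.
Proof. apply envelope_below. Qed.

Notation term k t := (envelope_coeff k * t ^ k).

Lemma envelope_coeff_0 : envelope_coeff 0 = w 0.
Proof.
destruct w_weight as [Hpos [Hmono _]].
apply Rle_antisym.
- pose proof (proj2 (envelope_below 0) 0 (Rle_refl 0)); simpl in *; lra.
- apply below_le_envelope; split; [apply Rlt_le, Hpos; lra|].
  intros s Hs; simpl; rewrite Rmult_1_r; apply Hmono; lra.
Qed.

(** If [c] bounds from below the monomials [i] and [k] at [y], the monomial
    [c * (s / y) ^ j] lies below the monomial [i] for [s <= y] and below the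
    monomial [k] for [s >= y], hence below [w] everywhere. *)
Lemma envelope_quasiconcave i j k y : (i <= j <= k)%nat -> 0 < y ->
  Rmin (term i y) (term k y) <= term j y.
Proof.
intros Hijk Hy.
set (c := Rmin (term i y) (term k y)).
assert (Hyj : 0 < y ^ j) by (apply pow_lt, Hy).
assert (Hc0 : 0 <= c).
{ apply Rmin_glb; apply Rmult_le_pos; try apply envelope_coeff_ge0; apply pow_le; lra. }
assert (H : c / y ^ j <= envelope_coeff j).
{ apply below_le_envelope; split.
  { apply Rmult_le_pos; [exact Hc0|apply Rlt_le, Rinv_0_lt_compat, Hyj]. }
  intros s Hs.
  assert (Hci : c <= term i y) by apply Rmin_l.
  assert (Hck : c <= term k y) by apply Rmin_r.
  assert (Hs' : s ^ j * c <= y ^ j * w s).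
  { destruct (Rle_dec s y) as [Hsy|Hsy].
    - apply Rle_trans with (y ^ j * term i s).
      + replace j with (i + (j - i))%nat by lia; rewrite !pow_add.
        assert (s ^ (j - i) <= y ^ (j - i)) by (apply pow_incr; lra).
        pose proof (pow_le s i Hs); pose proof (pow_le s (j - i) Hs).
        assert (0 <= s ^ i * s ^ (j - i)) by (apply Rmult_le_pos; assumption).
        apply Rle_trans with (s ^ i * s ^ (j - i) * (term i y)).
        { apply Rmult_le_compat_l; assumption. }
        assert (0 <= s ^ i * (term i y)).
        { apply Rmult_le_pos; [assumption|]; lra. }
        nra.
      + apply Rmult_le_compat_l; [lra|]; apply envelope_below, Hs.
    - apply Rle_trans with (y ^ j * term k s).
      + replace k with (j + (k - j))%nat in Hck |- * by lia.
        set (d := (k - j)%nat) in *; set (E := envelope_coeff (j + d)) in *.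
        rewrite !pow_add in *.
        assert (y ^ d <= s ^ d) by (apply pow_incr; lra).
        pose proof (pow_le s j Hs).
        apply Rle_trans with (s ^ j * (E * (y ^ j * y ^ d))).
        { apply Rmult_le_compat_l; assumption. }
        assert (0 <= s ^ j * E * y ^ j).
        { repeat apply Rmult_le_pos; try lra; apply envelope_coeff_ge0. }
        nra.
      + apply Rmult_le_compat_l; [lra|]; apply envelope_below, Hs. }
  apply Rmult_le_reg_r with (y ^ j); [exact Hyj|].
  replace (c / y ^ j * s ^ j * y ^ j) with (s ^ j * c) by (field; lra); lra. }
apply Rmult_le_compat_r with (r := y ^ j) in H; [|lra].
replace (c / y ^ j * y ^ j) with c in H by (field; lra); exact H.
Qed.

(** The monomials are bounded by [w] at [2 * y], so at [y] they are at most
    [w (2 * y) / 2 ^ n]. *)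
Lemma envelope_terms_vanish y : 0 < y -> forall eps, 0 < eps ->
  exists N, forall n, (N <= n)%nat -> term n y < eps.
Proof.
intros Hy eps He.
destruct w_weight as [Hpos _].
assert (Hw : 0 < w (2 * y)) by (apply Hpos; lra).
destruct (pow_lt_1_zero (1/2) ltac:(rewrite Rabs_pos_eq; lra) (eps / w (2 * y))
  ltac:(apply Rdiv_lt_0_compat; lra)) as [N HN].
exists N; intros n Hn; specialize (HN n Hn).
rewrite Rabs_pos_eq in HN by (apply pow_le; lra).
pose proof (proj2 (envelope_below n) (2 * y) ltac:(lra)) as H.
replace (y ^ n) with ((1/2) ^ n * (2 * y) ^ n)
  by (rewrite <- Rpow_mult_distr; f_equal; lra).
assert (0 < (1/2) ^ n) by (apply pow_lt; lra).
apply Rle_lt_trans with ((1/2) ^ n * w (2 * y)); [nra|].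
apply Rmult_lt_compat_r with (r := w (2 * y)) in HN; [|exact Hw].
replace (eps / w (2 * y) * w (2 * y)) with eps in HN by (field; lra); exact HN.
Qed.

(** A maximal exponent exists because the terms tend to [0]; monotonicity on
    both sides of it is quasi-concavity. *)
Lemma envelope_peak y : 0 < y -> exists m, is_peak envelope_coeff y m /\
  forall j, term j y <= term m y.
Proof.
intros Hy.
assert (H0 : 0 < term 0 y).
{ rewrite envelope_coeff_0; simpl; rewrite Rmult_1_r; apply w_weight; lra. }
destruct (envelope_terms_vanish y Hy _ H0) as [N HN].
assert (Hfin : exists m, forall j, (j <= N)%nat -> term j y <= term m y).
{ clear HN; induction N as [|N [m Hm]].
  - exists O; intros j Hj; assert (j = O) by lia; subst; lra.
  - destruct (Rle_dec (term (S N) y) (term m y)) as [H|H].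
    + exists m; intros j Hj; destruct (Nat.eq_dec j (S N)) as [->|]; [exact H|apply Hm; lia].
    + exists (S N); intros j Hj; destruct (Nat.eq_dec j (S N)) as [->|]; [lra|].
      specialize (Hm j ltac:(lia)); lra. }
destruct Hfin as [m Hm].
assert (Hmax : forall j, term j y <= term m y).
{ intros j; destruct (le_lt_dec j N) as [H|H]; [apply Hm, H|].
  specialize (HN j ltac:(lia)); specialize (Hm O ltac:(lia)); lra. }
exists m; split; [|exact Hmax]; split; intros i j Hij.
- pose proof (envelope_quasiconcave i j m y Hij Hy) as H.
  rewrite Rmin_left in H by apply Hmax; exact H.
- pose proof (envelope_quasiconcave m i j y Hij Hy) as H.
  rewrite Rmin_right in H by apply Hmax; exact H.
Qed.

Definition enveloped_by_monomials : Prop :=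
  exists K, 0 < K /\ forall t, 0 <= t -> exists k, w t <= K * term k t.

End Envelope.

(** Convexity of the power function, in the form of a comparison of slopes from
    the left endpoint; it makes suprema of monomials locally Lipschitz. *)
Lemma pow_chord_le n t s u : 0 <= t <= s -> s <= u ->
  (u - t) * (s ^ n - t ^ n) <= (s - t) * (u ^ n - t ^ n).
Proof.
intros Hts Hsu; induction n as [|n IH]; [simpl; lra|simpl].
assert (Hn : t ^ n <= u ^ n) by (apply pow_incr; lra).
assert (H1 : s * ((u - t) * (s ^ n - t ^ n)) <= s * ((s - t) * (u ^ n - t ^ n)))
  by (apply Rmult_le_compat_l; lra).
assert (H2 : 0 <= (u - s) * ((s - t) * (u ^ n - t ^ n)))
  by (repeat apply Rmult_le_pos; lra).
nra.
Qed.

Lemma ln_monomial c t k : 0 < c -> 0 < t -> ln (c * t ^ k) = ln c + INR k * ln t.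
Proof.
intros Hc Ht; rewrite ln_mult by (try apply pow_lt; assumption).
f_equal; induction k as [|k IH]; [simpl; rewrite ln_1; ring|].
rewrite S_INR; simpl pow; rewrite ln_mult, IH by (try apply pow_lt; assumption); ring.
Qed.

Section Envelope_weight.
Variable w : R -> R.
Hypothesis w_weight : weight_function w.
Notation term k t := (envelope_coeff w k * t ^ k).

Definition envelope (t : R) : R :=
  real (Lub_Rbar (fun y => exists k, y = term k t)).

Lemma envelope_lub t : 0 <= t ->
  is_lub_Rbar (fun y => exists k, y = term k t) (envelope t).
Proof.
intros Ht; unfold envelope.
pose proof (Lub_Rbar_correct (fun y => exists k, y = term k t)) as [Hu Hl].
pose proof (Hu (term 0 t) (ex_intro _ O eq_refl)) as H2.
assert (H1 : Rbar_le (Lub_Rbar (fun y => exists k, y = term k t)) (w t)).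
{ apply Hl; intros y [k ->]; exact (proj2 (envelope_below w w_weight k) t Ht). }
destruct (Lub_Rbar _) as [r| |]; simpl in *; try contradiction.
split; [exact Hu|exact Hl].
Qed.

Lemma term_le_envelope k t : 0 <= t -> term k t <= envelope t.
Proof. intros Ht; exact (proj1 (envelope_lub t Ht) _ (ex_intro _ k eq_refl)). Qed.

Lemma envelope_le t M : 0 <= t -> (forall k, term k t <= M) -> envelope t <= M.
Proof. intros Ht H; apply (proj2 (envelope_lub t Ht) M); intros y [k ->]; apply H. Qed.

Lemma envelope_pos t : 0 <= t -> 0 < envelope t.
Proof.
intros Ht; apply Rlt_le_trans with (2 := term_le_envelope O t Ht).
rewrite (envelope_coeff_0 w w_weight); simpl; rewrite Rmult_1_r; apply w_weight; lra.
Qed.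

Lemma envelope_mono s t : 0 <= s -> s <= t -> envelope s <= envelope t.
Proof.
intros Hs Hst; apply envelope_le; [exact Hs|intros k].
apply Rle_trans with (2 := term_le_envelope k t ltac:(lra)).
apply Rmult_le_compat_l; [apply envelope_coeff_ge0, w_weight|apply pow_incr; lra].
Qed.

(** The slope bound of each monomial is at most the envelope at [u],
    uniformly in the exponent. *)
Lemma envelope_lipschitz t s u : 0 <= t <= s -> s <= u -> 1 <= u - t ->
  envelope s <= envelope t + (s - t) * envelope u.
Proof.
intros Hts Hsu Hu; apply envelope_le; [lra|intros k].
pose proof (pow_chord_le k t s u Hts Hsu) as H.
pose proof (term_le_envelope k t ltac:(lra)) as H1.
pose proof (term_le_envelope k u ltac:(lra)) as H2.
pose proof (envelope_coeff_ge0 w w_weight k) as Ha.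
assert (Hm : t ^ k <= s ^ k) by (apply pow_incr; lra).
pose proof (pow_le t k ltac:(lra)).
assert (H3 : s ^ k - t ^ k <= (s - t) * u ^ k) by nra.
assert (H4 : envelope_coeff w k * (s ^ k - t ^ k) <=
             envelope_coeff w k * ((s - t) * u ^ k)) by (apply Rmult_le_compat_l; lra).
assert (H5 : (s - t) * term k u <= (s - t) * envelope u) by (apply Rmult_le_compat_l; lra).
nra.
Qed.

Lemma envelope_weight_function :
  (forall A, exists t, 0 <= t /\ A < envelope t) -> weight_function envelope.
Proof.
intros Hunb; repeat split.
- apply envelope_pos.
- apply envelope_mono.
- apply continuous_on_nonneg; intros x eps Hx He.
  (* all the points involved are at most [x + 1], at distance at least 1 from
     [x + 2], as the Lipschitz estimate requires *)
  set (L := envelope (x + 2)).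
  assert (HL : 0 < L) by (apply envelope_pos; lra).
  exists (Rmin 1 (eps / L)); split.
  { apply Rmin_glb_lt; [lra|apply Rdiv_lt_0_compat; lra]. }
  intros y Hy Hxy.
  pose proof (Rmin_l 1 (eps / L)); pose proof (Rmin_r 1 (eps / L)).
  assert (Hxy2 : Rabs (y - x) * L < eps).
  { apply Rmult_lt_reg_r with (/ L); [apply Rinv_0_lt_compat, HL|].
    rewrite Rmult_assoc, Rinv_r, Rmult_1_r by lra; unfold Rdiv in *; lra. }
  revert Hxy Hxy2; unfold Rabs at 1 2; destruct (Rcase_abs (y - x)) as [H1|H1]; intros.
  + pose proof (envelope_lipschitz y x (x + 2) ltac:(lra) ltac:(lra) ltac:(lra)).
    pose proof (envelope_mono y x Hy ltac:(lra)).
    fold L in H2; rewrite Rabs_left1 by lra; lra.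
  + pose proof (envelope_lipschitz x y (x + 2) ltac:(lra) ltac:(lra) ltac:(lra)).
    pose proof (envelope_mono x y Hx ltac:(lra)).
    fold L in H2; rewrite Rabs_pos_eq by lra; lra.
- exact Hunb.
Qed.

(** The exponents with a zero coefficient have no logarithm and are left out of
    the index set; the supremum is attained at a peak, so it is not affected. *)
Lemma envelope_log_tropical : log_tropical envelope.
Proof.
exists (fun k => 0 < envelope_coeff w k), (fun k => ln (envelope_coeff w k)).
intros x; pose proof (exp_pos x) as Hx.
assert (Eterm : forall k, 0 < envelope_coeff w k ->
   ln (envelope_coeff w k) + INR k * x = ln (term k (exp x))).
{ intros k Hk; rewrite ln_monomial, ln_exp by assumption; reflexivity. }
split.
- intros y [k [Hk ->]]; rewrite (Eterm k Hk).
  assert (0 < term k (exp x)) by (apply Rmult_lt_0_compat; [exact Hk|apply pow_lt, Hx]).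
  pose proof (term_le_envelope k (exp x) ltac:(lra)) as [H1| ->]; [|lra].
  apply Rlt_le, ln_increasing; assumption.
- intros M HM.
  destruct (envelope_peak w w_weight (exp x) Hx) as [m [_ Hm]].
  assert (E : envelope (exp x) = term m (exp x)).
  { apply Rle_antisym; [apply envelope_le; [lra|exact Hm]|apply term_le_envelope; lra]. }
  pose proof (envelope_pos (exp x) ltac:(lra)) as Hp.
  assert (Hmpos : 0 < envelope_coeff w m).
  { rewrite E in Hp; pose proof (pow_lt (exp x) m Hx).
    pose proof (envelope_coeff_ge0 w w_weight m); nra. }
  rewrite E, <- (Eterm m Hmpos); apply HM; eauto.
Qed.

Lemma enveloped_log_tropical :
  enveloped_by_monomials w -> equivalent_to_log_tropical w.
Proof.
intros [K [HK HM]].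
assert (Hle : forall t, 0 <= t -> envelope t <= w t).
{ intros t Ht; apply envelope_le; [exact Ht|intros k].
  exact (proj2 (envelope_below w w_weight k) t Ht). }
assert (Hge : forall t, 0 <= t -> w t <= K * envelope t).
{ intros t Ht; destruct (HM t Ht) as [k Hk].
  pose proof (term_le_envelope k t Ht); nra. }
exists envelope; split; [|split; [exact envelope_log_tropical|]].
- apply envelope_weight_function; intros A.
  destruct w_weight as [_ [_ [_ Hunb]]].
  destruct (Hunb (K * A)) as [t [Ht HA]]; exists t; split; [exact Ht|].
  specialize (Hge t Ht); nra.
- exists 1, K; split; [lra|split; [exact HK|]].
  intros t Ht; split; [rewrite Rmult_1_l; apply Hle|apply Hge]; exact Ht.
Qed.

(** The affine pieces only control the weight at positive points.  At [0] the
    piece of slope [0] stays below by continuity, and the others vanish there. *)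
Lemma log_tropical_enveloped :
  equivalent_to_log_tropical w -> enveloped_by_monomials w.
Proof.
intros [v [Hv [[E [b Htrop]] [C1 [C2 [HC1 [HC2 Heq]]]]]]].
destruct Hv as [Hvpos [Hvmono [Hvcont _]]].
assert (Hln : forall s, 0 < s -> is_lub (fun y => exists j, E j /\ y = b j + INR j * ln s) (ln (v s))).
{ intros s Hs; specialize (Htrop (ln s)); cbv beta in Htrop.
  rewrite exp_ln in Htrop by exact Hs; exact Htrop. }
assert (Hbelow : forall j, E j -> forall s, 0 < s -> exp (b j) * s ^ j <= v s).
{ intros j Hj s Hs.
  assert (0 < exp (b j) * s ^ j) by (apply Rmult_lt_0_compat; [apply exp_pos|apply pow_lt, Hs]).
  rewrite <- (exp_ln (exp (b j) * s ^ j)), <- (exp_ln (v s)) by (try apply Hvpos; lra).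
  rewrite ln_monomial, ln_exp by (try apply exp_pos; exact Hs).
  destruct (proj1 (Hln s Hs) _ (ex_intro _ j (conj Hj eq_refl))) as [H1|H1];
    [apply Rlt_le, exp_increasing, H1|rewrite H1; lra]. }
assert (Hbelow0 : forall j, E j -> forall s, 0 <= s -> exp (b j) * s ^ j <= v s).
{ intros j Hj s [Hs| <-]; [apply Hbelow; assumption|].
  destruct j as [|j]; [|rewrite pow_i, Rmult_0_r by lia; apply Rlt_le, Hvpos; lra].
  apply Rnot_lt_le; intros Hlt; simpl in Hlt.
  destruct (proj1 (continuous_on_nonneg v) Hvcont 0 (exp (b O) * 1 - v 0) ltac:(lra) ltac:(lra))
    as [d [Hd Hc]].
  specialize (Hc (d / 2) ltac:(lra)).
  rewrite Rminus_0_r, Rabs_pos_eq in Hc by lra; specialize (Hc ltac:(lra)).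
  pose proof (Hbelow O Hj (d / 2) ltac:(lra)) as H1; simpl in H1.
  apply Rabs_lt_between in Hc; lra. }
exists (2 * C2 / C1 + 1); split.
{ assert (0 < 2 * C2 / C1) by (apply Rdiv_lt_0_compat; lra); lra. }
intros t [Ht| <-].
- assert (Hex : exists j, E j /\ ln (v t) - ln 2 < b j + INR j * ln t).
  { apply NNPP; intros N.
    assert (H : ln (v t) <= ln (v t) - ln 2).
    { apply (proj2 (Hln t Ht)); intros y [j [Hj ->]].
      apply Rnot_lt_le; intros Hlt; apply N; eauto. }
    pose proof ln_lt_2; lra. }
  destruct Hex as [j [Hj Hlt]]; exists j.
  assert (Hhalf : v t <= 2 * (exp (b j) * t ^ j)).
  { assert (0 < exp (b j) * t ^ j) by (apply Rmult_lt_0_compat; [apply exp_pos|apply pow_lt, Ht]).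
    rewrite <- (exp_ln (v t)), <- (exp_ln (2 * (exp (b j) * t ^ j))) by (try apply Hvpos; lra).
    apply Rlt_le, exp_increasing.
    rewrite ln_mult, ln_monomial, ln_exp by (try apply exp_pos; lra); lra. }
  assert (Hc : C1 * exp (b j) <= envelope_coeff w j).
  { apply below_le_envelope; [exact w_weight|split].
    - apply Rmult_le_pos; [lra|apply Rlt_le, exp_pos].
    - intros s Hs; rewrite Rmult_assoc.
      apply Rle_trans with (2 := proj1 (Heq s Hs)).
      apply Rmult_le_compat_l; [lra|apply Hbelow0; assumption]. }
  pose proof (proj2 (Heq t (Rlt_le _ _ Ht))) as H1.
  pose proof (pow_lt t j Ht) as Hp.
  assert (H2 : exp (b j) * t ^ j <= term j t / C1).
  { apply Rmult_le_reg_l with C1; [exact HC1|].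
    replace (C1 * (term j t / C1)) with (term j t) by (field; lra).
    rewrite <- Rmult_assoc; apply Rmult_le_compat_r; lra. }
  replace ((2 * C2 / C1 + 1) * term j t) with (C2 * (2 * (term j t / C1)) + term j t)
    by (field; lra).
  pose proof (envelope_coeff_ge0 w w_weight j).
  nra.
- exists O; rewrite (envelope_coeff_0 w w_weight); simpl.
  assert (0 < 2 * C2 / C1) by (apply Rdiv_lt_0_compat; lra).
  destruct w_weight as [Hpos _]; specialize (Hpos 0 ltac:(lra)); nra.
Qed.

End Envelope_weight.

(** * Complex power series with nonnegative coefficients *)

Lemma is_derive_C_epsilon (f : C -> C) (z l : C) :
  @is_derive C_AbsRing C_NormedModule f z l <->
  forall eps, 0 < eps -> exists d, 0 < d /\ forall y, Cmod (y - z) < d ->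
    Cmod (f y - f z - (y - z) * l) <= eps * Cmod (y - z).
Proof.
split.
- intros [_ H] eps He.
  destruct (H z (fun P HP => HP) (mkposreal eps He)) as [d Hd].
  exists d; split; [apply cond_pos|]; intros y Hy; exact (Hd y Hy).
- intros H; split; [apply is_linear_scal_l|].
  intros x Hx eps.
  apply (is_filter_lim_locally_unique (K := C_AbsRing) (V := AbsRing_NormedModule C_AbsRing)) in Hx.
  subst x.
  destruct (H eps (cond_pos eps)) as [d [Hd Hf]].
  exists (mkposreal d Hd); intros y Hy; exact (Hf y Hy).
Qed.

(** The complex numbers carry two normed-module structures over themselves, one
    from the product of two copies of the reals and one from the absolute value.
    The general rules of differentiation are available for the second one. *)
Lemma is_derive_C_AbsRing (f : C -> C) (z l : C) :
  @is_derive C_AbsRing C_NormedModule f z l <->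
  @is_derive C_AbsRing (AbsRing_NormedModule C_AbsRing) f z l.
Proof. split; intros [_ H]; (split; [apply is_linear_scal_l|exact H]). Qed.

Lemma Re_le_Cmod (z : C) : Rabs (fst z) <= Cmod z.
Proof. exact (Rle_trans _ _ _ (Rmax_l _ _) (Rmax_Cmod z)). Qed.

Lemma Im_le_Cmod (z : C) : Rabs (snd z) <= Cmod z.
Proof. exact (Rle_trans _ _ _ (Rmax_r _ _) (Rmax_Cmod z)). Qed.

Lemma Cmod_sqr (z : C) : Cmod z * Cmod z = fst z * fst z + snd z * snd z.
Proof.
unfold Cmod; rewrite sqrt_sqrt; [ring|].
pose proof (pow2_ge_0 (fst z)); pose proof (pow2_ge_0 (snd z)); lra.
Qed.

Lemma Rabs_dot_le (u v : C) :
  Rabs (fst u * fst v + snd u * snd v) <= Cmod u * Cmod v.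
Proof.
pose proof (Re_le_Cmod (u * Cconj v)%C) as H.
rewrite Cmod_mult, Cmod_conj in H; simpl in H.
replace (fst u * fst v + snd u * snd v)
  with (fst u * fst v - snd u * - snd v) by ring; exact H.
Qed.

(** Summing real and imaginary parts separately gives a total function; it is
    only used under a [dominated] hypothesis. *)
Definition Cseries (u : nat -> C) : C :=
  (Series (fun k => fst (u k)), Series (fun k => snd (u k))).

Definition dominated (u : nat -> C) (b : nat -> R) : Prop :=
  (forall k, Cmod (u k) <= b k) /\ ex_series b.

Lemma dominated_ex u b : dominated u b ->
  ex_series (fun k => fst (u k)) /\ ex_series (fun k => snd (u k)).
Proof.
intros [Hu Hb]; split;
  apply (ex_series_le (K := R_AbsRing) (V := R_CompleteNormedModule)) with (2 := Hb);
  intros k; apply Rle_trans with (2 := Hu k); [apply Re_le_Cmod|apply Im_le_Cmod].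
Qed.

(** Taking the inner product of the sum [l] with itself reduces the bound to the
    real series of the inner products of [l] with the terms. *)
Lemma Cseries_bound u b : dominated u b -> Cmod (Cseries u) <= Series b.
Proof.
intros H; destruct (dominated_ex u b H) as [H1 H2]; destruct H as [Hu Hb].
set (l := Cseries u).
assert (Hb0 : 0 <= Series b).
{ rewrite <- (Rmult_0_l (Series b)), <- Series_scal_l.
  apply Series_le; [|exact Hb]; intros n.
  pose proof (Cmod_ge_0 (u n)); specialize (Hu n); lra. }
assert (Hdot : Cmod l * Cmod l <= Cmod l * Series b).
{ rewrite Cmod_sqr.
  replace (fst l * fst l + snd l * snd l)
    with (Series (fun k => fst l * fst (u k) + snd l * snd (u k))).
  - rewrite <- Series_scal_l; apply Rle_trans with (1 := Rle_abs _).
    assert (Hk : forall k, Rabs (fst l * fst (u k) + snd l * snd (u k)) <= Cmod l * b k).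
    { intros k; apply Rle_trans with (1 := Rabs_dot_le l (u k)).
      apply Rmult_le_compat_l; [apply Cmod_ge_0|apply Hu]. }
    assert (Hex : ex_series (fun k => Cmod l * b k))
      by exact (ex_series_scal (K := R_AbsRing) (V := R_NormedModule) (Cmod l) b Hb).
    apply Rle_trans with (Series (fun k => Rabs (fst l * fst (u k) + snd l * snd (u k)))).
    + apply Series_Rabs.
      apply (ex_series_le (K := R_AbsRing) (V := R_CompleteNormedModule)) with (2 := Hex).
      intros k; apply Rle_trans with (2 := Hk k).
      right; apply Rabs_Rabsolu.
    + apply Series_le; [|exact Hex].
      intros k; split; [apply Rabs_pos|apply Hk].
  - rewrite Series_plus, !Series_scal_l; [reflexivity| |];
    apply (ex_series_scal (K := R_AbsRing) (V := R_NormedModule)); assumption. }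
pose proof (Cmod_ge_0 l).
destruct (Req_dec (Cmod l) 0) as [Z|Z]; [rewrite Z; exact Hb0|].
apply Rmult_le_reg_l with (Cmod l); [lra|exact Hdot].
Qed.

Lemma Cseries_minus u v b c : dominated u b -> dominated v c ->
  (Cseries u - Cseries v)%C = Cseries (fun k => u k - v k)%C.
Proof.
intros Hu Hv; apply dominated_ex in Hu as [Hu1 Hu2]; apply dominated_ex in Hv as [Hv1 Hv2].
unfold Cseries; simpl.
change (fun k => fst (u k) + - fst (v k)) with (fun k => fst (u k) - fst (v k)).
change (fun k => snd (u k) + - snd (v k)) with (fun k => snd (u k) - snd (v k)).
rewrite !Series_minus by assumption; reflexivity.
Qed.

Lemma Cseries_scal a u b : dominated u b ->
  (a * Cseries u)%C = Cseries (fun k => a * u k)%C.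
Proof.
intros Hu; apply dominated_ex in Hu as [Hu1 Hu2].
assert (Hs : forall (x : R) (p : nat -> R), ex_series p -> ex_series (fun k => x * p k)).
{ intros x p Hp; exact (ex_series_scal (K := R_AbsRing) (V := R_NormedModule) x p Hp). }
unfold Cseries; simpl.
rewrite Series_plus, Series_minus, !Series_scal_l by (apply Hs; assumption).
reflexivity.
Qed.

Section Positive_power_series.
Variable a : nat -> R.
Hypothesis a_ge0 : forall k, 0 <= a k.
Hypothesis a_series : forall t, 0 <= t -> ex_series (fun k => a k * t ^ k).

Definition power_series (z : C) : C := Cseries (fun k => a k * z ^ k)%C.

Lemma Cmod_coeff k (z : C) : Cmod (a k * z) = a k * Cmod z.
Proof. rewrite Cmod_mult, Cmod_R, Rabs_pos_eq by apply a_ge0; reflexivity. Qed.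

Lemma power_series_dominated z :
  dominated (fun k => a k * z ^ k)%C (fun k => a k * Cmod z ^ k).
Proof.
split; [|apply a_series, Cmod_ge_0].
intros k; rewrite Cmod_coeff, Cmod_pow; lra.
Qed.

Lemma power_series_le z : Cmod (power_series z) <= Series (fun k => a k * Cmod z ^ k).
Proof. apply Cseries_bound, power_series_dominated. Qed.

Lemma power_series_real t : power_series (RtoC t) = RtoC (Series (fun k => a k * t ^ k)).
Proof.
assert (E : forall k, (a k * RtoC t ^ k)%C = RtoC (a k * t ^ k)).
{ intros k; rewrite <- RtoC_pow, <- RtoC_mult; reflexivity. }
apply injective_projections; unfold power_series, Cseries; cbn [fst snd].
- apply Series_ext; intros k; rewrite E; reflexivity.
- replace (snd (RtoC (Series (fun k => a k * t ^ k))))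
    with (0 * Series (fun k => a k * t ^ k)) by (simpl; ring).
  rewrite <- Series_scal_l; apply Series_ext; intros k; rewrite E; simpl; ring.
Qed.

(** A second-order Taylor estimate, in a form whose summation against the
    coefficients only needs convergence of the series at a larger radius. *)
Lemma pow_increment_bound (z h : C) r k : 1 <= r -> Cmod z + Cmod h <= r ->
  Cmod ((z + h) ^ k - z ^ k - h * (INR k * z ^ pred k)) <=
  INR k * INR k * r ^ k * (Cmod h * Cmod h).
Proof.
intros Hr Hzh; pose proof (Cmod_ge_0 z); pose proof (Cmod_ge_0 h).
assert (Hh2 : 0 <= Cmod h * Cmod h) by (apply Rmult_le_pos; assumption).
assert (Hzr : Cmod (z + h) <= r) by (pose proof (Cmod_triangle z h); lra).
induction k as [|k IH].
- simpl.
  replace (1 - 1 - h * (0 * 1))%C with (RtoC 0) by ring.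
  rewrite Cmod_0; lra.
- replace ((z + h) ^ S k - z ^ S k - h * (INR (S k) * z ^ pred (S k)))%C
    with ((z + h) * ((z + h) ^ k - z ^ k - h * (INR k * z ^ pred k)) +
          INR k * z ^ pred k * (h * h))%C.
  + eapply Rle_trans; [apply Cmod_triangle|].
    rewrite !Cmod_mult, Cmod_pow, Cmod_R, Rabs_pos_eq by apply pos_INR.
    rewrite S_INR; simpl pow.
    pose proof (pos_INR k) as Hk.
    assert (H1 : Cmod z ^ pred k <= r ^ k).
    { apply Rle_trans with (r ^ pred k); [apply pow_incr; lra|apply Rle_pow; [lra|lia]]. }
    assert (H2 : 0 <= Cmod z ^ pred k) by (apply pow_le; assumption).
    assert (H3 : 0 <= r ^ k) by (apply pow_le; lra).
    set (D := Cmod ((z + h) ^ k - z ^ k - h * (INR k * z ^ pred k))) in *.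
    assert (H4 : Cmod (z + h) * D <= r * (INR k * INR k * r ^ k * (Cmod h * Cmod h))).
    { apply Rmult_le_compat; [apply Cmod_ge_0|apply Cmod_ge_0|exact Hzr|exact IH]. }
    assert (H5 : INR k * Cmod z ^ pred k <= INR k * r * r ^ k).
    { rewrite Rmult_assoc; apply Rmult_le_compat_l; [exact Hk|].
      apply Rle_trans with (1 := H1); nra. }
    assert (H6 : INR k * Cmod z ^ pred k * (Cmod h * Cmod h) <=
                 INR k * r * r ^ k * (Cmod h * Cmod h)).
    { apply Rmult_le_compat_r; assumption. }
    assert (H7 : 0 <= r * r ^ k * (Cmod h * Cmod h)).
    { repeat apply Rmult_le_pos; try lra; assumption. }
    nra.
  + rewrite S_INR, RtoC_plus, !Cpow_S; simpl pred.
    destruct k as [|k]; [simpl; ring|].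
    simpl pred; rewrite (Cpow_S z k); ring.
Qed.

Lemma INR_le_pow2 k : INR k <= 2 ^ k.
Proof.
induction k as [|k IH]; [simpl; lra|].
rewrite S_INR; simpl pow.
assert (1 <= 2 ^ k) by (apply pow_R1_Rle; lra); lra.
Qed.

(** The estimate of the increments is summed; since [INR k <= 2 ^ k], the
    series of the derivative and of the remainder are dominated by the given
    series at the radii [2 * r] and [4 * r]. *)
Lemma power_series_entire : entire power_series.
Proof.
intros z.
set (d := fun k => (a k * (INR k * z ^ pred k))%C).
set (r := Cmod z + 1).
assert (Hr : 1 <= r) by (unfold r; pose proof (Cmod_ge_0 z); lra).
assert (Hrpow : forall k, 0 <= r ^ k) by (intros; apply pow_le; lra).
assert (Hd : dominated d (fun k => a k * (2 * r) ^ k)).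
{ split; [|apply a_series; lra].
  intros k; unfold d; rewrite Cmod_coeff, Cmod_mult, Cmod_pow, Cmod_R, Rabs_pos_eq by apply pos_INR.
  apply Rmult_le_compat_l; [apply a_ge0|].
  rewrite Rpow_mult_distr; apply Rmult_le_compat;
    [apply pos_INR|apply pow_le, Cmod_ge_0|apply INR_le_pow2|].
  apply Rle_trans with (r ^ pred k).
  - apply pow_incr; split; [apply Cmod_ge_0|unfold r; lra].
  - apply Rle_pow; [lra|lia]. }
exists (Cseries d); apply is_derive_C_epsilon; intros eps He.
set (M := Series (fun k => a k * (4 * r) ^ k)).
assert (HM : 0 <= M).
{ apply Rle_trans with (1 := Cmod_ge_0 (power_series (RtoC (4 * r)))).
  apply Rle_trans with (1 := power_series_le _).
  rewrite Cmod_R, Rabs_pos_eq by lra; apply Rle_refl. }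
exists (Rmin 1 (eps / (M + 1))); split.
{ apply Rmin_glb_lt; [lra|apply Rdiv_lt_0_compat; lra]. }
intros y Hy.
pose proof (Rmin_l 1 (eps / (M + 1))); pose proof (Rmin_r 1 (eps / (M + 1))).
set (h := (y - z)%C) in *.
pose proof (Cmod_ge_0 h) as Hh.
unfold power_series.
rewrite (Cseries_minus _ _ _ _ (power_series_dominated y) (power_series_dominated z)).
assert (Hdiff : dominated (fun k => a k * y ^ k - a k * z ^ k)%C
                  (fun k => a k * Cmod y ^ k + a k * Cmod z ^ k)).
{ split.
  - intros k; eapply Rle_trans; [apply Cmod_triangle|].
    rewrite Cmod_opp, !Cmod_coeff, !Cmod_pow; lra.
  - apply (ex_series_plus (K := R_AbsRing) (V := R_NormedModule)); apply a_series, Cmod_ge_0. }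
rewrite (Cseries_scal h d _ Hd).
assert (Hhd : dominated (fun k => h * d k)%C (fun k => Cmod h * (a k * (2 * r) ^ k))).
{ destruct Hd as [Hd1 Hd2]; split.
  - intros k; rewrite Cmod_mult; apply Rmult_le_compat_l; [exact Hh|apply Hd1].
  - exact (ex_series_scal (K := R_AbsRing) (V := R_NormedModule) (Cmod h) _ Hd2). }
rewrite (Cseries_minus _ _ _ _ Hdiff Hhd).
assert (Hfin : Cmod (Cseries (fun k => a k * y ^ k - a k * z ^ k - h * d k)%C) <=
               Series (fun k => (Cmod h * Cmod h) * (a k * (4 * r) ^ k))).
{ apply Cseries_bound; split.
  - intros k; unfold d.
    replace (a k * y ^ k - a k * z ^ k - h * (a k * (INR k * z ^ pred k)))%C
      with (a k * ((z + h) ^ k - z ^ k - h * (INR k * z ^ pred k)))%C.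
    + rewrite Cmod_coeff.
      rewrite (Rmult_comm (Cmod h * Cmod h)), Rmult_assoc.
      apply Rmult_le_compat_l; [apply a_ge0|].
      apply Rle_trans with (1 := pow_increment_bound z h r k Hr ltac:(unfold r; lra)).
      apply Rmult_le_compat_r; [apply Rmult_le_pos; assumption|].
      replace (4 * r) with (2 * 2 * r) by ring; rewrite !Rpow_mult_distr.
      apply Rmult_le_compat_r; [apply Hrpow|].
      apply Rmult_le_compat; try apply pos_INR; apply INR_le_pow2.
    + replace y with (z + h)%C by (unfold h; ring); ring.
  - refine (ex_series_scal (K := R_AbsRing) (V := R_NormedModule) (Cmod h * Cmod h) _ _).
    apply a_series; lra. }
apply Rle_trans with (1 := Hfin); rewrite Series_scal_l; fold M.
assert (H7 : Cmod h * (M + 1) < eps).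
{ apply Rmult_lt_reg_r with (/ (M + 1)); [apply Rinv_0_lt_compat; lra|].
  rewrite Rmult_assoc, Rinv_r, Rmult_1_r by lra; unfold Rdiv in *; lra. }
nra.
Qed.

End Positive_power_series.

(** * From monomials to power series and holomorphic maps *)

Lemma is_series_single j c : is_series (fun k => if Nat.eq_dec k j then c else 0) c.
Proof.
assert (H : forall n, sum_n (fun k => if Nat.eq_dec k j then c else 0) n =
                      if le_lt_dec j n then c else 0).
{ induction n as [|n IH].
  - rewrite sum_O; destruct (Nat.eq_dec 0 j), (le_lt_dec j 0); try reflexivity; lia.
  - rewrite sum_Sn, IH.
    destruct (le_lt_dec j n), (Nat.eq_dec (S n) j), (le_lt_dec j (S n)); try lia;
      [exact (Rplus_0_r c)|exact (Rplus_0_l c)|exact (Rplus_0_l 0)]. }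
apply (is_lim_seq_ext_loc (fun _ => c) _ c); [|apply is_lim_seq_const].
exists j; intros n Hn; rewrite H; destruct (le_lt_dec j n); [reflexivity|lia].
Qed.

Lemma bounded_sums_series (b : nat -> R) M : (forall k, 0 <= b k) ->
  (forall n, sum_n b n <= M) -> ex_series b /\ Series b <= M.
Proof.
intros Hb HM.
assert (Hlim : ex_finite_lim_seq (sum_n b)).
{ apply ex_finite_lim_seq_incr with M; [|exact HM].
  intros n; rewrite sum_Sn; specialize (Hb (S n)); unfold plus; simpl; lra. }
destruct Hlim as [l Hl].
assert (Hs : is_series b l) by exact Hl.
split; [exists l; exact Hs|].
rewrite (is_series_unique b l Hs).
exact (is_lim_seq_le (sum_n b) (fun _ => M) l M HM Hl (is_lim_seq_const M)).
Qed.

Lemma term_le_Series (b : nat -> R) k : (forall k, 0 <= b k) -> ex_series b ->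
  b k <= Series b.
Proof.
intros Hb Hex.
rewrite <- (is_series_unique _ _ (is_series_single k (b k))).
apply Series_le; [|exact Hex].
intros n; destruct (Nat.eq_dec n k) as [->|]; specialize (Hb n) || specialize (Hb k); lra.
Qed.

Lemma Series_pow_0 (a : nat -> R) : Series (fun k => a k * 0 ^ k) = a O.
Proof.
rewrite <- (is_series_unique _ _ (is_series_single O (a O))).
apply Series_ext; intros [|k]; [simpl; ring|rewrite pow_i by lia].
destruct (Nat.eq_dec (S k) 0); [lia|ring].
Qed.

Section Dominant.
Variable a : nat -> R.
Hypothesis a_ge0 : forall k, 0 <= a k.
Hypothesis a_series : forall t, 0 <= t -> ex_series (fun k => a k * t ^ k).

(** Triangle inequality: a term that exceeds the sum of all the others keeps the
    series away from [0] on the whole circle. *)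
Lemma power_series_dominant_term z j M :
  (forall n, sum_n (fun k => if Nat.eq_dec k j then 0 else a k * Cmod z ^ k) n <= M) ->
  a j * Cmod z ^ j - M <= Cmod (power_series a z).
Proof.
intros HM.
set (b := fun k => if Nat.eq_dec k j then 0 else a k * Cmod z ^ k) in *.
set (u := fun k => if Nat.eq_dec k j then RtoC 0 else (a k * z ^ k)%C).
assert (Hb : forall k, 0 <= b k).
{ intros k; unfold b; destruct (Nat.eq_dec k j); [lra|].
  apply Rmult_le_pos; [apply a_ge0|apply pow_le, Cmod_ge_0]. }
destruct (bounded_sums_series b M Hb HM) as [Hex HbM].
assert (Hu : dominated u b).
{ split; [|exact Hex]; intros k; unfold u, b.
  destruct (Nat.eq_dec k j); [rewrite Cmod_0; lra|].
  rewrite Cmod_coeff, Cmod_pow by exact a_ge0; lra. }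
assert (E : (power_series a z - Cseries u)%C = (a j * z ^ j)%C).
{ unfold power_series.
  rewrite (Cseries_minus _ _ _ _ (power_series_dominated a a_ge0 a_series z) Hu).
  set (c := (a j * z ^ j)%C).
  assert (Ek : forall k, (a k * z ^ k - u k)%C = if Nat.eq_dec k j then c else RtoC 0).
  { intros k; unfold u, c; destruct (Nat.eq_dec k j) as [->|]; ring. }
  apply injective_projections; cbn [fst snd Cseries].
  - rewrite <- (is_series_unique _ _ (is_series_single j (fst c))).
    apply Series_ext; intros k; rewrite Ek; destruct (Nat.eq_dec k j); reflexivity.
  - rewrite <- (is_series_unique _ _ (is_series_single j (snd c))).
    apply Series_ext; intros k; rewrite Ek; destruct (Nat.eq_dec k j); reflexivity. }
pose proof (Cseries_bound u b Hu) as H1.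
pose proof (Cmod_triangle (power_series a z) (- Cseries u)) as H2.
change (power_series a z + - Cseries u)%C with (power_series a z - Cseries u)%C in H2.
rewrite E, Cmod_opp, Cmod_coeff, Cmod_pow in H2 by exact a_ge0.
lra.
Qed.
End Dominant.

Lemma sum_sqr_Cmod_ge0 n (v : Tn n C) : 0 <= sum_sqr_Cmod v.
Proof.
induction n as [|n IH]; simpl; [lra|].
specialize (IH (snd v)); pose proof (pow2_ge_0 (Cmod (fst v))); simpl in *; lra.
Qed.

Lemma coeff_le_euclidean_norm n (v : Tn n C) k : (k < n)%nat ->
  Cmod (coeff_Tn (RtoC 0) v k) <= euclidean_norm v.
Proof.
intros Hk; unfold euclidean_norm.
rewrite <- (sqrt_pow2 (Cmod _)) by apply Cmod_ge_0; apply sqrt_le_1_alt.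
revert k Hk; induction n as [|n IH]; intros k Hk; [lia|].
cbn [sum_sqr_Cmod]; pose proof (sum_sqr_Cmod_ge0 n (snd v)).
destruct k as [|k]; [cbn [coeff_Tn]; lra|].
specialize (IH (snd v) k ltac:(lia)).
pose proof (pow2_ge_0 (Cmod (fst v))).
cbn [coeff_Tn]; lra.
Qed.

Lemma euclidean_norm_le n (v : Tn n C) M : 0 <= M ->
  (forall k, (k < n)%nat -> Cmod (coeff_Tn (RtoC 0) v k) <= M) ->
  euclidean_norm v <= INR n * M.
Proof.
intros HM Hv; unfold euclidean_norm.
assert (H : sum_sqr_Cmod v <= INR n * M ^ 2).
{ revert Hv; induction n as [|n IH]; intros Hv; [simpl; lra|].
  rewrite S_INR; cbn [sum_sqr_Cmod].
  specialize (IH (snd v) (fun k Hk => Hv (S k) ltac:(lia))).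
  pose proof (Hv O ltac:(lia)) as H0; cbn [coeff_Tn] in H0.
  assert (Cmod (fst v) ^ 2 <= M ^ 2) by (apply pow_incr; split; [apply Cmod_ge_0|exact H0]).
  lra. }
assert (Hn : 0 <= INR n) by apply pos_INR.
rewrite <- (sqrt_pow2 (INR n * M)) by (apply Rmult_le_pos; assumption).
apply sqrt_le_1_alt; apply Rle_trans with (1 := H).
rewrite Rpow_mult_distr; apply Rmult_le_compat_r; [apply pow2_ge_0|].
destruct n as [|n]; [simpl; lra|].
assert (1 <= INR (S n)) by (rewrite S_INR; pose proof (pos_INR n); lra); nra.
Qed.

Section Constructions.
Variable w : R -> R.
Hypothesis w_weight : weight_function w.
Notation A := (envelope_coeff w).
Notation coeff := (class_coeff (envelope_coeff w)).

Lemma envelope_coeff_nonneg k : 0 <= A k.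
Proof. apply envelope_coeff_ge0, w_weight. Qed.

(** At [0] the point has no peak in the sense used for positive points, and the
    bound is read off the constant coefficient. *)
Lemma coeff_series chi t : 0 <= t ->
  ex_series (fun k => coeff chi k * t ^ k) /\
  Series (fun k => coeff chi k * t ^ k) <= 300 * w t.
Proof.
intros Ht.
assert (Hpos : forall s, 0 <= s -> forall k, 0 <= coeff chi k * s ^ k).
{ intros s Hs k; apply Rmult_le_pos; [apply class_coeff_ge0, envelope_coeff_nonneg|apply pow_le, Hs]. }
assert (H : forall s, 0 < s -> ex_series (fun k => coeff chi k * s ^ k) /\
  Series (fun k => coeff chi k * s ^ k) <= 300 * w s).
{ intros s Hs; apply bounded_sums_series; [apply Hpos; lra|intros n].
  destruct (envelope_peak w w_weight s Hs) as [m [Hm _]].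
  eapply Rle_trans; [apply (class_sum_bound A envelope_coeff_nonneg s m); assumption|].
  apply Rmult_le_compat_l; [lra|apply envelope_below; [exact w_weight|lra]]. }
destruct Ht as [Ht| <-]; [apply H, Ht|split].
- apply (ex_series_le (K := R_AbsRing) (V := R_CompleteNormedModule)) with (2 := proj1 (H 1 ltac:(lra))).
  intros k; apply Rle_trans with (coeff chi k * 0 ^ k).
  + right; apply Rabs_pos_eq, Hpos; lra.
  + apply Rmult_le_compat_l; [apply class_coeff_ge0, envelope_coeff_nonneg|apply pow_incr; lra].
- rewrite Series_pow_0.
  assert (A O = w 0) by (apply envelope_coeff_0, w_weight).
  assert (0 < w 0) by (apply w_weight; lra).
  unfold class_coeff; destruct (excluded_middle_informative _); lra.
Qed.

Lemma enveloped_holomorphic_map :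
  enveloped_by_monomials w -> approximable_by_holomorphic_map w.
Proof.
intros [K [HK HM]].
set (a := fun r => coeff (fun i => i mod 8 = r)).
assert (Ha : forall r k, 0 <= a r k) by (intros; apply class_coeff_ge0, envelope_coeff_nonneg).
assert (Hex : forall r t, 0 <= t -> ex_series (fun k => a r k * t ^ k))
  by (intros; apply coeff_series; assumption).
set (f := fun z => mk_Tn 8 (fun r => power_series (a r) z)).
assert (Ef : forall r z, (r < 8)%nat -> coeff_Tn (RtoC 0) (f z) r = power_series (a r) z)
  by (intros r z Hr; exact (coeff_Tn_bij _ (fun r => power_series (a r) z) r Hr)).
exists 8%nat, f; split; [lia|split].
- intros r Hr z.
  destruct (power_series_entire (a r) (Ha r) (Hex r) z) as [l Hl]; exists l.
  apply (is_derive_ext (power_series (a r))); [|exact Hl].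
  intros u; symmetry; apply Ef, Hr.
- exists (1 / 2400), (200 * K + 1); split; [lra|split; [lra|]].
  intros z _; pose proof (Cmod_ge_0 z) as Hz.
  assert (Hw : 0 < w (Cmod z)) by (apply w_weight, Hz).
  split.
  + assert (H : euclidean_norm (f z) <= INR 8 * (300 * w (Cmod z))).
    { apply euclidean_norm_le; [lra|]; intros r Hr; rewrite Ef by exact Hr.
      apply Rle_trans with (1 := power_series_le (a r) (Ha r) (Hex r) z).
      apply coeff_series, Hz. }
    simpl in H; lra.
  + assert (Hlow : exists r, (r < 8)%nat /\
       w (Cmod z) <= (200 * K + 1) * Cmod (power_series (a r) z)).
    { destruct Hz as [Hz|Hz].
      - destruct (envelope_peak w w_weight (Cmod z) Hz) as [m [Hm Hmax]].
        destruct (dominant_class A envelope_coeff_nonneg (Cmod z) m Hm Hz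
          (envelope_terms_vanish w w_weight _ Hz)) as [r [j [Hr [H1 H2]]]].
        exists r; split; [exact Hr|].
        pose proof (power_series_dominant_term (a r) (Ha r) (Hex r) z j _ H2) as H3.
        fold (a r) in H1, H3.
        destruct (HM (Cmod z) (Cmod_ge_0 z)) as [k Hk]; specialize (Hmax k).
        pose proof (Cmod_ge_0 (power_series (a r) z)).
        assert (A m * Cmod z ^ m <= 200 * Cmod (power_series (a r) z)) by lra.
        nra.
      - (* at the origin only the class of rank 0 contains the constant term *)
        exists O; split; [lia|]; rewrite <- Hz.
        symmetry in Hz; apply Cmod_eq_0 in Hz; subst z.
        rewrite power_series_real, Series_pow_0, Cmod_R, Rabs_pos_eq by apply Ha.
        assert (E : a O O = w 0).
        { rewrite <- (envelope_coeff_0 w w_weight); unfold a, class_coeff.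
          destruct (excluded_middle_informative _) as [|N]; [reflexivity|].
          exfalso; apply N; split; reflexivity. }
        rewrite E; rewrite Cmod_0 in Hw; nra. }
    destruct Hlow as [r [Hr Hlow]]; apply Rle_trans with (1 := Hlow).
    apply Rmult_le_compat_l; [lra|].
    rewrite <- Ef by exact Hr; apply coeff_le_euclidean_norm, Hr.
Qed.

Lemma enveloped_power_series :
  enveloped_by_monomials w -> approximable_by_power_series w.
Proof.
intros [K [HK HM]].
set (a := coeff (fun _ => True)).
assert (Ha : forall k, 0 <= a k) by (intros; apply class_coeff_ge0, envelope_coeff_nonneg).
exists a; split; [exact Ha|split].
{ intros t Ht; apply ex_pseries_R, coeff_series, Ht. }
exists (1 / 300), (100 * K + 1); split; [lra|split; [lra|]].
intros t Ht; unfold nonneg in Ht; destruct (coeff_series (fun _ => True) t Ht) as [Hex Hle].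
change (1 / 300 * Series (fun k => a k * t ^ k) <= w t /\
  w t <= (100 * K + 1) * Series (fun k => a k * t ^ k)).
fold a in Hex, Hle; split; [lra|].
assert (Hterm : forall k, a k * t ^ k <= Series (fun k => a k * t ^ k)).
{ intros k; apply (term_le_Series (fun k => a k * t ^ k)); [|exact Hex].
  intros i; apply Rmult_le_pos; [apply Ha|apply pow_le, Ht]. }
destruct Ht as [Ht| <-].
- destruct (envelope_peak w w_weight t Ht) as [m [Hm Hmax]].
  destruct (dominant_class A envelope_coeff_nonneg t m Hm Ht
    (envelope_terms_vanish w w_weight _ Ht)) as [r [j [_ [H1 _]]]].
  assert (H2 : coeff (fun i => i mod 8 = r) j <= a j).
  { unfold a, class_coeff.
    destruct (excluded_middle_informative _) as [[S _]|_];
      destruct (excluded_middle_informative _) as [_|N]; try lra;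
      [exfalso; apply N; split; [exact S|exact I]|apply envelope_coeff_nonneg]. }
  apply Rmult_le_compat_r with (r := t ^ j) in H2; [|apply pow_le; lra].
  destruct (HM t ltac:(lra)) as [k Hk]; specialize (Hmax k); specialize (Hterm j).
  assert (0 < w t) by (apply w_weight; lra).
  assert (A m * t ^ m <= 100 * Series (fun k => a k * t ^ k)) by lra.
  assert (0 <= Series (fun k => a k * t ^ k)).
  { apply Rle_trans with (2 := Hterm), Rmult_le_pos; [apply Ha|apply pow_le; lra]. }
  nra.
- rewrite Series_pow_0.
  assert (E : a O = w 0).
  { rewrite <- (envelope_coeff_0 w w_weight); unfold a, class_coeff.
    destruct (excluded_middle_informative _) as [|N]; [reflexivity|].
    exfalso; apply N; split; [reflexivity|exact I]. }
  assert (0 < w 0) by (apply w_weight; lra).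
  rewrite E; nra.
Qed.

(** With nonnegative coefficients the modulus on the circle of radius [t] is
    largest at the point [t] itself. *)
Lemma power_series_max_modulus :
  approximable_by_power_series w -> approximable_by_max_modulus w.
Proof.
intros [a [Ha [Hps Heq]]].
assert (Hex : forall t, 0 <= t -> ex_series (fun k => a k * t ^ k)).
{ intros t Ht; apply ex_pseries_R, Hps, Ht. }
pose proof (power_series_entire a Ha Hex) as Hent.
exists (power_series a); split; [exact Hent|].
assert (E : forall t, nonneg t -> max_modulus (power_series a) t = PSeries a t).
{ intros t Ht; destruct (max_modulus_max _ t Hent Ht) as [[z [Hz Hmax]] Hub].
  apply Rle_antisym.
  - rewrite <- Hmax; apply Rle_trans with (1 := power_series_le a Ha Hex z).
    rewrite Hz; apply Rle_refl.
  - specialize (Hub (RtoC t)); rewrite Cmod_R, Rabs_pos_eq in Hub by exact Ht.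
    specialize (Hub eq_refl).
    rewrite power_series_real, Cmod_R in Hub.
    exact (Rle_trans _ _ _ (Rle_abs _) Hub). }
destruct Heq as [C1 [C2 [H1 [H2 H]]]]; exists C1, C2.
split; [exact H1|split; [exact H2|]]; intros t Ht; rewrite E by exact Ht; apply H, Ht.
Qed.

(** The zero function competes and [w] bounds all competitors, so the
    supremum is finite. *)
Lemma associated_weight_lub z : is_lub_Rbar (fun y => exists f : C -> C,
    entire f /\ (forall u : C, Cmod (f u) <= w (Cmod u)) /\ y = Cmod (f z))
  (associated_weight w z).
Proof.
unfold associated_weight; set (P := fun y => _).
pose proof (Lub_Rbar_correct P) as [Hu Hl].
assert (H0 : P 0).
{ exists (fun _ => RtoC 0); split; [|split].
  - intros u; exists zero; apply is_derive_const.
  - intros u; rewrite Cmod_0; apply Rlt_le, w_weight, Cmod_ge_0.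
  - rewrite Cmod_0; reflexivity. }
specialize (Hu 0 H0) as H2.
assert (H1 : Rbar_le (Lub_Rbar P) (w (Cmod z))) by (apply Hl; intros y [f [_ [Hf ->]]]; apply Hf).
destruct (Lub_Rbar P) as [r| |]; simpl in *; try contradiction.
split; [exact Hu|exact Hl].
Qed.

Lemma associated_weight_le t : 0 <= t -> associated_weight w (RtoC t) <= w t.
Proof.
intros Ht; apply (proj2 (associated_weight_lub (RtoC t)) (w t)).
intros y [f [_ [Hf ->]]]; specialize (Hf (RtoC t)).
rewrite Cmod_R, Rabs_pos_eq in Hf by exact Ht; exact Hf.
Qed.

Lemma le_associated_weight (f : C -> C) c z : 0 <= c -> entire f ->
  (forall u, c * Cmod (f u) <= w (Cmod u)) -> c * Cmod (f z) <= associated_weight w z.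
Proof.
intros Hc Hf Hle.
apply (proj1 (associated_weight_lub z) (c * Cmod (f z))).
assert (E : forall u, Cmod (RtoC c * f u)%C = c * Cmod (f u)).
{ intros u; rewrite Cmod_mult, Cmod_R, Rabs_pos_eq by exact Hc; reflexivity. }
exists (fun u => (RtoC c * f u)%C); split; [|split].
- intros u; destruct (Hf u) as [l Hl]; apply is_derive_C_AbsRing in Hl.
  eexists; apply is_derive_C_AbsRing.
  exact (is_derive_mult (K := C_AbsRing) (fun _ => RtoC c) f u zero l
    (is_derive_const _ _) Hl Cmult_comm).
- intros u; rewrite E; apply Hle.
- rewrite E; reflexivity.
Qed.

End Constructions.

(** * Additive rectangle functions that are locally small *)

Lemma nested_intervals (x l : nat -> R) :
  (forall n, x n <= x (S n)) -> (forall n, x (S n) + l (S n) <= x n + l n) ->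
  (forall n, 0 <= l n) -> exists x0, forall n, x n <= x0 <= x n + l n.
Proof.
intros Hx Hl Hpos.
assert (Hinc : forall n k, x n <= x (n + k)%nat).
{ induction k as [|k IH]; [rewrite Nat.add_0_r; lra|].
  rewrite Nat.add_succ_r; specialize (Hx (n + k)%nat); lra. }
assert (Hdec : forall n k, x (n + k)%nat + l (n + k)%nat <= x n + l n).
{ induction k as [|k IH]; [rewrite Nat.add_0_r; lra|].
  rewrite Nat.add_succ_r; specialize (Hl (n + k)%nat); lra. }
assert (Hub : forall n m, x m <= x n + l n).
{ intros n m; destruct (le_lt_dec m n) as [H|H].
  - specialize (Hinc m (n - m)%nat); replace (m + (n - m))%nat with n in Hinc by lia.
    specialize (Hpos n); lra.
  - specialize (Hdec n (m - n)%nat); replace (n + (m - n))%nat with m in Hdec by lia.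
    specialize (Hpos m); lra. }
destruct (completeness (fun r => exists n, r = x n)) as [x0 [H1 H2]].
- exists (x O + l O); intros r [n ->]; apply Hub.
- exists (x O); exists O; reflexivity.
- exists x0; intros n; split; [apply H1; eauto|apply H2; intros r [m ->]; apply Hub].
Qed.

Section Bisection.
Variable D : R -> R -> R -> R -> R.
Variables X1 X2 Y1 Y2 : R.
Hypothesis HX : X1 <= X2.
Hypothesis HY : Y1 <= Y2.
Hypothesis D_split_x : forall a b c y1 y2, X1 <= a -> a <= b -> b <= c -> c <= X2 ->
  Y1 <= y1 -> y1 <= y2 -> y2 <= Y2 -> D a c y1 y2 = D a b y1 y2 + D b c y1 y2.
Hypothesis D_split_y : forall x1 x2 a b c, X1 <= x1 -> x1 <= x2 -> x2 <= X2 ->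
  Y1 <= a -> a <= b -> b <= c -> c <= Y2 -> D x1 x2 a c = D x1 x2 a b + D x1 x2 b c.
Hypothesis D_local : forall x0 y0, X1 <= x0 <= X2 -> Y1 <= y0 <= Y2 ->
  forall eps, 0 < eps -> exists d, 0 < d /\ forall a b c e,
    X1 <= a -> a <= x0 <= b -> b <= X2 -> Y1 <= c -> c <= y0 <= e -> e <= Y2 ->
    b - a < d -> e - c < d -> Rabs (D a b c e) <= eps * ((b - a) + (e - c)) ^ 2.

Let wd n := (X2 - X1) / 2 ^ n.
Let ht n := (Y2 - Y1) / 2 ^ n.
Let defect n x y := Rabs (D x (x + wd n) y (y + ht n)).

(** Lower left corner of the rectangle of step [n] in the bisection.  Choosing
    the first quarter with a large value makes the sequence definable without a
    choice principle. *)
Fixpoint bisection_corner (eta : R) (n : nat) : R * R :=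
  match n with
  | O => (X1, Y1)
  | S k =>
    let (x, y) := bisection_corner eta k in
    if Rle_dec (eta / 4 ^ n) (defect n x y) then (x, y)
    else if Rle_dec (eta / 4 ^ n) (defect n (x + wd n) y) then (x + wd n, y)
    else if Rle_dec (eta / 4 ^ n) (defect n x (y + ht n)) then (x, y + ht n)
    else (x + wd n, y + ht n)
  end.

Lemma wd_half n : wd n = wd (S n) + wd (S n).
Proof. unfold wd; simpl; field; apply pow_nonzero; lra. Qed.

Lemma ht_half n : ht n = ht (S n) + ht (S n).
Proof. unfold ht; simpl; field; apply pow_nonzero; lra. Qed.

Lemma wd_ge0 n : 0 <= wd n.
Proof. apply Rmult_le_pos; [lra|apply Rlt_le, Rinv_0_lt_compat, pow_lt; lra]. Qed.

Lemma ht_ge0 n : 0 <= ht n.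
Proof. apply Rmult_le_pos; [lra|apply Rlt_le, Rinv_0_lt_compat, pow_lt; lra]. Qed.

Lemma bisection_corner_spec eta n : eta <= Rabs (D X1 X2 Y1 Y2) ->
  let (x, y) := bisection_corner eta n in
  X1 <= x /\ x + wd n <= X2 /\ Y1 <= y /\ y + ht n <= Y2 /\ eta / 4 ^ n <= defect n x y.
Proof.
intros He; induction n as [|n IH].
- unfold bisection_corner, defect, wd, ht; simpl pow.
  replace (X1 + (X2 - X1) / 1) with X2 by field.
  replace (Y1 + (Y2 - Y1) / 1) with Y2 by field.
  repeat split; lra.
- cbn [bisection_corner].
  destruct (bisection_corner eta n) as [x y].
  destruct IH as [I1 [I2 [I3 [I4 I5]]]].
  pose proof (wd_half n); pose proof (ht_half n).
  pose proof (wd_ge0 (S n)); pose proof (ht_ge0 (S n)).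
  destruct (Rle_dec _ _) as [Q1|Q1]; [repeat split; lra|].
  destruct (Rle_dec _ _) as [Q2|Q2]; [repeat split; lra|].
  destruct (Rle_dec _ _) as [Q3|Q3]; [repeat split; lra|].
  repeat split; try lra.
  apply Rnot_le_lt in Q1, Q2, Q3; apply Rnot_lt_le; intros Q4.
  assert (E4 : eta / 4 ^ n = 4 * (eta / 4 ^ S n)) by (simpl; field; apply pow_nonzero; lra).
  unfold defect in *.
  rewrite (D_split_x x (x + wd (S n)) (x + wd n)),
    (D_split_y x (x + wd (S n)) y (y + ht (S n)) (y + ht n)),
    (D_split_y (x + wd (S n)) (x + wd n) y (y + ht (S n)) (y + ht n)) in I5 by lra.
  replace (x + wd n) with (x + wd (S n) + wd (S n)) in I5 by lra.
  replace (y + ht n) with (y + ht (S n) + ht (S n)) in I5 by lra.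
  revert I5; apply Rlt_not_le.
  eapply Rle_lt_trans; [apply Rabs_triang|].
  pose proof (Rabs_triang (D x (x + wd (S n)) y (y + ht (S n)))
    (D x (x + wd (S n)) (y + ht (S n)) (y + ht (S n) + ht (S n)))).
  pose proof (Rabs_triang (D (x + wd (S n)) (x + wd (S n) + wd (S n)) y (y + ht (S n)))
    (D (x + wd (S n)) (x + wd (S n) + wd (S n)) (y + ht (S n)) (y + ht (S n) + ht (S n)))).
  lra.
Qed.

(** Goursat's argument in abstract form.  If the value were [eta <> 0], one
    quarter would carry at least [eta / 4], and so on; at the common point of
    the nested rectangles the value would not be small compared with the square
    of their size. *)
Lemma additive_locally_small_zero : D X1 X2 Y1 Y2 = 0.
Proof.
apply NNPP; intros Hne.
set (eta := Rabs (D X1 X2 Y1 Y2)).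
assert (Heta : 0 < eta) by (apply Rabs_pos_lt, Hne).
pose proof (fun n => bisection_corner_spec eta n (Rle_refl _)) as Hspec.
set (p := bisection_corner eta) in *.
assert (Hstep : forall n, (fst (p (S n)) = fst (p n) \/ fst (p (S n)) = fst (p n) + wd (S n)) /\
                          (snd (p (S n)) = snd (p n) \/ snd (p (S n)) = snd (p n) + ht (S n))).
{ intros n; unfold p; cbn [bisection_corner].
  destruct (bisection_corner eta n) as [x y].
  destruct (Rle_dec _ _); [cbn; auto|].
  destruct (Rle_dec _ _); [cbn; auto|].
  destruct (Rle_dec _ _); cbn; auto. }
destruct (nested_intervals (fun n => fst (p n)) wd) as [x0 Hx0].
{ intros n; pose proof (wd_ge0 (S n)); destruct (proj1 (Hstep n)) as [E|E]; rewrite E; lra. }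
{ intros n; pose proof (wd_half n); pose proof (wd_ge0 (S n));
    destruct (proj1 (Hstep n)) as [E|E]; rewrite E; lra. }
{ exact wd_ge0. }
destruct (nested_intervals (fun n => snd (p n)) ht) as [y0 Hy0].
{ intros n; pose proof (ht_ge0 (S n)); destruct (proj2 (Hstep n)) as [E|E]; rewrite E; lra. }
{ intros n; pose proof (ht_half n); pose proof (ht_ge0 (S n));
    destruct (proj2 (Hstep n)) as [E|E]; rewrite E; lra. }
{ exact ht_ge0. }
set (L := (X2 - X1) + (Y2 - Y1)).
assert (HL : 0 <= L) by (unfold L; lra).
assert (HxyI : (X1 <= x0 <= X2) /\ (Y1 <= y0 <= Y2)).
{ specialize (Hspec O); specialize (Hx0 O); specialize (Hy0 O).
  destruct (p O) as [x y]; simpl in *; lra. }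
destruct HxyI as [Hx0I Hy0I].
assert (HL2 : 0 < eta / (2 * (L ^ 2 + 1))).
{ apply Rdiv_lt_0_compat; [exact Heta|pose proof (pow2_ge_0 L); lra]. }
destruct (D_local x0 y0 Hx0I Hy0I _ HL2) as [d [Hd Hloc]].
assert (Hn : exists n, L / 2 ^ n < d).
{ destruct (pow_lt_1_zero (1/2) ltac:(rewrite Rabs_pos_eq; lra) (d / (L + 1))
    ltac:(apply Rdiv_lt_0_compat; lra)) as [N HN].
  exists N; specialize (HN N (le_n N)); rewrite Rabs_pos_eq in HN by (apply pow_le; lra).
  unfold Rdiv at 1; rewrite <- pow_inv; replace (/ 2) with (1/2) by lra.
  apply Rmult_lt_compat_r with (r := L + 1) in HN; [|lra].
  replace (d / (L + 1) * (L + 1)) with d in HN by (field; lra).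
  assert (0 < (1/2) ^ N) by (apply pow_lt; lra); nra. }
destruct Hn as [n Hn].
specialize (Hspec n); specialize (Hx0 n); specialize (Hy0 n).
destruct (p n) as [x y]; cbn [fst snd] in *.
assert (Es : wd n + ht n = L / 2 ^ n) by (unfold wd, ht, L; field; apply pow_nonzero; lra).
pose proof (wd_ge0 n); pose proof (ht_ge0 n).
specialize (Hloc x (x + wd n) y (y + ht n) ltac:(lra) ltac:(lra) ltac:(lra) ltac:(lra)
  ltac:(lra) ltac:(lra) ltac:(lra) ltac:(lra)).
destruct Hspec as [_ [_ [_ [_ Hdef]]]]; unfold defect in Hdef.
replace (x + wd n - x + (y + ht n - y)) with (L / 2 ^ n) in Hloc by lra.
assert (E4 : (L / 2 ^ n) ^ 2 = L ^ 2 / 4 ^ n).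
{ unfold Rdiv; rewrite Rpow_mult_distr, <- !pow_inv, <- pow_mult, Nat.mul_comm, pow_mult.
  f_equal; f_equal; lra. }
rewrite E4 in Hloc.
assert (H4 : 0 < / 4 ^ n) by (apply Rinv_0_lt_compat, pow_lt; lra).
assert (Hc : eta / 4 ^ n <= eta / (2 * (L ^ 2 + 1)) * (L ^ 2 / 4 ^ n)) by lra.
unfold Rdiv at 1 in Hc; rewrite (Rmult_comm eta) in Hc.
replace (eta / (2 * (L ^ 2 + 1)) * (L ^ 2 / 4 ^ n))
  with (/ 4 ^ n * (eta * (L ^ 2 / (2 * (L ^ 2 + 1))))) in Hc
  by (field; split; [apply pow_nonzero; lra|pose proof (pow2_ge_0 L); lra]).
apply Rmult_le_reg_l in Hc; [|exact H4].
assert (L ^ 2 / (2 * (L ^ 2 + 1)) < 1).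
{ pose proof (pow2_ge_0 L).
  apply Rmult_lt_reg_r with (2 * (L ^ 2 + 1)); [lra|].
  unfold Rdiv; rewrite Rmult_assoc, Rinv_l by lra; lra. }
nra.
Qed.

End Bisection.

(** * Goursat's theorem on rectangles *)

Definition continuous_2d (P : R -> R -> R) (x0 y0 : R) : Prop :=
  forall eps, 0 < eps -> exists d, 0 < d /\ forall x y,
    Rabs (x - x0) < d -> Rabs (y - y0) < d -> Rabs (P x y - P x0 y0) < eps.

Definition cauchy_riemann (P Q : R -> R -> R) (x0 y0 : R) : Prop :=
  exists g1 g2, forall eps, 0 < eps -> exists d, 0 < d /\ forall x y,
    Rabs (x - x0) < d -> Rabs (y - y0) < d ->
    Rabs (P x y - P x0 y0 - (g1 * (x - x0) - g2 * (y - y0)))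
      <= eps * (Rabs (x - x0) + Rabs (y - y0)) /\
    Rabs (Q x y - Q x0 y0 - (g2 * (x - x0) + g1 * (y - y0)))
      <= eps * (Rabs (x - x0) + Rabs (y - y0)).

(** The imaginary part of the integral of [P + i Q] around the rectangle.  The
    real part is not considered: multiplying the function by a constant of
    modulus one turns one into the other. *)
Definition boundary_integral (P Q : R -> R -> R) (a b c d : R) : R :=
  RInt (fun x => Q x c - Q x d) a b + RInt (fun y => P b y - P a y) c d.

Lemma continuous_epsilon (f : R -> R) x :
  (forall eps, 0 < eps -> exists d, 0 < d /\ forall y,
     Rabs (y - x) < d -> Rabs (f y - f x) < eps) -> continuous f x.
Proof.
intros H; apply filterlim_locally; intros eps.
destruct (H eps (cond_pos eps)) as [d [Hd Hf]].
exists (mkposreal d Hd); intros y Hy; apply Hf, Hy.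
Qed.

Lemma continuous_2d_x P x0 y0 : continuous_2d P x0 y0 -> continuous (fun x => P x y0) x0.
Proof.
intros H; apply continuous_epsilon; intros eps He.
destruct (H eps He) as [d [Hd Hc]]; exists d; split; [exact Hd|].
intros x Hx; apply Hc; [exact Hx|rewrite Rminus_diag, Rabs_R0; exact Hd].
Qed.

Lemma continuous_2d_y P x0 y0 : continuous_2d P x0 y0 -> continuous (fun y => P x0 y) y0.
Proof.
intros H; apply continuous_epsilon; intros eps He.
destruct (H eps He) as [d [Hd Hc]]; exists d; split; [exact Hd|].
intros y Hy; apply Hc; [rewrite Rminus_diag, Rabs_R0; exact Hd|exact Hy].
Qed.

Lemma RInt_near_const (f : R -> R) a b k M : a <= b -> ex_RInt f a b ->
  (forall x, a < x < b -> Rabs (f x - k) <= M) ->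
  Rabs (RInt f a b - k * (b - a)) <= M * (b - a).
Proof.
intros Hab Hex Hf.
assert (Hc : forall c, RInt (fun _ => c) a b = c * (b - a)).
{ intros c; rewrite RInt_const; unfold scal; simpl; unfold mult; simpl; ring. }
assert (H1 : RInt (fun _ => k - M) a b <= RInt f a b).
{ apply RInt_le; [exact Hab|apply ex_RInt_const|exact Hex|].
  intros x Hx; specialize (Hf x Hx); apply Rabs_le_between in Hf; lra. }
assert (H2 : RInt f a b <= RInt (fun _ => k + M) a b).
{ apply RInt_le; [exact Hab|exact Hex|apply ex_RInt_const|].
  intros x Hx; specialize (Hf x Hx); apply Rabs_le_between in Hf; lra. }
rewrite Hc in H1, H2; apply Rabs_le; split; lra.
Qed.

Section Rectangle.
Variables P Q : R -> R -> R.
Variables X1 X2 Y1 Y2 : R.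
Hypothesis HX : X1 <= X2.
Hypothesis HY : Y1 <= Y2.
Hypothesis P_cont : forall x y, X1 <= x <= X2 -> Y1 <= y <= Y2 -> continuous_2d P x y.
Hypothesis Q_cont : forall x y, X1 <= x <= X2 -> Y1 <= y <= Y2 -> continuous_2d Q x y.

Lemma ex_RInt_horizontal a b c d : X1 <= a -> a <= b -> b <= X2 ->
  Y1 <= c <= Y2 -> Y1 <= d <= Y2 -> ex_RInt (fun x => Q x c - Q x d) a b.
Proof.
intros; apply (ex_RInt_continuous (V := R_CompleteNormedModule)); intros x Hx.
rewrite Rmin_left, Rmax_right in Hx by lra.
apply (continuous_minus (V := R_NormedModule)); apply continuous_2d_x, Q_cont; lra.
Qed.

Lemma ex_RInt_vertical a b c d : X1 <= a <= X2 -> X1 <= b <= X2 ->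
  Y1 <= c -> c <= d -> d <= Y2 -> ex_RInt (fun y => P b y - P a y) c d.
Proof.
intros; apply (ex_RInt_continuous (V := R_CompleteNormedModule)); intros x Hx.
rewrite Rmin_left, Rmax_right in Hx by lra.
apply (continuous_minus (V := R_NormedModule)); apply continuous_2d_y, P_cont; lra.
Qed.

Lemma boundary_integral_split_x a b c y1 y2 : X1 <= a -> a <= b -> b <= c -> c <= X2 ->
  Y1 <= y1 -> y1 <= y2 -> y2 <= Y2 ->
  boundary_integral P Q a c y1 y2 =
  boundary_integral P Q a b y1 y2 + boundary_integral P Q b c y1 y2.
Proof.
intros; unfold boundary_integral.
rewrite <- (RInt_Chasles (V := R_CompleteNormedModule) (fun x => Q x y1 - Q x y2) a b c)
  by (apply ex_RInt_horizontal; lra).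
replace (RInt (fun y => P c y - P a y) y1 y2)
  with (RInt (fun y => P b y - P a y) y1 y2 + RInt (fun y => P c y - P b y) y1 y2).
- unfold plus; simpl; ring.
- rewrite <- (RInt_plus (V := R_CompleteNormedModule)) by (apply ex_RInt_vertical; lra).
  apply RInt_ext; intros; unfold plus; simpl; ring.
Qed.

Lemma boundary_integral_split_y x1 x2 a b c : X1 <= x1 -> x1 <= x2 -> x2 <= X2 ->
  Y1 <= a -> a <= b -> b <= c -> c <= Y2 ->
  boundary_integral P Q x1 x2 a c =
  boundary_integral P Q x1 x2 a b + boundary_integral P Q x1 x2 b c.
Proof.
intros; unfold boundary_integral.
rewrite <- (RInt_Chasles (V := R_CompleteNormedModule) (fun y => P x2 y - P x1 y) a b c)
  by (apply ex_RInt_vertical; lra).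
replace (RInt (fun x => Q x a - Q x c) x1 x2)
  with (RInt (fun x => Q x a - Q x b) x1 x2 + RInt (fun x => Q x b - Q x c) x1 x2).
- unfold plus; simpl; ring.
- rewrite <- (RInt_plus (V := R_CompleteNormedModule)) by (apply ex_RInt_horizontal; lra).
  apply RInt_ext; intros; unfold plus; simpl; ring.
Qed.

(** For an affine function satisfying the Cauchy-Riemann equations the two
    integrals are [g1 * (c - e) * (b - a)] and [g1 * (b - a) * (e - c)], which
    cancel; only the remainder of the linear approximation is left. *)
Lemma boundary_integral_local x0 y0 : cauchy_riemann P Q x0 y0 ->
  forall eps, 0 < eps -> exists d, 0 < d /\ forall a b c e,
    X1 <= a -> a <= x0 <= b -> b <= X2 -> Y1 <= c -> c <= y0 <= e -> e <= Y2 ->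
    b - a < d -> e - c < d ->
    Rabs (boundary_integral P Q a b c e) <= eps * ((b - a) + (e - c)) ^ 2.
Proof.
intros [g1 [g2 Hcr]] eps He.
destruct (Hcr (eps / 2) ltac:(lra)) as [d [Hd H]]; exists d; split; [exact Hd|].
intros a b c e Ha Hab Hb Hc Hce He' Hd1 Hd2.
set (s := (b - a) + (e - c)).
assert (Hin : forall x y, a <= x <= b -> c <= y <= e ->
  Rabs (P x y - P x0 y0 - (g1 * (x - x0) - g2 * (y - y0))) <= eps / 2 * s /\
  Rabs (Q x y - Q x0 y0 - (g2 * (x - x0) + g1 * (y - y0))) <= eps / 2 * s).
{ intros x y Hx Hy.
  assert (A1 : Rabs (x - x0) <= b - a) by (apply Rabs_le; lra).
  assert (A2 : Rabs (y - y0) <= e - c) by (apply Rabs_le; lra).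
  destruct (H x y ltac:(lra) ltac:(lra)) as [B1 B2].
  assert (eps / 2 * (Rabs (x - x0) + Rabs (y - y0)) <= eps / 2 * s)
    by (apply Rmult_le_compat_l; unfold s; lra).
  split; lra. }
assert (Hh : Rabs (RInt (fun x => Q x c - Q x e) a b - g1 * (c - e) * (b - a)) <=
             eps * s * (b - a)).
{ apply RInt_near_const; [lra|apply ex_RInt_horizontal; lra|].
  intros x Hx.
  destruct (Hin x c ltac:(lra) ltac:(lra)) as [_ B1]; apply Rabs_le_between in B1.
  destruct (Hin x e ltac:(lra) ltac:(lra)) as [_ B2]; apply Rabs_le_between in B2.
  apply Rabs_le; split; lra. }
assert (Hv : Rabs (RInt (fun y => P b y - P a y) c e - g1 * (b - a) * (e - c)) <=
             eps * s * (e - c)).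
{ apply RInt_near_const; [lra|apply ex_RInt_vertical; lra|].
  intros y Hy.
  destruct (Hin a y ltac:(lra) ltac:(lra)) as [B1 _]; apply Rabs_le_between in B1.
  destruct (Hin b y ltac:(lra) ltac:(lra)) as [B2 _]; apply Rabs_le_between in B2.
  apply Rabs_le; split; lra. }
unfold boundary_integral.
apply Rabs_le_between in Hh; apply Rabs_le_between in Hv.
replace (eps * s ^ 2) with (eps * s * (b - a) + eps * s * (e - c)) by (unfold s; ring).
apply Rabs_le; split; lra.
Qed.
End Rectangle.

Lemma goursat_rectangle P Q X1 X2 Y1 Y2 : X1 <= X2 -> Y1 <= Y2 ->
  (forall x y, X1 <= x <= X2 -> Y1 <= y <= Y2 -> continuous_2d P x y /\ continuous_2d Q x y) ->
  (forall x y, X1 <= x <= X2 -> Y1 <= y <= Y2 -> cauchy_riemann P Q x y) ->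
  boundary_integral P Q X1 X2 Y1 Y2 = 0.
Proof.
intros HX HY Hcont Hcr.
pose proof (fun x y h1 h2 => proj1 (Hcont x y h1 h2)) as HP.
pose proof (fun x y h1 h2 => proj2 (Hcont x y h1 h2)) as HQ.
apply additive_locally_small_zero; try assumption.
- intros; apply (boundary_integral_split_x P Q X1 X2 Y1 Y2); assumption.
- intros; apply (boundary_integral_split_y P Q X1 X2 Y1 Y2); assumption.
- intros x0 y0 Hx0 Hy0; apply (boundary_integral_local P Q X1 X2 Y1 Y2); try assumption.
  apply Hcr; assumption.
Qed.

(** By additivity the integral equals the one over a small square around the
    exceptional point, and there [P] and [Q] vary by less than [1]. *)
Lemma goursat_rectangle_except P Q X1 X2 Y1 Y2 xs ys : X1 < xs < X2 -> Y1 < ys < Y2 ->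
  (forall x y, X1 <= x <= X2 -> Y1 <= y <= Y2 -> continuous_2d P x y /\ continuous_2d Q x y) ->
  (forall x y, X1 <= x <= X2 -> Y1 <= y <= Y2 -> (x, y) <> (xs, ys) -> cauchy_riemann P Q x y) ->
  boundary_integral P Q X1 X2 Y1 Y2 = 0.
Proof.
intros Hxs Hys Hcont Hcr.
pose proof (fun x y h1 h2 => proj1 (Hcont x y h1 h2)) as HP.
pose proof (fun x y h1 h2 => proj2 (Hcont x y h1 h2)) as HQ.
apply NNPP; intros Hne.
set (B := Rabs (boundary_integral P Q X1 X2 Y1 Y2)).
assert (HB : 0 < B) by (apply Rabs_pos_lt, Hne).
destruct (HP xs ys ltac:(lra) ltac:(lra) 1 ltac:(lra)) as [d1 [Hd1 HP1]].
destruct (HQ xs ys ltac:(lra) ltac:(lra) 1 ltac:(lra)) as [d2 [Hd2 HQ1]].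
assert (Hex : exists d, 0 < d /\ d < d1 /\ d < d2 /\ X1 <= xs - d /\ xs + d <= X2 /\
                        Y1 <= ys - d /\ ys + d <= Y2 /\ 8 * d < B).
{ exists (Rmin (Rmin (Rmin (d1 / 2) (d2 / 2)) (Rmin (xs - X1) (X2 - xs)))
               (Rmin (Rmin (ys - Y1) (Y2 - ys)) (B / 9))).
  repeat apply Rmin_case_strong; intros; repeat split; lra. }
destruct Hex as [d [H0 [H1 [H2 [H3 [H4 [H5 [H6 H7]]]]]]]].
assert (Z : forall a b c e, X1 <= a -> a <= b -> b <= X2 -> Y1 <= c -> c <= e -> e <= Y2 ->
  ~ (a <= xs <= b /\ c <= ys <= e) -> boundary_integral P Q a b c e = 0).
{ intros a b c e ? ? ? ? ? ? N; apply goursat_rectangle; try assumption.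
  - intros; apply Hcont; lra.
  - intros x y Hx Hy; apply Hcr; [lra|lra|]; intros E; injection E as -> ->; tauto. }
assert (E : boundary_integral P Q X1 X2 Y1 Y2 =
            boundary_integral P Q (xs - d) (xs + d) (ys - d) (ys + d)).
{ rewrite (boundary_integral_split_x P Q X1 X2 Y1 Y2 HP HQ X1 (xs - d) X2),
    (boundary_integral_split_x P Q X1 X2 Y1 Y2 HP HQ (xs - d) (xs + d) X2),
    (boundary_integral_split_y P Q X1 X2 Y1 Y2 HP HQ (xs - d) (xs + d) Y1 (ys - d) Y2),
    (boundary_integral_split_y P Q X1 X2 Y1 Y2 HP HQ (xs - d) (xs + d) (ys - d) (ys + d) Y2)
    by lra.
  rewrite (Z X1 (xs - d)), (Z (xs + d) X2), (Z (xs - d) (xs + d) Y1),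
    (Z (xs - d) (xs + d) (ys + d) Y2) by lra.
  ring. }
assert (Hh : Rabs (RInt (fun x => Q x (ys - d) - Q x (ys + d)) (xs - d) (xs + d)
                   - 0 * (xs + d - (xs - d))) <= 2 * (xs + d - (xs - d))).
{ apply RInt_near_const; [lra|apply (ex_RInt_horizontal Q X1 X2 Y1 Y2); auto; lra|].
  intros x Hx.
  pose proof (HQ1 x (ys - d) ltac:(apply Rabs_lt_between; lra) ltac:(apply Rabs_lt_between; lra)) as B1.
  pose proof (HQ1 x (ys + d) ltac:(apply Rabs_lt_between; lra) ltac:(apply Rabs_lt_between; lra)) as B2.
  apply Rabs_lt_between in B1, B2; apply Rabs_le; lra. }
assert (Hv : Rabs (RInt (fun y => P (xs + d) y - P (xs - d) y) (ys - d) (ys + d)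
                   - 0 * (ys + d - (ys - d))) <= 2 * (ys + d - (ys - d))).
{ apply RInt_near_const; [lra|apply (ex_RInt_vertical P X1 X2 Y1 Y2); auto; lra|].
  intros y Hy.
  pose proof (HP1 (xs - d) y ltac:(apply Rabs_lt_between; lra) ltac:(apply Rabs_lt_between; lra)) as B1.
  pose proof (HP1 (xs + d) y ltac:(apply Rabs_lt_between; lra) ltac:(apply Rabs_lt_between; lra)) as B2.
  apply Rabs_lt_between in B1, B2; apply Rabs_le; lra. }
assert (B <= 8 * d); [|lra].
unfold B; rewrite E; unfold boundary_integral.
apply Rabs_le_between in Hh; apply Rabs_le_between in Hv; apply Rabs_le; lra.
Qed.

(** * Complex derivatives and integrals over circles *)

(** Complex differentiability for the structure on which products and
    compositions can be differentiated. *)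
Definition C_derivable (f : C -> C) (z : C) : Prop :=
  @ex_derive C_AbsRing (AbsRing_NormedModule C_AbsRing) f z.

Definition C_continuous (f : C -> C) (z : C) : Prop :=
  forall eps, 0 < eps -> exists d, 0 < d /\ forall y,
    Cmod (y - z) < d -> Cmod (f y - f z) < eps.

Lemma entire_C_derivable f : entire f -> forall z, C_derivable f z.
Proof. intros Hf z; destruct (Hf z) as [l Hl]; exists l; apply is_derive_C_AbsRing, Hl. Qed.

Lemma C_derivable_epsilon f z : C_derivable f z <-> exists l,
  forall eps, 0 < eps -> exists d, 0 < d /\ forall y, Cmod (y - z) < d ->
    Cmod (f y - f z - (y - z) * l) <= eps * Cmod (y - z).
Proof.
split; intros [l Hl]; exists l.
- apply is_derive_C_epsilon, is_derive_C_AbsRing, Hl.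
- apply is_derive_C_AbsRing, is_derive_C_epsilon, Hl.
Qed.

Lemma C_derivable_const (c z : C) : C_derivable (fun _ => c) z.
Proof. exists zero; apply is_derive_const. Qed.

Lemma C_derivable_id z : C_derivable (fun u => u) z.
Proof. exists one; apply (is_derive_id (K := C_AbsRing)). Qed.

Lemma C_derivable_minus f g z : C_derivable f z -> C_derivable g z ->
  C_derivable (fun u => f u - g u)%C z.
Proof.
intros [l1 H1] [l2 H2]; eexists.
exact (is_derive_minus (K := C_AbsRing) (V := AbsRing_NormedModule C_AbsRing) f g z l1 l2 H1 H2).
Qed.

Lemma C_derivable_mult f g z : C_derivable f z -> C_derivable g z ->
  C_derivable (fun u => f u * g u)%C z.
Proof.
intros [l1 H1] [l2 H2]; eexists.
exact (is_derive_mult (K := C_AbsRing) f g z l1 l2 H1 H2 Cmult_comm).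
Qed.

Lemma C_derivable_pow f n z : C_derivable f z -> C_derivable (fun u => f u ^ n)%C z.
Proof.
intros Hf; induction n as [|n IH]; [exact (C_derivable_const (RtoC 1) z)|].
exact (C_derivable_mult f (fun u => f u ^ n)%C z Hf IH).
Qed.

Lemma C_derivable_comp f g z : C_derivable f (g z) -> C_derivable g z ->
  C_derivable (fun u => f (g u)) z.
Proof.
intros [l1 H1] [l2 H2]; eexists.
exact (is_derive_comp (K := C_AbsRing) (V := AbsRing_NormedModule C_AbsRing) f g z l1 l2 H1 H2).
Qed.

Lemma C_derivable_inv (z : C) : z <> 0 -> C_derivable Cinv z.
Proof.
intros Hz; apply C_derivable_epsilon; exists (- (/ (z * z)))%C; intros eps He.
assert (Hm : 0 < Cmod z) by (apply Cmod_gt_0; exact Hz).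
set (m := Cmod z) in *.
assert (Hm3 : 0 < m * m * m) by (repeat apply Rmult_lt_0_compat; exact Hm).
exists (Rmin (m / 2) (eps * (m * m * m) / 2)); split.
{ apply Rmin_glb_lt; [lra|]; assert (0 < eps * (m * m * m)) by (apply Rmult_lt_0_compat; lra); lra. }
intros y Hy.
pose proof (Rmin_l (m / 2) (eps * (m * m * m) / 2)).
pose proof (Rmin_r (m / 2) (eps * (m * m * m) / 2)).
assert (Hym : m / 2 <= Cmod y).
{ pose proof (Cmod_triangle y (- (y - z))) as T; rewrite Cmod_opp in T.
  replace (y + - (y - z))%C with z in T by ring; fold m in T; lra. }
assert (Hy0 : y <> 0) by (intros ->; rewrite Cmod_0 in Hym; lra).
replace (/ y - / z - (y - z) * - / (z * z))%C with ((y - z) * (y - z) * / (y * (z * z)))%C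
  by (field; split; assumption).
rewrite !Cmod_mult, Cmod_inv, !Cmod_mult
  by (repeat apply Cmult_neq_0; assumption).
fold m; pose proof (Cmod_ge_0 (y - z)) as Hd.
rewrite Rmult_assoc, Rmult_comm; apply Rmult_le_compat_r; [exact Hd|].
apply Rmult_le_reg_r with (Cmod y * (m * m)); [nra|].
rewrite Rmult_assoc, Rinv_l, Rmult_1_r by nra.
apply Rle_trans with (eps * (m / 2 * (m * m))); [lra|].
apply Rmult_le_compat_l; [lra|apply Rmult_le_compat_r; nra].
Qed.

Lemma C_derivable_div f g z : C_derivable f z -> C_derivable g z -> g z <> 0 ->
  C_derivable (fun u => f u / g u)%C z.
Proof.
intros Hf Hg Hz; apply C_derivable_mult; [exact Hf|].
apply (C_derivable_comp Cinv g); [apply C_derivable_inv, Hz|exact Hg].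
Qed.

Lemma C_derivable_continuous f z : C_derivable f z -> C_continuous f z.
Proof.
intros Hf eps He; apply C_derivable_epsilon in Hf as [l Hl].
destruct (Hl 1 ltac:(lra)) as [d [Hd H]].
pose proof (Cmod_ge_0 l) as Hl0.
exists (Rmin d (eps / (Cmod l + 2))); split.
{ apply Rmin_glb_lt; [exact Hd|apply Rdiv_lt_0_compat; lra]. }
intros y Hy.
pose proof (Rmin_l d (eps / (Cmod l + 2))); pose proof (Rmin_r d (eps / (Cmod l + 2))).
specialize (H y ltac:(lra)).
pose proof (Cmod_triangle (f y - f z - (y - z) * l) ((y - z) * l)) as T.
replace (f y - f z - (y - z) * l + (y - z) * l)%C with (f y - f z)%C in T by ring.
rewrite Cmod_mult in T; pose proof (Cmod_ge_0 (y - z)).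
assert (Cmod (y - z) * (Cmod l + 2) < eps).
{ apply Rmult_lt_reg_r with (/ (Cmod l + 2)); [apply Rinv_0_lt_compat; lra|].
  rewrite Rmult_assoc, Rinv_r, Rmult_1_r by lra; unfold Rdiv in *; lra. }
assert (0 <= Cmod (y - z) * Cmod l) by (apply Rmult_le_pos; lra).
nra.
Qed.

Lemma C_derivable_ext_loc f g z r : 0 < r ->
  (forall u, Cmod (u - z) < r -> f u = g u) -> C_derivable f z -> C_derivable g z.
Proof.
intros Hr E Hf; apply C_derivable_epsilon in Hf as [l Hf]; apply C_derivable_epsilon.
exists l; intros eps He; destruct (Hf eps He) as [d [Hd H]].
exists (Rmin d r); split; [apply Rmin_glb_lt; assumption|intros y Hy].
pose proof (Rmin_l d r); pose proof (Rmin_r d r).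
rewrite <- !E; [apply H; lra| |lra].
replace (z - z)%C with (RtoC 0) by ring; rewrite Cmod_0; exact Hr.
Qed.

Definition Cexp (z : C) : C := (exp (fst z) * cos (snd z), exp (fst z) * sin (snd z)).

Lemma Cexp_add z h : Cexp (z + h) = (Cexp z * Cexp h)%C.
Proof.
unfold Cexp; simpl; rewrite exp_plus, cos_plus, sin_plus.
apply injective_projections; simpl; ring.
Qed.

Lemma Cmod_Cexp z : Cmod (Cexp z) = exp (fst z).
Proof.
unfold Cmod, Cexp; cbn [fst snd].
replace ((exp (fst z) * cos (snd z)) ^ 2 + (exp (fst z) * sin (snd z)) ^ 2)
  with (exp (fst z) * exp (fst z) * (Rsqr (sin (snd z)) + Rsqr (cos (snd z))))
  by (unfold Rsqr; ring).
rewrite sin2_cos2, Rmult_1_r; apply sqrt_square, Rlt_le, exp_pos.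
Qed.

Lemma Cmod_le_abs x y : Cmod (x, y) <= Rabs x + Rabs y.
Proof.
pose proof (Cmod_sqr (x, y)) as E; cbn [fst snd] in E.
pose proof (Rabs_pos x); pose proof (Rabs_pos y).
apply Rsqr_incr_0_var; [unfold Rsqr|lra].
assert (Rabs x * Rabs x = x * x) by (rewrite <- Rabs_mult; apply Rabs_pos_eq; nra).
assert (Rabs y * Rabs y = y * y) by (rewrite <- Rabs_mult; apply Rabs_pos_eq; nra).
nra.
Qed.

Lemma derivable_increment f l : derivable_pt_lim f 0 l -> forall eps, 0 < eps ->
  exists d, 0 < d /\ forall h, Rabs h < d -> Rabs (f h - f 0 - l * h) <= eps * Rabs h.
Proof.
intros H eps He; destruct (H eps He) as [d Hd]; exists d; split; [apply cond_pos|].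
intros h Hh; destruct (Req_dec h 0) as [->|Hn].
- rewrite Rmult_0_r, Rminus_diag, Rminus_0_r, Rabs_R0; lra.
- specialize (Hd h Hn Hh); rewrite Rplus_0_l in Hd.
  replace (f h - f 0 - l * h) with (((f h - f 0) / h - l) * h) by (field; exact Hn).
  rewrite Rabs_mult; apply Rmult_le_compat_r; [apply Rabs_pos|lra].
Qed.

(** Differentiability of the exponential at [0], obtained from the derivatives
    of the real functions [exp], [sin] and [cos] at [0]. *)
Lemma Cexp_increment_0 : forall eps, 0 < eps -> exists d, 0 < d /\ forall h,
  Cmod h < d -> Cmod (Cexp h - 1 - h) <= eps * Cmod h.
Proof.
intros eps He; set (e := Rmin 1 (eps / 16)).
assert (He0 : 0 < e) by (apply Rmin_glb_lt; lra).
assert (He1 : e <= 1) by apply Rmin_l.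
assert (He2 : e <= eps / 16) by apply Rmin_r.
clearbody e.
destruct (derivable_increment exp 1 derivable_pt_lim_exp_0 e He0) as [d1 [Hd1 H1]].
destruct (derivable_increment sin 1 derivable_pt_lim_sin_0 e He0) as [d2 [Hd2 H2]].
destruct (derivable_increment cos 0 derivable_pt_lim_cos_0 e He0) as [d3 [Hd3 H3]].
exists (Rmin (Rmin d1 d2) (Rmin d3 e)); split; [repeat apply Rmin_glb_lt; assumption|].
intros h Hh.
pose proof (Rmin_l (Rmin d1 d2) (Rmin d3 e)); pose proof (Rmin_r (Rmin d1 d2) (Rmin d3 e)).
pose proof (Rmin_l d1 d2); pose proof (Rmin_r d1 d2).
pose proof (Rmin_l d3 e); pose proof (Rmin_r d3 e).
pose proof (Re_le_Cmod h) as Ha; pose proof (Im_le_Cmod h) as Hb.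
destruct h as [a b]; set (m := Cmod (a, b)) in *; cbn [fst snd] in Ha, Hb.
specialize (H1 a ltac:(lra)); specialize (H2 b ltac:(lra)); specialize (H3 b ltac:(lra)).
rewrite exp_0 in H1; rewrite sin_0 in H2; rewrite cos_0 in H3.
assert (Hem : forall x, Rabs x <= m -> e * Rabs x <= e * m)
  by (intros; apply Rmult_le_compat_l; lra).
assert (K1 : Rabs (exp a - 1 - 1 * a) <= e * m) by (pose proof (Hem a Ha); lra).
assert (K2 : Rabs (sin b - 0 - 1 * b) <= e * m) by (pose proof (Hem b Hb); lra).
assert (K3 : Rabs (cos b - 1 - 0 * b) <= e * m) by (pose proof (Hem b Hb); lra).
assert (Hm : 0 <= m) by apply Cmod_ge_0.
assert (K4 : Rabs (exp a - 1) <= 2 * m).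
{ apply Rabs_le_between in K1; apply Rabs_le_between in Ha; apply Rabs_le; split; nra. }
assert (K5 : Rabs (sin b) <= 2 * e).
{ apply Rabs_le_between in K2; apply Rabs_le_between in Hb; apply Rabs_le; split; nra. }
assert (K6 : Rabs (cos b) <= 1) by (apply Rabs_le, COS_bound).
assert (R1 : Rabs (exp a * cos b - 1 - a) <= 4 * (e * m)).
{ replace (exp a * cos b - 1 - a)
    with ((exp a - 1 - 1 * a) * cos b + (1 + a) * (cos b - 1 - 0 * b)) by ring.
  eapply Rle_trans; [apply Rabs_triang|]; rewrite !Rabs_mult.
  assert (Rabs (1 + a) <= 2) by (apply Rabs_le_between in Ha; apply Rabs_le; lra).
  pose proof (Rabs_pos (exp a - 1 - 1 * a)); pose proof (Rabs_pos (cos b - 1 - 0 * b)).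
  pose proof (Rabs_pos (cos b)); pose proof (Rabs_pos (1 + a)).
  assert (Rabs (exp a - 1 - 1 * a) * Rabs (cos b) <= e * m * 1)
    by (apply Rmult_le_compat; lra).
  assert (Rabs (1 + a) * Rabs (cos b - 1 - 0 * b) <= 2 * (e * m))
    by (apply Rmult_le_compat; lra).
  lra. }
assert (R2 : Rabs (exp a * sin b - b) <= 5 * (e * m)).
{ replace (exp a * sin b - b)
    with ((exp a - 1) * sin b + (sin b - 0 - 1 * b)) by ring.
  eapply Rle_trans; [apply Rabs_triang|]; rewrite !Rabs_mult.
  assert (Rabs (exp a - 1) * Rabs (sin b) <= 2 * m * (2 * e))
    by (apply Rmult_le_compat; try apply Rabs_pos; assumption).
  lra. }
assert (Hle : Cmod (Cexp (a, b) - 1 - (a, b)) <= Rabs (exp a * cos b - 1 - a) + Rabs (exp a * sin b - b)).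
{ replace (Cexp (a, b) - 1 - (a, b))%C
    with ((exp a * cos b - 1 - a, exp a * sin b - b) : C); [apply Cmod_le_abs|].
  unfold Cexp; apply injective_projections; simpl; ring. }
assert (e * m <= eps / 16 * m) by (apply Rmult_le_compat_r; lra).
nra.
Qed.

Lemma C_derivable_Cexp z : C_derivable Cexp z.
Proof.
apply C_derivable_epsilon; exists (Cexp z); intros eps He.
set (m := Cmod (Cexp z)).
assert (Hm : 0 < m) by (unfold m; rewrite Cmod_Cexp; apply exp_pos).
destruct (Cexp_increment_0 (eps / m) ltac:(apply Rdiv_lt_0_compat; lra)) as [d [Hd H]].
exists d; split; [exact Hd|intros y Hy].
specialize (H (y - z)%C Hy).
replace (Cexp y - Cexp z - (y - z) * Cexp z)%C
  with (Cexp z * (Cexp (y - z) - 1 - (y - z)))%C.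
- rewrite Cmod_mult; fold m.
  replace (eps * Cmod (y - z)) with (m * (eps / m * Cmod (y - z))) by (field; lra).
  apply Rmult_le_compat_l; [lra|exact H].
- replace y with (z + (y - z))%C at 3 by ring; rewrite Cexp_add; ring.
Qed.

(** The segment [- PI <= y <= PI] meets the preimages of the positive real
    number [rho] only at [y = 0], in its interior; this is why circles are
    parametrized from [- PI] to [PI]. *)
Lemma Cexp_preimage_real rho x y : 0 < rho -> - PI <= y <= PI ->
  Cexp (x, y) = RtoC rho -> x = ln rho /\ y = 0.
Proof.
intros Hrho Hy E; injection E as Ec Es; pose proof (exp_pos x) as Hx.
assert (Hs : sin y = 0) by (apply Rmult_integral in Es as [Es|Es]; lra).
assert (Hc : 0 < cos y) by (apply Rnot_le_lt; intros Hle; nra).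
assert (Hy0 : y = 0).
{ destruct (Rtotal_order y 0) as [Hlt|[Heq|Hgt]]; [|exact Heq|].
  - destruct (Req_dec y (- PI)) as [->|Hne].
    + rewrite cos_neg, cos_PI in Hc; lra.
    + pose proof (sin_gt_0 (- y) ltac:(lra) ltac:(lra)) as H; rewrite sin_neg in H; lra.
  - destruct (Req_dec y PI) as [->|Hne].
    + rewrite cos_PI in Hc; lra.
    + pose proof (sin_gt_0 y ltac:(lra) ltac:(lra)); lra. }
split; [|exact Hy0].
subst y; rewrite cos_0, Rmult_1_r in Ec; rewrite <- Ec, ln_exp; reflexivity.
Qed.

Lemma C_continuous_2d f x y : C_continuous f (x, y) ->
  continuous_2d (fun x y => fst (f (x, y))) x y /\
  continuous_2d (fun x y => snd (f (x, y))) x y.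
Proof.
intros Hf.
assert (H : forall eps, 0 < eps -> exists d, 0 < d /\ forall x' y',
  Rabs (x' - x) < d -> Rabs (y' - y) < d -> Cmod (f (x', y') - f (x, y)) < eps).
{ intros eps He; destruct (Hf eps He) as [d [Hd H]].
  exists (d / 2); split; [lra|intros x' y' Hx Hy; apply H].
  apply Rle_lt_trans with (1 := Cmod_le_abs (x' - x) (y' - y)); lra. }
split; intros eps He; destruct (H eps He) as [d [Hd Hc]]; exists d; (split; [exact Hd|]);
  intros x' y' Hx Hy; apply Rle_lt_trans with (2 := Hc x' y' Hx Hy).
- exact (Re_le_Cmod (f (x', y') - f (x, y))).
- exact (Im_le_Cmod (f (x', y') - f (x, y))).
Qed.

Lemma C_derivable_cauchy_riemann f x y : C_derivable f (x, y) ->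
  cauchy_riemann (fun x y => fst (f (x, y))) (fun x y => snd (f (x, y))) x y.
Proof.
intros Hf; apply C_derivable_epsilon in Hf as [l Hl].
exists (fst l), (snd l); intros eps He; destruct (Hl eps He) as [d [Hd H]].
exists (d / 2); split; [lra|intros x' y' Hx Hy].
pose proof (Cmod_le_abs (x' - x) (y' - y)) as Hle.
specialize (H (x', y') (Rle_lt_trans _ _ d Hle ltac:(lra))).
assert (H' : Cmod (f (x', y') - f (x, y) - ((x', y') - (x, y)) * l) <=
             eps * (Rabs (x' - x) + Rabs (y' - y))).
{ apply Rle_trans with (1 := H), Rmult_le_compat_l; [lra|exact Hle]. }
pose proof (Re_le_Cmod (f (x', y') - f (x, y) - ((x', y') - (x, y)) * l)) as A1.
pose proof (Im_le_Cmod (f (x', y') - f (x, y) - ((x', y') - (x, y)) * l)) as A2.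
simpl in A1, A2; split.
- apply Rle_trans with (2 := H'), Rle_trans with (2 := A1); right; f_equal; ring.
- apply Rle_trans with (2 := H'), Rle_trans with (2 := A2); right; f_equal; ring.
Qed.

Definition circle_point (r y : R) : C := (r * cos y, r * sin y).

(** Up to the factor [2 * PI], the real part of the mean of [h] over the circle
    of radius [r]. *)
Definition circle_integral (h : C -> C) (r : R) : R :=
  RInt (fun y => fst (h (circle_point r y))) (- PI) PI.

Lemma Cmod_circle_point r y : 0 <= r -> Cmod (circle_point r y) = r.
Proof.
intros Hr; unfold Cmod, circle_point; cbn [fst snd].
replace ((r * cos y) ^ 2 + (r * sin y) ^ 2)
  with (r * r * (Rsqr (sin y) + Rsqr (cos y))) by (unfold Rsqr; ring).
rewrite sin2_cos2, Rmult_1_r; apply sqrt_square; exact Hr.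
Qed.

Lemma Cexp_circle_point r y : 0 < r -> Cexp (ln r, y) = circle_point r y.
Proof. intros Hr; unfold Cexp, circle_point; cbn [fst snd]; rewrite exp_ln by exact Hr; reflexivity. Qed.

(** In logarithmic coordinates the annulus becomes a rectangle whose horizontal
    sides carry the same values by periodicity of the exponential, so the
    integrals over the vertical sides agree. *)
Lemma circle_integral_const h r1 r2 rho : 0 < r1 -> r1 < rho < r2 ->
  C_continuous h (RtoC rho) ->
  (forall u, r1 <= Cmod u <= r2 -> u <> RtoC rho -> C_derivable h u) ->
  circle_integral h r1 = circle_integral h r2.
Proof.
intros Hr1 Hrho Hcont Hder.
pose proof PI_RGT_0 as Hpi.
set (f := fun z => h (Cexp z)).
set (P := fun x y => fst (f (x, y))); set (Q := fun x y => snd (f (x, y))).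
assert (L1 : ln r1 < ln rho) by (apply ln_increasing; lra).
assert (L2 : ln rho < ln r2) by (apply ln_increasing; lra).
assert (Hf : forall x y, ln r1 <= x <= ln r2 -> - PI <= y <= PI ->
  (x, y) <> (ln rho, 0) -> C_derivable f (x, y)).
{ intros x y Hx Hy Hne; apply (C_derivable_comp h Cexp); [|apply C_derivable_Cexp].
  apply Hder.
  - rewrite Cmod_Cexp; cbn [fst]; split.
    + rewrite <- (exp_ln r1) by lra; destruct (proj1 Hx) as [H|H];
        [apply Rlt_le, exp_increasing, H|rewrite H; lra].
    + rewrite <- (exp_ln r2) by lra; destruct (proj2 Hx) as [H|H];
        [apply Rlt_le, exp_increasing, H|rewrite H; lra].
  - intros E; apply Hne; destruct (Cexp_preimage_real rho x y ltac:(lra) Hy E) as [-> ->].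
    reflexivity. }
assert (HPQ : forall x y, ln r1 <= x <= ln r2 -> - PI <= y <= PI ->
  continuous_2d P x y /\ continuous_2d Q x y).
{ intros x y Hx Hy; apply C_continuous_2d.
  destruct (classic ((x, y) = (ln rho, 0))) as [E|Hne].
  - assert (Ec : Cexp (x, y) = RtoC rho).
    { rewrite E, Cexp_circle_point by lra; unfold circle_point, RtoC.
      rewrite cos_0, sin_0; f_equal; ring. }
    intros eps He; unfold f; rewrite Ec.
    destruct (Hcont eps He) as [d1 [Hd1 H1]].
    destruct (C_derivable_continuous Cexp (x, y) (C_derivable_Cexp _) d1 Hd1) as [d2 [Hd2 H2]].
    exists d2; split; [exact Hd2|intros u Hu; apply H1; rewrite <- Ec; apply H2, Hu].
  - apply C_derivable_continuous, Hf; assumption. }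
assert (Hz : boundary_integral P Q (ln r1) (ln r2) (- PI) PI = 0).
{ apply (goursat_rectangle_except P Q (ln r1) (ln r2) (- PI) PI (ln rho) 0); try lra.
  - exact HPQ.
  - intros x y Hx Hy Hne; apply (C_derivable_cauchy_riemann f), Hf; assumption. }
unfold boundary_integral in Hz.
assert (Hper : RInt (fun x => Q x (- PI) - Q x PI) (ln r1) (ln r2) = 0).
{ rewrite (RInt_ext _ (fun _ => 0)).
  - rewrite RInt_const; unfold scal; simpl; unfold mult; simpl; ring.
  - intros x _; unfold Q, f.
    replace (Cexp (x, - PI)) with (Cexp (x, PI)); [apply Rminus_diag|].
    unfold Cexp; cbn [fst snd]; rewrite cos_neg, sin_neg, sin_PI; f_equal; ring. }
assert (Hex : forall x, ln r1 <= x <= ln r2 -> ex_RInt (fun y => P x y) (- PI) PI).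
{ intros x Hx; apply (ex_RInt_continuous (V := R_CompleteNormedModule)); intros y Hy.
  rewrite Rmin_left, Rmax_right in Hy by lra.
  apply continuous_2d_y, HPQ; assumption. }
rewrite Hper, Rplus_0_l in Hz.
rewrite (RInt_ext _ (fun y => minus (P (ln r2) y) (P (ln r1) y))) in Hz
  by (intros; reflexivity).
rewrite (RInt_minus (V := R_CompleteNormedModule)) in Hz by (apply Hex; lra).
assert (E : forall r, 0 < r -> RInt (fun y => P (ln r) y) (- PI) PI = circle_integral h r).
{ intros r Hr; apply RInt_ext; intros y _; unfold P, f.
  rewrite Cexp_circle_point by exact Hr; reflexivity. }
rewrite !E in Hz by lra.
unfold minus, plus, opp in Hz; simpl in Hz; lra.
Qed.

(** * Cauchy's estimate in an annulus *)

Lemma ex_RInt_circle h r : 0 < r -> (forall u, Cmod u = r -> C_continuous h u) ->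
  ex_RInt (fun y => fst (h (circle_point r y))) (- PI) PI.
Proof.
intros Hr Hh; apply (ex_RInt_continuous (V := R_CompleteNormedModule)); intros y _.
apply (continuous_ext (fun y => fst (h (Cexp (ln r, y))))).
{ intros t; rewrite Cexp_circle_point by exact Hr; reflexivity. }
apply (continuous_2d_y (fun x y => fst (h (Cexp (x, y))))).
apply (C_continuous_2d (fun z => h (Cexp z))).
intros eps He.
assert (Hc : C_continuous h (Cexp (ln r, y))).
{ apply Hh; rewrite Cmod_Cexp; apply exp_ln, Hr. }
destruct (Hc eps He) as [d1 [Hd1 H1]].
destruct (C_derivable_continuous Cexp (ln r, y) (C_derivable_Cexp _) d1 Hd1) as [d2 [Hd2 H2]].
exists d2; split; [exact Hd2|intros u Hu; apply H1, H2, Hu].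
Qed.

Lemma circle_integral_near h r k M : 0 < r ->
  (forall u, Cmod u = r -> C_continuous h u) ->
  (forall u, Cmod u = r -> Cmod (h u - RtoC k) <= M) ->
  Rabs (circle_integral h r - k * (2 * PI)) <= M * (2 * PI).
Proof.
intros Hr Hc HM; pose proof PI_RGT_0.
replace (2 * PI) with (PI - - PI) by ring.
apply RInt_near_const; [lra|apply ex_RInt_circle; assumption|].
intros y _.
apply Rle_trans with (2 := HM _ (Cmod_circle_point r y (Rlt_le _ _ Hr))).
exact (Re_le_Cmod (h (circle_point r y) - RtoC k)).
Qed.

(** The Cauchy kernel for the measure [d u / u] on circles around [0]. *)
Definition cauchy_kernel (rho : R) (u : C) : C := (u / (u - RtoC rho))%C.

Lemma Cmod_dist_circles u rho : 0 <= rho -> Rabs (Cmod u - rho) <= Cmod (u - RtoC rho).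
Proof.
intros Hrho.
pose proof (Cmod_triangle (u - RtoC rho) (RtoC rho)) as H1.
pose proof (Cmod_triangle (RtoC rho - u) u) as H2.
replace (u - RtoC rho + RtoC rho)%C with u in H1 by ring.
replace (RtoC rho - u + u)%C with (RtoC rho) in H2 by ring.
replace (RtoC rho - u)%C with (- (u - RtoC rho))%C in H2 by ring.
rewrite Cmod_opp in H2; rewrite Cmod_R, Rabs_pos_eq in H1, H2 by exact Hrho.
apply Rabs_le; lra.
Qed.

Lemma minus_rho_neq_0 u rho : 0 <= rho -> Cmod u <> rho -> (u - RtoC rho)%C <> 0.
Proof.
intros Hrho Hne E; pose proof (Cmod_dist_circles u rho Hrho) as H.
rewrite E, Cmod_0 in H; pose proof (Rabs_pos (Cmod u - rho)).
destruct (Req_dec (Cmod u - rho) 0) as [Z|Z]; [lra|].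
pose proof (Rabs_pos_lt _ Z); lra.
Qed.

Lemma cauchy_kernel_derivable rho u : (u - RtoC rho)%C <> 0 ->
  C_derivable (cauchy_kernel rho) u.
Proof.
intros H; apply (C_derivable_div (fun u => u) (fun u => u - RtoC rho)%C);
  [apply C_derivable_id| |exact H].
apply (C_derivable_minus (fun u => u) (fun _ => RtoC rho));
  [apply C_derivable_id|apply C_derivable_const].
Qed.

Lemma cauchy_kernel_integral_const rho s r : 0 < s -> s < r -> 0 <= rho ->
  rho < s \/ r < rho ->
  circle_integral (cauchy_kernel rho) s = circle_integral (cauchy_kernel rho) r.
Proof.
intros Hs Hsr Hrho Hout.
assert (H : forall u, s <= Cmod u <= r -> C_derivable (cauchy_kernel rho) u).
{ intros u Hu; apply cauchy_kernel_derivable, minus_rho_neq_0; lra. }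
apply (circle_integral_const _ s r ((s + r) / 2)); try lra.
- apply C_derivable_continuous, H; rewrite Cmod_R, Rabs_pos_eq; lra.
- intros u Hu _; apply H, Hu.
Qed.

Lemma Cmod_div_le (u v : C) M : v <> 0 -> Cmod u <= M * Cmod v -> Cmod (u / v) <= M.
Proof.
intros Hv H; rewrite Cmod_div by exact Hv.
pose proof (proj1 (Cmod_gt_0 v) Hv) as Hm.
apply Rmult_le_reg_r with (Cmod v); [exact Hm|].
unfold Rdiv; rewrite Rmult_assoc, Rinv_l, Rmult_1_r by lra; exact H.
Qed.

Lemma cauchy_kernel_le rho u : 0 <= rho -> Cmod u <> rho ->
  Cmod (cauchy_kernel rho u) <= Cmod u / Rabs (Cmod u - rho).
Proof.
intros Hrho Hne.
assert (Hp : 0 < Rabs (Cmod u - rho)) by (apply Rabs_pos_lt; lra).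
apply Cmod_div_le; [apply minus_rho_neq_0; assumption|].
pose proof (Cmod_dist_circles u rho Hrho) as H.
replace (Cmod u) with (Cmod u / Rabs (Cmod u - rho) * Rabs (Cmod u - rho)) at 1 by (field; lra).
apply Rmult_le_compat_l; [|exact H].
apply Rmult_le_pos; [apply Cmod_ge_0|apply Rlt_le, Rinv_0_lt_compat, Hp].
Qed.

(** The integral does not depend on [r < rho] and the kernel tends to [0] with
    [r]. *)
Lemma cauchy_kernel_integral_inside rho r : 0 < r -> r < rho ->
  circle_integral (cauchy_kernel rho) r = 0.
Proof.
intros Hr Hrho; apply NNPP; intros Hne; pose proof PI_RGT_0 as Hpi.
set (eta := Rabs (circle_integral (cauchy_kernel rho) r)).
assert (Heta : 0 < eta) by (apply Rabs_pos_lt, Hne).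
set (s := Rmin (r / 2) (eta * (rho - r) / (4 * PI))).
assert (Hs0 : 0 < s).
{ apply Rmin_glb_lt; [lra|apply Rdiv_lt_0_compat; [apply Rmult_lt_0_compat|]; lra]. }
assert (Hs1 : s <= r / 2) by apply Rmin_l.
assert (Hs2 : s <= eta * (rho - r) / (4 * PI)) by apply Rmin_r.
assert (Hb : Rabs (circle_integral (cauchy_kernel rho) s - 0 * (2 * PI)) <=
             s / (rho - r) * (2 * PI)).
{ apply circle_integral_near; [exact Hs0| |].
  - intros u Hu; apply C_derivable_continuous, cauchy_kernel_derivable, minus_rho_neq_0; lra.
  - intros u Hu; replace (cauchy_kernel rho u - RtoC 0)%C with (cauchy_kernel rho u) by ring.
    apply Cmod_div_le; [apply minus_rho_neq_0; lra|].
    pose proof (Cmod_dist_circles u rho ltac:(lra)) as H; rewrite Rabs_left in H by lra.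
    rewrite Hu in *.
    replace s with (s / (rho - r) * (rho - r)) at 1 by (field; lra).
    apply Rmult_le_compat_l; [|lra].
    apply Rmult_le_pos; [lra|apply Rlt_le, Rinv_0_lt_compat; lra]. }
rewrite (cauchy_kernel_integral_const rho s r) in Hb by lra.
rewrite Rmult_0_l, Rminus_0_r in Hb; fold eta in Hb.
assert (s / (rho - r) * (2 * PI) <= eta / 2); [|lra].
apply Rle_trans with (eta * (rho - r) / (4 * PI) / (rho - r) * (2 * PI)).
- apply Rmult_le_compat_r; [lra|].
  apply Rmult_le_compat_r; [apply Rlt_le, Rinv_0_lt_compat; lra|exact Hs2].
- right; field; lra.
Qed.

(** The integral does not depend on [r > rho] and the kernel tends to [1] at
    infinity. *)
Lemma cauchy_kernel_integral_outside rho r : 0 < rho -> rho < r ->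
  circle_integral (cauchy_kernel rho) r = 2 * PI.
Proof.
intros Hrho Hr; apply NNPP; intros Hne; pose proof PI_RGT_0 as Hpi.
set (eta := Rabs (circle_integral (cauchy_kernel rho) r - 1 * (2 * PI))).
assert (Heta : 0 < eta) by (apply Rabs_pos_lt; lra).
assert (Hq : 0 < rho * (4 * PI) / eta).
{ apply Rdiv_lt_0_compat; [apply Rmult_lt_0_compat; lra|exact Heta]. }
set (s := r + rho * (4 * PI) / eta).
assert (Hb : Rabs (circle_integral (cauchy_kernel rho) s - 1 * (2 * PI)) <=
             rho / (rho * (4 * PI) / eta) * (2 * PI)).
{ apply circle_integral_near; [unfold s; lra| |].
  - intros u Hu; apply C_derivable_continuous, cauchy_kernel_derivable, minus_rho_neq_0;
      [lra|rewrite Hu; unfold s; lra].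
  - intros u Hu.
    assert (Hn : (u - RtoC rho)%C <> 0) by (apply minus_rho_neq_0; [lra|rewrite Hu; unfold s; lra]).
    replace (cauchy_kernel rho u - RtoC 1)%C with (RtoC rho / (u - RtoC rho))%C
      by (unfold cauchy_kernel; field; exact Hn).
    apply Cmod_div_le; [exact Hn|].
    pose proof (Cmod_dist_circles u rho ltac:(lra)) as H.
    rewrite Hu, Rabs_pos_eq in H by (unfold s; lra).
    rewrite Cmod_R, Rabs_pos_eq by lra.
    set (q := rho * (4 * PI) / eta) in *.
    replace rho with (rho / q * q) at 1 by (field; lra).
    apply Rmult_le_compat_l; [|unfold s in H; lra].
    apply Rmult_le_pos; [lra|apply Rlt_le, Rinv_0_lt_compat; lra]. }
rewrite <- (cauchy_kernel_integral_const rho r s) in Hb by (unfold s; lra).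
fold eta in Hb.
replace (rho / (rho * (4 * PI) / eta) * (2 * PI)) with (eta / 2) in Hb by (field; lra).
lra.
Qed.

(** The difference quotient, completed by the derivative, removes the
    singularity at [z]. *)
Lemma C_slope_continuous h z l : 
  (forall eps, 0 < eps -> exists d, 0 < d /\ forall y, Cmod (y - z) < d ->
    Cmod (h y - h z - (y - z) * l) <= eps * Cmod (y - z)) ->
  C_continuous (fun u => if excluded_middle_informative (u = z) then l
                         else (h u - h z) / (u - z))%C z.
Proof.
intros H eps He; destruct (H (eps / 2) ltac:(lra)) as [d [Hd Hh]].
exists d; split; [exact Hd|intros y Hy].
destruct (excluded_middle_informative (z = z)) as [_|N]; [|contradiction].
destruct (excluded_middle_informative (y = z)) as [->|Hne].
- replace (l - l)%C with (RtoC 0) by ring; rewrite Cmod_0; exact He.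
- assert (Hn : (y - z)%C <> 0).
  { intros E; apply Hne; replace y with (y - z + z)%C by ring; rewrite E; ring. }
  replace ((h y - h z) / (y - z) - l)%C
    with ((h y - h z - (y - z) * l) / (y - z))%C by (field; exact Hn).
  apply Rle_lt_trans with (eps / 2); [apply Cmod_div_le; [exact Hn|apply Hh, Hy]|lra].
Qed.

Lemma C_continuous_mult f g z : C_continuous f z -> C_continuous g z ->
  C_continuous (fun u => f u * g u)%C z.
Proof.
intros Hf Hg eps He.
set (A := Cmod (f z)); set (B := Cmod (g z)).
assert (HA : 0 <= A) by apply Cmod_ge_0; assert (HB : 0 <= B) by apply Cmod_ge_0.
set (e := Rmin 1 (eps / (A + B + 2))).
assert (He0 : 0 < e) by (apply Rmin_glb_lt; [lra|apply Rdiv_lt_0_compat; lra]).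
assert (He1 : e <= 1) by apply Rmin_l.
assert (He2 : e * (A + B + 2) <= eps).
{ apply Rle_trans with (eps / (A + B + 2) * (A + B + 2)).
  - apply Rmult_le_compat_r; [lra|apply Rmin_r].
  - right; field; lra. }
clearbody e.
destruct (Hf e He0) as [d1 [Hd1 H1]]; destruct (Hg e He0) as [d2 [Hd2 H2]].
exists (Rmin d1 d2); split; [apply Rmin_glb_lt; assumption|intros y Hy].
pose proof (Rmin_l d1 d2); pose proof (Rmin_r d1 d2).
specialize (H1 y ltac:(lra)); specialize (H2 y ltac:(lra)).
replace (f y * g y - f z * g z)%C
  with ((f y - f z) * (g y - g z) + ((f y - f z) * g z + f z * (g y - g z)))%C by ring.
eapply Rle_lt_trans; [apply Cmod_triangle|].
eapply Rle_lt_trans; [apply Rplus_le_compat_l, Cmod_triangle|].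
rewrite !Cmod_mult; fold A B.
pose proof (Cmod_ge_0 (f y - f z)); pose proof (Cmod_ge_0 (g y - g z)).
nra.
Qed.

(** Cauchy's formula for the annulus.  The function [u * slope u], where [slope]
    is the difference quotient of [h] at [rho], has the same integral over both
    circles; it equals [h * kernel - c * kernel], and the kernel has integral
    [0] on the inner and [2 * PI] on the outer circle.  As [c] is real, the real
    parts suffice. *)
Lemma annulus_estimate_real h rho r1 r2 M1 M2 : 0 < r1 -> r1 < rho -> rho < r2 ->
  (forall u : C, u <> 0 -> C_derivable h u) ->
  (forall u, Cmod u = r1 -> Cmod (h u) <= M1) ->
  (forall u, Cmod u = r2 -> Cmod (h u) <= M2) ->
  forall c, h (RtoC rho) = RtoC c ->
  Rabs c <= M1 * (r1 / (rho - r1)) + M2 * (r2 / (r2 - rho)).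
Proof.
intros Hr1 Hrho Hr2 Hh HM1 HM2 c Hc; pose proof PI_RGT_0 as Hpi.
assert (Hne : forall u, u <> RtoC rho -> (u - RtoC rho)%C <> 0).
{ intros u Hu E; apply Hu; replace u with (u - RtoC rho + RtoC rho)%C by ring.
  rewrite E; ring. }
assert (Hz : RtoC rho <> RtoC 0) by (intros E; injection E as E; lra).
pose proof (proj1 (C_derivable_epsilon h (RtoC rho)) (Hh _ Hz)) as [l Hl].
set (slope := fun u => (if excluded_middle_informative (u = RtoC rho) then l
                        else (h u - h (RtoC rho)) / (u - RtoC rho))%C).
set (H := fun u => (u * slope u)%C).
assert (HHder : forall u : C, u <> 0 -> u <> RtoC rho -> C_derivable H u).
{ intros u Hu0 Hu.
  (* away from [rho] the completed quotient is locally the plain one *)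
  apply (C_derivable_ext_loc (fun u => u * ((h u - h (RtoC rho)) / (u - RtoC rho)))%C
    H u (Cmod (u - RtoC rho))).
  - apply Cmod_gt_0, Hne, Hu.
  - intros v Hv; unfold H, slope.
    destruct (excluded_middle_informative (v = RtoC rho)) as [->|_]; [|reflexivity].
    replace (RtoC rho - u)%C with (- (u - RtoC rho))%C in Hv by ring.
    rewrite Cmod_opp in Hv; lra.
  - apply (C_derivable_mult (fun u => u)); [apply C_derivable_id|].
    apply (C_derivable_div (fun u => h u - h (RtoC rho))%C (fun u => u - RtoC rho)%C);
      [| |apply Hne, Hu].
    + apply (C_derivable_minus h (fun _ => h (RtoC rho))); [apply Hh, Hu0|apply C_derivable_const].
    + apply (C_derivable_minus (fun u => u) (fun _ => RtoC rho));
        [apply C_derivable_id|apply C_derivable_const]. }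
assert (HHcont : C_continuous H (RtoC rho)).
{ apply C_continuous_mult; [apply C_derivable_continuous, C_derivable_id|].
  apply C_slope_continuous, Hl. }
assert (Hconst : circle_integral H r1 = circle_integral H r2).
{ apply (circle_integral_const H r1 r2 rho); [exact Hr1|lra|exact HHcont|].
  intros u Hu Hu'; apply HHder; [|exact Hu'].
  intros ->; rewrite Cmod_0 in Hu; lra. }
set (F := fun u => (h u * cauchy_kernel rho u)%C).
assert (Hnz : forall (u : C) r, 0 < r -> Cmod u = r -> u <> 0)
  by (intros u r Hr Hu ->; rewrite Cmod_0 in Hu; lra).
assert (HF : forall r, 0 < r -> r <> rho -> forall u, Cmod u = r -> C_continuous F u).
{ intros r Hr Hrr u Hu; apply C_derivable_continuous, C_derivable_mult.
  - apply Hh, (Hnz u r Hr Hu).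
  - apply cauchy_kernel_derivable, minus_rho_neq_0; lra. }
assert (HK : forall r, 0 < r -> r <> rho -> forall u, Cmod u = r -> C_continuous (cauchy_kernel rho) u).
{ intros r Hr Hrr u Hu; apply C_derivable_continuous, cauchy_kernel_derivable, minus_rho_neq_0; lra. }
assert (Hsplit : forall r, 0 < r -> r <> rho ->
  circle_integral H r = circle_integral F r - c * circle_integral (cauchy_kernel rho) r).
{ intros r Hr Hrr; unfold circle_integral.
  transitivity (RInt (fun y => minus (fst (F (circle_point r y)))
     (scal c (fst (cauchy_kernel rho (circle_point r y))))) (- PI) PI).
  - apply RInt_ext; intros y _.
    pose proof (Cmod_circle_point r y ltac:(lra)) as Hm.
    set (u := circle_point r y) in *.
    assert (Hu : u <> RtoC rho).
    { intros E; rewrite E, Cmod_R, Rabs_pos_eq in Hm; lra. }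
    assert (E : H u = (F u - RtoC c * cauchy_kernel rho u)%C).
    { unfold H, slope, F, cauchy_kernel.
      destruct (excluded_middle_informative (u = RtoC rho)) as [|_]; [contradiction|].
      rewrite Hc; field; apply Hne, Hu. }
    rewrite E; unfold minus, plus, opp, scal; simpl; unfold mult; simpl; ring.
  - rewrite (RInt_minus (V := R_CompleteNormedModule)).
    + rewrite (RInt_scal (V := R_CompleteNormedModule)); [reflexivity|].
      apply ex_RInt_circle; [exact Hr|exact (HK r Hr Hrr)].
    + apply ex_RInt_circle; [exact Hr|exact (HF r Hr Hrr)].
    + apply (ex_RInt_scal (V := R_NormedModule)).
      apply ex_RInt_circle; [exact Hr|exact (HK r Hr Hrr)]. }
rewrite !Hsplit, cauchy_kernel_integral_inside, cauchy_kernel_integral_outside in Hconst by lra.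
assert (Hbound : forall r M, 0 < r -> r <> rho -> (forall u, Cmod u = r -> Cmod (h u) <= M) ->
  Rabs (circle_integral F r - 0 * (2 * PI)) <= M * (r / Rabs (r - rho)) * (2 * PI)).
{ intros r M Hr Hrr HM; apply circle_integral_near; [exact Hr|exact (HF r Hr Hrr)|].
  intros u Hu; replace (F u - RtoC 0)%C with (F u) by ring.
  unfold F; rewrite Cmod_mult; apply Rmult_le_compat; try apply Cmod_ge_0; [apply HM, Hu|].
  rewrite <- Hu; apply cauchy_kernel_le; lra. }
pose proof (Hbound r1 M1 Hr1 ltac:(lra) HM1) as B1.
pose proof (Hbound r2 M2 ltac:(lra) ltac:(lra) HM2) as B2.
rewrite (Rabs_left (r1 - rho)) in B1 by lra; rewrite (Rabs_pos_eq (r2 - rho)) in B2 by lra.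
replace (- (r1 - rho)) with (rho - r1) in B1 by ring.
apply Rabs_le_between in B1; apply Rabs_le_between in B2.
apply Rmult_le_reg_r with (2 * PI); [lra|].
rewrite <- (Rabs_pos_eq (2 * PI)) at 1 by lra; rewrite <- Rabs_mult.
apply Rabs_le; lra.
Qed.

(** A factor of modulus one makes the value at [rho] real. *)
Lemma annulus_estimate h rho r1 r2 M1 M2 : 0 < r1 -> r1 < rho -> rho < r2 ->
  (forall u : C, u <> 0 -> C_derivable h u) ->
  (forall u, Cmod u = r1 -> Cmod (h u) <= M1) ->
  (forall u, Cmod u = r2 -> Cmod (h u) <= M2) ->
  Cmod (h (RtoC rho)) <= M1 * (r1 / (rho - r1)) + M2 * (r2 / (r2 - rho)).
Proof.
intros Hr1 Hrho Hr2 Hh HM1 HM2.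
set (a := h (RtoC rho)).
destruct (classic (a = 0)) as [Z|Z].
- rewrite Z, Cmod_0, <- Rabs_R0.
  apply (annulus_estimate_real h rho r1 r2 M1 M2); assumption.
- assert (Hm : 0 < Cmod a) by (apply Cmod_gt_0; exact Z).
  set (k := (Cconj a / RtoC (Cmod a))%C).
  assert (Hma : RtoC (Cmod a) <> RtoC 0) by (intros E; injection E as E; lra).
  assert (Hk : Cmod k = 1).
  { unfold k; rewrite Cmod_div, Cmod_conj, Cmod_R, Rabs_pos_eq by (try exact Hma; lra).
    field; lra. }
  assert (Hka : (k * a)%C = RtoC (Cmod a)).
  { unfold k; replace (Cconj a / RtoC (Cmod a) * a)%C with ((a * Cconj a) / RtoC (Cmod a))%C
      by (field; exact Hma).
    replace (a * Cconj a)%C with (RtoC (Cmod a) * RtoC (Cmod a))%C; [field; exact Hma|].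
    rewrite <- RtoC_mult, Cmod_sqr; destruct a as [x y].
    apply injective_projections; simpl; ring. }
  rewrite <- (Rabs_pos_eq (Cmod a)) by lra.
  apply (annulus_estimate_real (fun u => k * h u)%C rho r1 r2 M1 M2); try assumption.
  + intros u Hu; apply (C_derivable_mult (fun _ => k) h); [apply C_derivable_const|apply Hh, Hu].
  + intros u Hu; rewrite Cmod_mult, Hk, Rmult_1_l; apply HM1, Hu.
  + intros u Hu; rewrite Cmod_mult, Hk, Rmult_1_l; apply HM2, Hu.
Qed.

(** * Essential weights and the equivalences *)

Lemma le_of_powers_le x b q : 0 <= x -> 0 <= b ->
  (forall n, x ^ n <= b ^ n * q) -> x <= b.
Proof.
intros Hx Hb H; apply Rnot_lt_le; intros Hlt.
destruct Hb as [Hb| <-].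
- assert (H1 : 1 < x / b).
  { apply Rmult_lt_reg_r with b; [exact Hb|].
    unfold Rdiv; rewrite Rmult_assoc, Rinv_l by lra; lra. }
  destruct (Pow_x_infinity (x / b) ltac:(rewrite Rabs_pos_eq; lra) (q + 1)) as [n Hn].
  specialize (Hn n (le_n n)); rewrite Rabs_pos_eq in Hn by (apply pow_le; lra).
  unfold Rdiv in Hn; rewrite Rpow_mult_distr, pow_inv in Hn.
  specialize (H n); pose proof (pow_lt b n Hb) as Hp.
  apply Rge_le, Rmult_le_compat_r with (r := b ^ n) in Hn; [|lra].
  rewrite Rmult_assoc, Rinv_l in Hn by lra; lra.
- specialize (H 1%nat); simpl in H; lra.
Qed.

Lemma C_derivable_div_pow f m (u : C) : C_derivable f u -> u <> 0 ->
  C_derivable (fun u => f u / u ^ m)%C u.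
Proof.
intros Hf Hu; apply (C_derivable_div f (fun u => u ^ m)%C); [exact Hf| |apply Cpow_nz, Hu].
apply (C_derivable_pow (fun u => u)), C_derivable_id.
Qed.

Lemma Cmod_div_pow a m (u : C) : u <> 0 -> Cmod (a / u ^ m) = Cmod a / Cmod u ^ m.
Proof. intros Hu; rewrite Cmod_div, Cmod_pow by (apply Cpow_nz, Hu); reflexivity. Qed.

(** Maximum principle for [f u / u ^ k].  The estimate in the annulus holds for
    all its powers with the same constant, which disappears after extraction of
    roots. *)
Lemma two_circle_maximum f k rho r1 r2 B : 0 < r1 -> r1 < rho -> rho < r2 -> 0 <= B ->
  (forall u : C, u <> 0 -> C_derivable f u) ->
  (forall u, Cmod u = r1 \/ Cmod u = r2 -> Cmod (f u) <= B * (Cmod u / rho) ^ k) ->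
  Cmod (f (RtoC rho)) <= B.
Proof.
intros Hr1 Hrho Hr2 HB Hf Hle.
assert (Hp : 0 < rho ^ k) by (apply pow_lt; lra).
set (b := B / rho ^ k).
assert (Hb : 0 <= b) by (apply Rmult_le_pos; [exact HB|apply Rlt_le, Rinv_0_lt_compat, Hp]).
set (g := fun u => (f u / u ^ k)%C).
assert (Hg : forall u, Cmod u = r1 \/ Cmod u = r2 -> Cmod (g u) <= b).
{ intros u Hu.
  assert (Hm : 0 < Cmod u) by (destruct Hu; lra).
  unfold g; rewrite Cmod_div_pow by (apply Cmod_gt_0, Hm).
  pose proof (pow_lt _ k Hm) as Hmk; specialize (Hle u Hu).
  apply Rmult_le_reg_r with (Cmod u ^ k); [exact Hmk|].
  replace (Cmod (f u) / Cmod u ^ k * Cmod u ^ k) with (Cmod (f u)) by (field; lra).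
  apply Rle_trans with (1 := Hle); right; unfold b, Rdiv.
  rewrite Rpow_mult_distr, pow_inv; ring. }
assert (Hrho0 : RtoC rho <> RtoC 0) by (intros E; injection E as E; lra).
assert (Hgrho : Cmod (g (RtoC rho)) <= b).
{ apply le_of_powers_le with (r1 / (rho - r1) + r2 / (r2 - rho)); [apply Cmod_ge_0|exact Hb|].
  intros n; rewrite <- Cmod_pow.
  assert (Hn : forall u, Cmod u = r1 \/ Cmod u = r2 -> Cmod (g u ^ n) <= b ^ n).
  { intros u Hu; rewrite Cmod_pow; apply pow_incr; split; [apply Cmod_ge_0|apply Hg, Hu]. }
  rewrite Rmult_plus_distr_l.
  apply (annulus_estimate (fun u => g u ^ n)%C rho r1 r2 (b ^ n) (b ^ n)); auto.
  intros u Hu; apply (C_derivable_pow g), C_derivable_div_pow; auto. }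
unfold g in Hgrho; rewrite Cmod_div_pow, Cmod_R, Rabs_pos_eq in Hgrho by (try exact Hrho0; lra).
apply Rmult_le_reg_r with (/ rho ^ k); [apply Rinv_0_lt_compat, Hp|exact Hgrho].
Qed.

(** Dividing by [u ^ (k + 1)], the exponent of the outer bound, makes the outer
    circle contribute at most [2 * S].  On the inner circle the bound then has
    the factor [1 / r1], which is compensated by the [r1] in the numerator of
    the kernel. *)
Lemma two_circle_gap f k rho r1 r2 S : 0 < r1 -> 2 * r1 <= rho -> 2 * rho <= r2 -> 0 <= S ->
  (forall u : C, u <> 0 -> C_derivable f u) ->
  (forall u, Cmod u = r1 -> Cmod (f u) <= S * (r1 / rho) ^ k) ->
  (forall u, Cmod u = r2 -> Cmod (f u) <= S * (r2 / rho) ^ (k + 1)) ->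
  Cmod (f (RtoC rho)) <= 4 * S.
Proof.
intros Hr1 Hrho Hr2 HS Hf H1 H2.
assert (Hpk : 0 < rho ^ k) by (apply pow_lt; lra).
assert (Hp : 0 < rho ^ (k + 1)) by (apply pow_lt; lra).
assert (Hr1k : 0 < r1 ^ k) by (apply pow_lt; lra).
assert (Hr2k : 0 < r2 ^ (k + 1)) by (apply pow_lt; lra).
assert (Hrho0 : RtoC rho <> RtoC 0) by (intros E; injection E as E; lra).
pose proof (annulus_estimate (fun u => f u / u ^ (k + 1))%C rho r1 r2
  (S / (rho ^ k * r1)) (S / rho ^ (k + 1)) Hr1 ltac:(lra) ltac:(lra)) as H.
cbv beta in H; rewrite Cmod_div_pow, Cmod_R, Rabs_pos_eq in H by (try exact Hrho0; lra).
apply Rmult_le_reg_r with (/ rho ^ (k + 1)); [apply Rinv_0_lt_compat, Hp|].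
eapply Rle_trans; [apply H|].
- intros u Hu; apply C_derivable_div_pow; auto.
- intros u Hu.
  rewrite Cmod_div_pow, Hu by (apply Cmod_gt_0; lra).
  apply Rmult_le_reg_r with (r1 ^ (k + 1)); [apply pow_lt, Hr1|].
  replace (Cmod (f u) / r1 ^ (k + 1) * r1 ^ (k + 1)) with (Cmod (f u))
    by (field; apply pow_nonzero; lra).
  apply Rle_trans with (1 := H1 u Hu); right.
  unfold Rdiv; rewrite Rpow_mult_distr, pow_inv, pow_add, pow_1; field; lra.
- intros u Hu.
  rewrite Cmod_div_pow, Hu by (apply Cmod_gt_0; lra).
  apply Rmult_le_reg_r with (r2 ^ (k + 1)); [exact Hr2k|].
  replace (Cmod (f u) / r2 ^ (k + 1) * r2 ^ (k + 1)) with (Cmod (f u)) by (field; lra).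
  apply Rle_trans with (1 := H2 u Hu); right.
  unfold Rdiv; rewrite Rpow_mult_distr, pow_inv; field; lra.
- assert (A1 : S / (rho ^ k * r1) * (r1 / (rho - r1)) <= 2 * S / rho ^ (k + 1)).
  { rewrite pow_add, pow_1.
    replace (S / (rho ^ k * r1) * (r1 / (rho - r1))) with (S / rho ^ k * / (rho - r1)) by (field; lra).
    replace (2 * S / (rho ^ k * rho)) with (S / rho ^ k * / (rho / 2)) by (field; lra).
    apply Rmult_le_compat_l; [apply Rmult_le_pos; [exact HS|apply Rlt_le, Rinv_0_lt_compat, Hpk]|].
    apply Rinv_le_contravar; lra. }
  assert (A2 : S / rho ^ (k + 1) * (r2 / (r2 - rho)) <= 2 * S / rho ^ (k + 1)).
  { replace (2 * S / rho ^ (k + 1)) with (S / rho ^ (k + 1) * 2) by (field; lra).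
    apply Rmult_le_compat_l; [apply Rmult_le_pos; [exact HS|apply Rlt_le, Rinv_0_lt_compat, Hp]|].
    apply Rmult_le_reg_r with (r2 - rho); [lra|].
    unfold Rdiv; rewrite Rmult_assoc, Rinv_l by lra; lra. }
  unfold Rdiv in *; lra.
Qed.

Section Essential_weight.
Variable w : R -> R.
Hypothesis w_weight : weight_function w.

(** Since [w] is at least [w 0 > 0], the inequalities force [r j / t] to tend to
    [1]; as [w (r j) < S], the bound follows by continuity at [t]. *)
Lemma small_witnesses_bound t S (r : nat -> R) : 0 < t -> 0 < S ->
  (forall j, 0 < r j < t) -> (forall j, w (r j) < S * (r j / t) ^ j) -> w t <= S.
Proof.
intros Ht HS Hr Hw; destruct w_weight as [Hpos [Hmono [Hcont _]]].
apply Rnot_lt_le; intros Hlt.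
destruct (proj1 (continuous_on_nonneg w) Hcont t (w t - S) ltac:(lra) ltac:(lra)) as [d [Hd Hc]].
set (s := Rmax (t / 2) (t - d / 2)).
assert (Hs1 : t / 2 <= s) by apply Rmax_l.
assert (Hs2 : t - d / 2 <= s) by apply Rmax_r.
assert (Hs3 : s < t) by (apply Rmax_lub_lt; lra).
specialize (Hc s ltac:(lra) ltac:(apply Rabs_lt_between; lra)).
apply Rabs_lt_between in Hc.
assert (Hw0 : 0 < w 0) by (apply Hpos; lra).
assert (Hst : 0 <= s / t < 1).
{ split; [apply Rmult_le_pos; [lra|apply Rlt_le, Rinv_0_lt_compat, Ht]|].
  apply Rmult_lt_reg_r with t; [exact Ht|].
  unfold Rdiv; rewrite Rmult_assoc, Rinv_l by lra; lra. }
destruct (pow_lt_1_zero (s / t) ltac:(rewrite Rabs_pos_eq; lra) (w 0 / S)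
  ltac:(apply Rdiv_lt_0_compat; lra)) as [N HN].
specialize (HN N (le_n N)); rewrite Rabs_pos_eq in HN by (apply pow_le; lra).
destruct (Hr N) as [Hr1 Hr2]; specialize (Hw N).
pose proof (Hmono 0 (r N) ltac:(lra) ltac:(lra)) as H0.
destruct (Rle_dec (r N) s) as [Hle|Hgt].
- assert ((r N / t) ^ N <= (s / t) ^ N).
  { apply pow_incr; split.
    - apply Rmult_le_pos; [lra|apply Rlt_le, Rinv_0_lt_compat, Ht].
    - apply Rmult_le_compat_r; [apply Rlt_le, Rinv_0_lt_compat, Ht|exact Hle]. }
  apply Rmult_lt_compat_l with (r := S) in HN; [|exact HS].
  replace (S * (w 0 / S)) with (w 0) in HN by (field; lra).
  nra.
- pose proof (Hmono s (r N) ltac:(lra) ltac:(lra)).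
  assert ((r N / t) ^ N <= 1 ^ N).
  { apply pow_incr; split.
    - apply Rmult_le_pos; [lra|apply Rlt_le, Rinv_0_lt_compat, Ht].
    - apply Rmult_le_reg_r with t; [exact Ht|].
      unfold Rdiv; rewrite Rmult_assoc, Rinv_l by lra; lra. }
  rewrite pow1 in *; nra.
Qed.

(** The radii of two consecutive exponents that enclose [t] bound [f t]; if no
    radius reaches [t], they accumulate at [t] and bound [w t] itself. *)
Lemma entire_bound_by_monomials f t S : 0 < t -> 0 < S -> entire f ->
  (forall u, Cmod (f u) <= w (Cmod u)) ->
  (forall j, exists r, 0 < r /\ w r < S * (r / t) ^ j) ->
  Cmod (f (RtoC t)) <= 4 * S.
Proof.
intros Ht HS Hf Hfw Hex; destruct w_weight as [Hpos [Hmono _]].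
assert (Hft : forall v, w t <= v -> v <= 4 * S -> Cmod (f (RtoC t)) <= 4 * S).
{ intros v H1 H2; specialize (Hfw (RtoC t)).
  rewrite Cmod_R, Rabs_pos_eq in Hfw by lra; lra. }
assert (Hder : forall u : C, u <> 0 -> C_derivable f u) by (intros; apply entire_C_derivable, Hf).
set (r := fun j => proj1_sig (constructive_indefinite_description _ (Hex j))).
assert (Hr : forall j, 0 < r j /\ w (r j) < S * (r j / t) ^ j)
  by (intros j; exact (proj2_sig (constructive_indefinite_description _ (Hex j)))).
destruct (classic (exists j, t <= r j)) as [Hj|Hno].
2:{ apply (Hft S); [|lra].
  apply (small_witnesses_bound t S r); try assumption.
  - intros j; split; [apply Hr|apply Rnot_le_lt; intros H; apply Hno; eauto].
  - apply Hr. }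
assert (Hleast : exists j, t <= r j /\ forall i, (i < j)%nat -> r i < t).
{ destruct Hj as [j Hj]; revert Hj.
  induction j as [j IH] using (well_founded_induction lt_wf); intros Hj.
  destruct (classic (exists i, (i < j)%nat /\ t <= r i)) as [[i [Hi1 Hi2]]|N].
  - exact (IH i Hi1 Hi2).
  - exists j; split; [exact Hj|intros i Hi; apply Rnot_le_lt; intros H; apply N; eauto]. }
destruct Hleast as [j [Hj1 Hj2]].
destruct (Hr j) as [Hr0 Hrj].
destruct j as [|k].
(* if already [r 0 >= t], monotonicity of [w] bounds [w t] by [S] *)
{ apply (Hft (w (r O))); [apply Hmono; lra|simpl in Hrj; lra]. }
specialize (Hj2 k ltac:(lia)); destruct (Hr k) as [Hk0 Hrk].
set (r1 := r k) in *; set (r2 := r (Datatypes.S k)) in *.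
destruct (Req_dec r2 t) as [E|Hne].
{ rewrite E in Hrj; replace (t / t) with 1 in Hrj by (field; lra); rewrite pow1 in Hrj.
  apply (Hft (w t)); lra. }
assert (Hlt : t < r2) by lra.
assert (F1 : forall u, Cmod u = r1 -> Cmod (f u) <= S * (r1 / t) ^ k).
{ intros u Hu; specialize (Hfw u); rewrite Hu in Hfw; lra. }
assert (F2 : forall u, Cmod u = r2 -> Cmod (f u) <= S * (r2 / t) ^ Datatypes.S k).
{ intros u Hu; specialize (Hfw u); rewrite Hu in Hfw; lra. }
assert (P1 : 0 < (r1 / t) ^ k) by (apply pow_lt, Rdiv_lt_0_compat; lra).
assert (P2 : 0 < (r2 / t) ^ k) by (apply pow_lt, Rdiv_lt_0_compat; lra).
(* a circle within a factor 2 of [t] may change its exponent by one at the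
   cost of a factor 2 *)
destruct (Rle_dec (2 * r1) t) as [G1|G1]; [destruct (Rle_dec (2 * t) r2) as [G2|G2]|].
- apply (two_circle_gap f k t r1 r2 S); try assumption; [lra|].
  intros u Hu; rewrite Nat.add_1_r; apply F2, Hu.
- apply Rle_trans with (2 * S); [|lra].
  apply (two_circle_maximum f k t r1 r2 (2 * S)); try assumption; [lra|].
  intros u [Hu|Hu]; rewrite Hu.
  + specialize (F1 u Hu); nra.
  + specialize (F2 u Hu); simpl in F2.
    apply Rle_trans with (1 := F2).
    assert (r2 / t <= 2).
    { apply Rmult_le_reg_r with t; [exact Ht|].
      unfold Rdiv; rewrite Rmult_assoc, Rinv_l by lra; lra. }
    assert (0 < S * (r2 / t) ^ k) by (apply Rmult_lt_0_compat; assumption).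
    nra.
- apply Rle_trans with (2 * S); [|lra].
  apply (two_circle_maximum f (Datatypes.S k) t r1 r2 (2 * S)); try assumption; [lra|].
  intros u [Hu|Hu]; rewrite Hu.
  + specialize (F1 u Hu); simpl.
    apply Rle_trans with (1 := F1).
    assert (1 <= 2 * (r1 / t)).
    { apply Rmult_le_reg_r with t; [exact Ht|].
      unfold Rdiv; rewrite !Rmult_assoc, Rinv_l by lra; lra. }
    assert (0 < S * (r1 / t) ^ k) by (apply Rmult_lt_0_compat; assumption).
    nra.
  + specialize (F2 u Hu).
    assert (0 < (r2 / t) ^ Datatypes.S k) by (apply pow_lt, Rdiv_lt_0_compat; lra).
    nra.
Qed.

(** If no monomial below [w] reached [w t / (8 * C2 + 1)] at [t], each exponent
    would have a violating radius, and the associated weight at [t] would be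
    less than half of what essentiality requires. *)
Lemma essential_enveloped : essential w -> enveloped_by_monomials w.
Proof.
intros [C1 [C2 [HC1 [HC2 H]]]]; pose proof w_weight as [Hpos [Hmono [Hcont _]]].
(* the constant exceeds [4 * C2], where 4 is the factor of
   [entire_bound_by_monomials], and is at least 1 to serve at [t = 0] *)
exists (8 * C2 + 1); split; [lra|].
intros t [Ht| <-].
2:{ exists O; rewrite (envelope_coeff_0 w w_weight); simpl.
  specialize (Hpos 0 ltac:(lra)); nra. }
apply NNPP; intros Hno.
assert (Hwt : 0 < w t) by (apply Hpos; lra).
set (S := w t / (8 * C2 + 1)).
assert (HS : 0 < S) by (apply Rdiv_lt_0_compat; lra).
assert (Hassoc : associated_weight w (RtoC t) <= 4 * S).
{ apply (proj2 (associated_weight_lub w w_weight (RtoC t)) (4 * S)).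
  intros y [f [Hf [Hfw ->]]].
  apply entire_bound_by_monomials; try assumption.
  intros j.
  assert (Htj : 0 < t ^ j) by (apply pow_lt, Ht).
  assert (Hnb : ~ below w j (S / t ^ j)).
  { intros Hb; apply (below_le_envelope w w_weight) in Hb.
    apply Hno; exists j.
    apply Rmult_le_compat_r with (r := t ^ j) in Hb; [|lra].
    replace (S / t ^ j * t ^ j) with S in Hb by (field; lra).
    replace (w t) with ((8 * C2 + 1) * S) by (unfold S; field; lra).
    apply Rmult_le_compat_l; lra. }
  assert (Hex : exists s, 0 <= s /\ w s < S / t ^ j * s ^ j).
  { apply NNPP; intros N; apply Hnb; split.
    - apply Rlt_le, Rdiv_lt_0_compat; assumption.
    - intros s Hs; apply Rnot_lt_le; intros Hlt; apply N; eauto. }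
  assert (E : forall s, S / t ^ j * s ^ j = S * (s / t) ^ j).
  { intros s; unfold Rdiv; rewrite Rpow_mult_distr, pow_inv; ring. }
  destruct Hex as [s [[Hs| <-] Hlt]]; rewrite E in Hlt; [eauto|].
  destruct j as [|j].
  - simpl in Hlt.
    destruct (proj1 (continuous_on_nonneg w) Hcont 0 (S - w 0) ltac:(lra) ltac:(lra)) as [d [Hd Hc]].
    exists (d / 2); split; [lra|simpl].
    specialize (Hc (d / 2) ltac:(lra)).
    rewrite Rminus_0_r, Rabs_pos_eq in Hc by lra; specialize (Hc ltac:(lra)).
    apply Rabs_lt_between in Hc; lra.
  - exfalso; unfold Rdiv in Hlt; rewrite Rmult_0_l, pow_i in Hlt by lia.
    specialize (Hpos 0 ltac:(lra)); lra. }
pose proof (proj2 (H t (Rlt_le _ _ Ht))) as H2; cbv beta in H2.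
assert (Hc : w t <= C2 * (4 * S)).
{ apply Rle_trans with (1 := H2); apply Rmult_le_compat_l; lra. }
assert (E : w t = (8 * C2 + 1) * S) by (unfold S; field; lra).
nra.
Qed.

Lemma max_modulus_essential : approximable_by_max_modulus w -> essential w.
Proof.
intros [f [Hf [C1 [C2 [HC1 [HC2 H]]]]]].
exists 1, (C2 / C1); split; [lra|split; [apply Rdiv_lt_0_compat; assumption|]].
intros t Ht; split; [rewrite Rmult_1_l; apply associated_weight_le; assumption|].
assert (Hf0 : forall u, C1 * Cmod (f u) <= w (Cmod u)).
{ intros u; apply Rle_trans with (2 := proj1 (H _ (Cmod_ge_0 u))).
  apply Rmult_le_compat_l; [lra|].
  apply (proj2 (max_modulus_max f (Cmod u) Hf (Cmod_ge_0 u))); reflexivity. }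
destruct (proj1 (max_modulus_max f t Hf Ht)) as [z [Hz Hmax]].
destruct (H t Ht) as [_ H2]; rewrite <- Hmax in H2.
(* the maximum over |z| = t is moved to the positive axis by a rotation *)
assert (Hrot : C1 * Cmod (f z) <= associated_weight w (RtoC t)).
{ destruct (Req_dec t 0) as [Z|Z].
  - rewrite Z in Hz; apply Cmod_eq_0 in Hz; subst z; rewrite Z.
    apply le_associated_weight; [exact w_weight|lra|exact Hf|exact Hf0].
  - unfold nonneg in Ht.
    set (k := (z / RtoC t)%C).
    assert (Ht0 : RtoC t <> RtoC 0) by (intros E; injection E as E; lra).
    assert (Hk : Cmod k = 1).
    { unfold k; rewrite Cmod_div, Hz, Cmod_R, Rabs_pos_eq by (try exact Ht0; lra); field; exact Z. }
    pose proof (le_associated_weight w w_weight (fun u => f (k * u)%C) C1 (RtoC t)) as L.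
    cbv beta in L; replace (k * RtoC t)%C with z in L by (unfold k; field; exact Ht0).
    apply L; [lra| |].
    + intros u.
      destruct (C_derivable_comp f (fun u => k * u)%C u) as [l Hl].
      * apply entire_C_derivable, Hf.
      * apply (C_derivable_mult (fun _ => k) (fun u => u)); [apply C_derivable_const|apply C_derivable_id].
      * exists l; apply is_derive_C_AbsRing, Hl.
    + intros u; specialize (Hf0 (k * u)%C); rewrite Cmod_mult, Hk, Rmult_1_l in Hf0; exact Hf0. }
apply Rle_trans with (1 := H2).
replace (C2 * Cmod (f z)) with (C2 / C1 * (C1 * Cmod (f z))) by (field; lra).
apply Rmult_le_compat_l; [apply Rlt_le, Rdiv_lt_0_compat; assumption|exact Hrot].
Qed.

Lemma holomorphic_map_essential : approximable_by_holomorphic_map w -> essential w.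
Proof.
intros [n [f [Hn [Hf [C1 [C2 [HC1 [HC2 H]]]]]]]].
assert (Hn0 : 0 < INR n) by (apply lt_0_INR; lia).
exists 1, (C2 * INR n / C1); split; [lra|split].
{ apply Rdiv_lt_0_compat; [apply Rmult_lt_0_compat|]; assumption. }
intros t Ht; split; [rewrite Rmult_1_l; apply associated_weight_le; assumption|].
destruct (H (RtoC t) I) as [_ H2].
rewrite Cmod_R, Rabs_pos_eq in H2 by exact Ht.
apply Rle_trans with (1 := H2).
replace (C2 * INR n / C1 * associated_weight w (RtoC t))
  with (C2 * (INR n * (associated_weight w (RtoC t) / C1))) by (field; lra).
apply Rmult_le_compat_l; [lra|].
assert (Hcomp : forall k, (k < n)%nat ->
  C1 * Cmod (coeff_Tn (RtoC 0) (f (RtoC t)) k) <= associated_weight w (RtoC t)).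
{ intros k Hk.
  apply (le_associated_weight w w_weight (fun z => coeff_Tn (RtoC 0) (f z) k)); [lra|apply Hf, Hk|].
  intros u; apply Rle_trans with (2 := proj1 (H u I)).
  apply Rmult_le_compat_l; [lra|apply coeff_le_euclidean_norm, Hk]. }
assert (Hscale : forall a, C1 * a <= associated_weight w (RtoC t) ->
  a <= associated_weight w (RtoC t) / C1).
{ intros a Ha; apply Rmult_le_reg_l with C1; [exact HC1|].
  replace (C1 * (associated_weight w (RtoC t) / C1)) with (associated_weight w (RtoC t))
    by (field; lra); exact Ha. }
apply euclidean_norm_le; [|intros k Hk; apply Hscale, Hcomp, Hk].
apply Hscale; rewrite Rmult_0_r.
apply Rle_trans with (2 := Hcomp O ltac:(lia)), Rmult_le_pos; [lra|apply Cmod_ge_0].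
Qed.

End Essential_weight.

Theorem theorem2 (w : R -> R) (hw : weight_function w) :
  (approximable_by_holomorphic_map w <-> essential w) /\
  (essential w <-> approximable_by_max_modulus w) /\
  (approximable_by_max_modulus w <-> approximable_by_power_series w) /\
  (approximable_by_power_series w <-> equivalent_to_log_tropical w).
Proof.
pose proof (holomorphic_map_essential w hw).
pose proof (max_modulus_essential w hw).
pose proof (power_series_max_modulus w).
pose proof (essential_enveloped w hw).
pose proof (enveloped_holomorphic_map w hw).
pose proof (enveloped_power_series w hw).
pose proof (enveloped_log_tropical w hw).
pose proof (log_tropical_enveloped w hw).
tauto.
Qed.
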